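(* Let $S$ be a locally trivial (smooth) stratified space. The family $\mathcal{X}_s(S)$ of all strongly stratified vector fields on $S$ is locally complete.
   Context: Stratified spaces. Let $S$ be a paracompact Hausdorff second countable space. A stratification of $S$ is a locally finite partition of $S$ into locally closed subspaces, called strata, such that: (Manifold Condition) every stratum is a smooth manifold in the induced topology; (Frontier Condition) if $M,N$ are strata and $\bar N\cap M\neq\emptyset$, then $M\subset\bar N$. A smooth chart on $S$ is a homeomorphism $\varphi$ of an open set $U\subseteq S$ onto a subspace of some $\mathbb{R}^n$ such that for every stratum $M$ the image $\varphi(U\cap M)$ is a smooth submanifold of $\mathbb{R}^n$ and $\varphi|U\cap M:U\cap M\to\varphi(U\cap M)$ is smooth. Charts $\varphi:U\to\mathbb{R}^n$, $\psi:V\to\mathbb{R}^m$ are compatible if every $x\in U\cap V$ has an open neighbourhood $U_x\subseteq U\cap V$ for which there are $N\geq\max(n,m)$, open sets $O,O'\subseteq\mathbb{R}^N$ containing $\varphi(U_x)\times\{0\}$, $\psi(U_x)\times\{0\}$ respectively, and a diffeomorphism $H:O\to O'$ with $H(\varphi(y),0)=(\psi(y),0)$ for $y\in U_x$. A smooth structure is a maximal atlas of compatible smooth charts. All stratified spaces are assumed smooth. A continuous $f:S\to\mathbb{R}$ belongs to $C^{\infty}(S)$ if for every $x\in S$ and every chart $\varphi:U\to\mathbb{R}^n$ of the atlas with $x\in U$ there are a neighbourhood $U_x\subseteq U$ of $x$ and a smooth $g:\mathbb{R}^n\to\mathbb{R}$ with $f|U_x=g\circ\varphi|U_x$. With $C^\infty(S)$,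 $S$ is a subcartesian space, i.e. a Hausdorff differential space (in Sikorski's sense) locally diffeomorphic to subsets of Cartesian spaces; a diffeomorphism $\varphi$ between such spaces is a homeomorphism such that $\varphi$ and $\varphi^{-1}$ pull back smooth functions to smooth functions. Functions on an open subset are smooth if they locally coincide with restrictions of functions in $C^\infty(S)$. Local triviality. $S$ is locally trivial if for every $x\in S$, with $M$ the stratum containing $x$, there are an open neighbourhood $U$ of $x$ in $S$, a smooth stratified space $F$ with a distinguished point $o$ such that $\{o\}$ is a stratum of $F$, and a diffeomorphism of differential spaces $\varphi:U\to(M\cap U)\times F$ (the product having strata $(M\cap U)\times N$, $N$ a stratum of $F$, and the product smooth structure) which induces smooth diffeomorphisms of the corresponding strata and satisfies $\varphi(y)=(y,o)$ for $y\in M\cap U$. Vector fields. A derivation of $C^{\infty}(S)$ is a linear map $X:f\mapsto X\cdot f$ of $C^\infty(S)$ to itself satisfying Leibniz' rule. An integral curve of $X$ through $x$ is a smooth curve $c:I\to S$, $I$ an interval (possibly a single point) containing $0$, with $c(0)=x$ and $\frac{d}{dt}f(c(t))=(X\cdot f)(c(t))$ for all $f\in C^{\infty}(S)$, $t\in I$. Every derivation has a unique maximal integral curve through each $x$; $\varphi^X_t(x)$ denotes its value at $t$. A derivation $X$ is a vector field if for every $x\in S$ there are an open neighbourhood $U$ of $x$ and $\varepsilon>0$ such that for $|t|<\varepsilon$ the map $\varphi^X_t$ is defined on $U$ and restricts to a diffeomorphism of $U$ onto an open subset of $S$. A strongly stratified vector field on $S$ is a vector field $X$ on $S$ (in this sense)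 that restricts, for every stratum $M$ of $S$, to a smooth vector field on $M$. Local completeness. For a diffeomorphism $\varphi:U\to V$ of open subsets of $S$, $\varphi_*Y$ is the derivation of $C^{\infty}(V)$ with $(\varphi_*Y)\cdot f=(Y\cdot(f\circ\varphi))\circ\varphi^{-1}$. A family $\mathcal{F}$ of vector fields is locally complete if for all $X,Y\in\mathcal{F}$, $t\in\mathbb{R}$, $x\in S$ for which $\varphi^X_{t*}Y(x)$ is defined, there exist an open neighbourhood $U$ of $x$ and $Z\in\mathcal{F}$ with $\varphi^X_{t*}Y|U=Z|U$. *)

(* Defs.v *)
From HB Require Import structures.
From mathcomp Require Import all_boot all_order all_algebra.
From mathcomp Require Import all_classical all_reals all_analysis.

Set Implicit Arguments.
Unset Strict Implicit.
Unset Printing Implicit Defensive.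

Import Order.TTheory GRing.Theory Num.Theory.
Import numFieldNormedType.Exports.

Local Open Scope classical_set_scope.
Local Open Scope ring_scope.

(* Functions, charts and operators are total Rocq functions; each notion below
   only constrains them on the set where the mathematical object lives. *)

(* [pderivs [:: i1; ...; ik] f] is the iterated partial derivative
   d_{i1} (... (d_{ik} f)). *)
Definition pderivs (R : realType) (n : nat) (s : seq 'I_n) (f : 'rV[R]_n -> R) :
    'rV[R]_n -> R :=
  foldr (fun (i : 'I_n) (g : 'rV[R]_n -> R) =>
           (fun x : 'rV[R]_n => ('D_('e_i) g x : R))) f s.

(* Meant for [O] open: all iterated partial derivatives exist and are
   continuous at the points of [O]. *)
Definition smooth_on (R : realType) (n : nat) (O : set 'rV[R]_n)
    (f : 'rV[R]_n -> R) : Prop :=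
  forall (s : seq 'I_n) (x : 'rV[R]_n), O x ->
    {for x, continuous (pderivs s f)} /\
    forall i : 'I_n, derivable (pderivs s f) x 'e_i.

Definition smooth_map_on (R : realType) (n m : nat) (O : set 'rV[R]_n)
    (h : 'rV[R]_n -> 'rV[R]_m) : Prop :=
  forall j : 'I_m, smooth_on O (fun x => h x ord0 j).

Definition Rn_diffeo (R : realType) (n : nat) (O O' : set 'rV[R]_n)
    (H : 'rV[R]_n -> 'rV[R]_n) : Prop :=
  exists G : 'rV[R]_n -> 'rV[R]_n,
    [/\ (forall z, O z -> O' (H z) /\ G (H z) = z),
        (forall z, O' z -> O (G z) /\ H (G z) = z),
        smooth_map_on O H & smooth_map_on O' G].

(* Embedded submanifolds; the dimension [k] may depend on the point. *)
Definition submanifold (R : realType) (n : nat) (P : set 'rV[R]_n) : Prop :=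
  forall p, P p ->
    exists (k : nat) (O O' : set 'rV[R]_n) (H : 'rV[R]_n -> 'rV[R]_n),
      [/\ (k <= n)%N, open O /\ open O', O p, Rn_diffeo O O' H &
          H @` (O `&` P) =
          O' `&` [set z | forall i : 'I_n, (k <= i)%N -> z ord0 i = 0]].

(* The inclusion v |-> (v, 0) of R^n into R^N (for n <= N). *)
Definition pad (R : realType) (n N : nat) (v : 'rV[R]_n) : 'rV[R]_N :=
  \row_(j < N) oapp (fun i : 'I_n => v ord0 i) 0 (insub (j : nat)).

Definition open_in (T : topologicalType) (A U : set T) : Prop :=
  exists2 W, open W & U = A `&` W.

Definition homeo_on (T T' : topologicalType) (A : set T) (B : set T')
    (f : T -> T') : Prop :=
  set_bij A B f /\
  forall V, V `<=` A -> (open_in A V <-> open_in B (f @` V)).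

Definition locally_closed (T : topologicalType) (A : set T) : Prop :=
  exists O C : set T, [/\ open O, closed C & A = O `&` C].

Definition locally_finite (T : topologicalType) (I : Type) (F : I -> set T) :
    Prop :=
  forall x, exists2 U, open_nbhs x U & finite_set [set i | F i `&` U !=set0].

Definition open_cover (T : topologicalType) (I : Type) (F : I -> set T) : Prop :=
  (forall i, open (F i)) /\ cover [set: I] F = [set: T].

Definition paracompact (T : topologicalType) : Prop :=
  forall (I : Type) (F : I -> set T), open_cover F ->
    exists (J : Type) (G : J -> set T),
      [/\ open_cover G, locally_finite G & forall j, exists i, G j `<=` F i].

Record chart (R : realType) (T : Type) := Chart {
  cdim : nat;
  cdom : set T;
  cmap : T -> 'rV[R]_cdim }.

Definition manifold_chart (R : realType) (T : topologicalType) (M : set T)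
    (a : chart R T) : Prop :=
  [/\ open_in M (cdom a), open (cmap a @` cdom a) &
      homeo_on (cdom a) (cmap a @` cdom a) (cmap a)].

Definition smooth_transition (R : realType) (T : Type) (a b : chart R T) : Prop :=
  exists2 h : 'rV[R]_(cdim a) -> 'rV[R]_(cdim b),
    smooth_map_on (cmap a @` (cdom a `&` cdom b)) h &
    forall y, cdom a y -> cdom b y -> cmap b y = h (cmap a y).

Definition manifold_compatible (R : realType) (T : Type) (a b : chart R T) :
    Prop :=
  smooth_transition a b /\ smooth_transition b a.

(* The dimension of a manifold is only required to be locally constant. *)
Definition manifold_structure (R : realType) (T : topologicalType) (M : set T)
    (At : set (chart R T)) : Prop :=
  [/\ (forall a, At a -> manifold_chart M a),
      (forall x, M x -> exists2 a, At a & cdom a x),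
      (forall a b, At a -> At b -> manifold_compatible a b) &
      (forall a, manifold_chart M a ->
         (forall b, At b -> manifold_compatible a b) -> At a)].

Definition open_submanifold (R : realType) (T : Type)
    (At : set (chart R T)) (U : set T) : set (chart R T) :=
  [set a | At a /\ cdom a `<=` U].

Definition prod_chart (R : realType) (T T' : Type) (a : chart R T)
    (b : chart R T') : chart R (T * T') :=
  @Chart R (T * T')%type (cdim a + cdim b) (cdom a `*` cdom b)
    (fun p => row_mx (cmap a p.1) (cmap b p.2)).

(* The maximal atlas generated by the product charts. *)
Definition prod_manifold (R : realType) (T T' : topologicalType)
    (M : set T) (At : set (chart R T)) (N : set T') (At' : set (chart R T')) :
    set (chart R (T * T')) :=
  [set c | manifold_chart (M `*` N) c /\
     forall a b, At a -> At' b -> manifold_compatible c (prod_chart a b)].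

(* [f] is smooth from the open subset [V] of a manifold with atlas [At] to R^n. *)
Definition manifold_smooth_to_Rn (R : realType) (T : Type)
    (At : set (chart R T)) (V : set T) (n : nat) (f : T -> 'rV[R]_n) : Prop :=
  forall a, At a ->
    exists2 h : 'rV[R]_(cdim a) -> 'rV[R]_n,
      smooth_map_on (cmap a @` (cdom a `&` V)) h &
      forall y, cdom a y -> V y -> f y = h (cmap a y).

Definition manifold_Cinf (R : realType) (T : Type) (At : set (chart R T)) :
    set (T -> R) :=
  [set f | forall a, At a ->
     exists2 g : 'rV[R]_(cdim a) -> R, smooth_on (cmap a @` cdom a) g &
       forall y, cdom a y -> f y = g (cmap a y)].

Definition manifold_smooth_map (R : realType) (T T' : topologicalType)
    (M : set T) (At : set (chart R T)) (N : set T') (At' : set (chart R T'))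
    (f : T -> T') : Prop :=
  [/\ set_fun M N f, {within M, continuous f} &
      forall a b, At a -> At' b ->
        exists2 h : 'rV[R]_(cdim a) -> 'rV[R]_(cdim b),
          smooth_map_on (cmap a @` (cdom a `&` f @^-1` cdom b)) h &
          forall y, cdom a y -> cdom b (f y) -> cmap b (f y) = h (cmap a y)].

Definition manifold_diffeo (R : realType) (T T' : topologicalType)
    (M : set T) (At : set (chart R T)) (N : set T') (At' : set (chart R T'))
    (f : T -> T') : Prop :=
  exists g : T' -> T,
    [/\ manifold_smooth_map M At N At' f, manifold_smooth_map N At' M At g,
        (forall y, M y -> g (f y) = y) & (forall z, N z -> f (g z) = z)].

(* A stratification is given as an indexed family [st] of pairwise disjoint
   nonempty sets, and [mat i] is the smooth structure of the manifold [st i].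
   [A] is the underlying set of the space, as a subspace of [T]. *)

Definition smooth_chart (R : realType) (T : topologicalType) (A : set T)
    (I : Type) (st : I -> set T) (mat : I -> set (chart R T)) (c : chart R T) :
    Prop :=
  [/\ open_in A (cdom c),
      homeo_on (cdom c) (cmap c @` cdom c) (cmap c) &
      forall i, submanifold (cmap c @` (cdom c `&` st i)) /\
                manifold_smooth_to_Rn (mat i) (cdom c `&` st i) (cmap c)].

Definition compatible (R : realType) (T : topologicalType) (c d : chart R T) :
    Prop :=
  forall x, cdom c x -> cdom d x ->
    exists (W : set T) (N : nat) (O O' : set 'rV[R]_N) (H : 'rV[R]_N -> 'rV[R]_N),
      let Ux := W `&` (cdom c `&` cdom d) in
      [/\ open_nbhs x W /\ (maxn (cdim c) (cdim d) <= N)%N,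
          open O /\ open O',
          (forall y, Ux y -> O (pad N (cmap c y)) /\ O' (pad N (cmap d y))),
          Rn_diffeo O O' H &
          forall y, Ux y -> H (pad N (cmap c y)) = pad N (cmap d y)].

Definition smooth_structure (R : realType) (T : topologicalType) (A : set T)
    (I : Type) (st : I -> set T) (mat : I -> set (chart R T))
    (At : set (chart R T)) : Prop :=
  [/\ (forall c, At c -> smooth_chart A st mat c),
      (forall x, A x -> exists2 c, At c & cdom c x),
      (forall c d, At c -> At d -> compatible c d) &
      (forall c, smooth_chart A st mat c ->
         (forall d, At d -> compatible c d) -> At c)].

Definition atlas_Cinf (R : realType) (T : topologicalType) (A : set T)
    (At : set (chart R T)) : set (T -> R) :=
  [set f | {within A, continuous f} /\
     forall x c, A x -> At c -> cdom c x ->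
       exists2 W, open_nbhs x W &
       exists2 g : 'rV[R]_(cdim c) -> R, smooth_on setT g &
         forall y, W y -> cdom c y -> f y = g (cmap c y)].

Record is_stratification (T : topologicalType) (I : Type) (st : I -> set T) :
    Prop := {
  strat_partition : partition [set: I] st [set: T];
  strat_locally_finite : locally_finite st;
  strat_locally_closed : forall i, locally_closed (st i);
  strat_frontier : forall i j,
    closure (st j) `&` st i !=set0 -> st i `<=` closure (st j) }.

Record strat_space (R : realType) := StratSpace {
  carrier :> topologicalType;
  stratum_index : Type;
  stratum : stratum_index -> set carrier;
  stratum_atlas : stratum_index -> set (chart R carrier);
  smooth_atlas : set (chart R carrier);
  strat_paracompact : paracompact carrier;
  strat_hausdorff : hausdorff_space carrier;
  strat_second_countable : @second_countable carrier;
  strat_stratification : is_stratification stratum;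
  strat_manifold : forall i, manifold_structure (stratum i) (stratum_atlas i);
  strat_smooth : smooth_structure [set: carrier] stratum stratum_atlas
                   smooth_atlas }.

Definition Cinf (R : realType) (S : strat_space R) : set (S -> R) :=
  atlas_Cinf [set: S] (@smooth_atlas R S).

Definition Cinf_on (R : realType) (S : strat_space R) (U : set S) : set (S -> R) :=
  [set f | forall x, U x ->
     exists2 W, open_nbhs x W &
     exists2 h, Cinf h & forall y, W y -> U y -> f y = h y].

(* [phi] is a diffeomorphism, with inverse [psi], from the differential space
   with underlying set [A] and smooth functions [C] to the one given by [B]
   and [D]. *)
Definition diffeo (R : realType) (T T' : topologicalType)
    (A : set T) (C : set (T -> R)) (B : set T') (D : set (T' -> R))
    (phi : T -> T') (psi : T' -> T) : Prop :=
  [/\ homeo_on A B phi,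
      (forall x, A x -> psi (phi x) = x),
      (forall f, D f -> C (f \o phi)) &
      (forall f, C f -> D (f \o psi))].

Section LocalTriviality.
Variables (R : realType) (S F : strat_space R).
Variables (i : stratum_index S) (U : set S).

Definition prod_stratum (k : stratum_index F) : set (S * F) :=
  (stratum i `&` U) `*` stratum k.

Definition prod_stratum_atlas (k : stratum_index F) : set (chart R (S * F)) :=
  prod_manifold (stratum i `&` U) (open_submanifold (stratum_atlas i) U)
    (stratum k) (stratum_atlas k).

Definition prod_set : set (S * F) := (stratum i `&` U) `*` [set: F].

(* The maximal atlas generated by the products of a chart of the manifold
   [stratum i `&` U] and a chart of the smooth structure of [F]. *)
Definition prod_atlas : set (chart R (S * F)) :=
  [set c | smooth_chart prod_set prod_stratum prod_stratum_atlas c /\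
     forall a b, open_submanifold (stratum_atlas i) U a -> smooth_atlas b ->
       compatible c (prod_chart a b)].

Definition corresponding_strata (phi : S -> S * F)
    (j : stratum_index S) (k : stratum_index F) : Prop :=
  phi @` (stratum j `&` U) = prod_stratum k /\
  manifold_diffeo (stratum j `&` U) (open_submanifold (stratum_atlas j) U)
    (prod_stratum k) (prod_stratum_atlas k) phi.

End LocalTriviality.

Definition locally_trivial (R : realType) (S : strat_space R) : Prop :=
  forall (x : S) (i : stratum_index S), stratum i x ->
    exists (U : set S) (F : strat_space R) (o : F) (k0 : stratum_index F)
           (phi : S -> S * F) (psi : S * F -> S),
      [/\ open_nbhs x U /\ stratum k0 = [set o],
          diffeo U (Cinf_on U) (@prod_set R S F i U)
            (atlas_Cinf (@prod_set R S F i U) (@prod_atlas R S F i U)) phi psi,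
          (forall j, stratum j `&` U !=set0 ->
             exists k, corresponding_strata i U phi j k),
          (forall k, exists j, corresponding_strata i U phi j k) &
          (forall y, stratum i y -> U y -> phi y = (y, o))].

Definition derivation (R : realType) (T : Type) (A : set T) (C : set (T -> R))
    (X : (T -> R) -> (T -> R)) : Prop :=
  [/\ (forall f, C f -> C (X f)),
      (forall f g, C f -> C g -> (forall x, A x -> f x = g x) ->
         forall x, A x -> X f x = X g x),
      (forall (a : R) f g, C f -> C g -> forall x, A x ->
         X (fun y => a * f y + g y) x = a * X f x + X g x) &
      (forall f g, C f -> C g -> forall x, A x ->
         X (fun y => f y * g y) x = X f x * g x + f x * X g x)].

(* Derivative of [g : I -> R] at [t], one-sided at the endpoints of [I]; no
   condition when [I] is a single point, since the filter is then trivial. *)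
Definition deriv_within (R : realType) (I : set R) (g : R -> R) (t l : R) : Prop :=
  (fun s : R => (g s - g t) / (s - t)) @ within I t^' --> l.

Definition smooth_on_interval (R : realType) (I : set R) (g : R -> R) : Prop :=
  exists2 d : nat -> R -> R, (forall t, I t -> d 0%N t = g t) &
    forall k t, I t -> deriv_within I (d k) t (d k.+1 t).

Section VectorFields.
Variables (R : realType) (S : strat_space R).

Local Notation operator := ((S -> R) -> (S -> R)).

Definition smooth_curve (I : set R) (c : R -> S) : Prop :=
  {within I, continuous c} /\
  forall f : S -> R, Cinf f -> smooth_on_interval I (f \o c).

Definition integral_curve (X : operator) (x : S) (I : set R) (c : R -> S) : Prop :=
  [/\ is_interval I, I 0, smooth_curve I c, c 0 = x &
      forall f : S -> R, Cinf f -> forall t, I t ->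
        deriv_within I (f \o c) t (X f (c t))].

Definition maximal_integral_curve (X : operator) (x : S) (I : set R)
    (c : R -> S) : Prop :=
  integral_curve X x I c /\
  forall (J : set R) (d : R -> S), integral_curve X x J d -> I `<=` J ->
    (forall t, I t -> d t = c t) -> J = I.

(* [flow X t x y] : the value at [t] of the maximal integral curve of [X]
   through [x] is defined and equal to [y]. *)
Definition flow (X : operator) (t : R) (x y : S) : Prop :=
  exists (I : set R) (c : R -> S),
    [/\ maximal_integral_curve X x I c, I t & c t = y].

(* The time-[t] flow of [X] is defined on the open set [W] and restricts to a
   diffeomorphism [phi], with inverse [psi], of [W] onto the open set [V]. *)
Definition flow_diffeo (X : operator) (t : R) (W V : set S) (phi psi : S -> S) :
    Prop :=
  [/\ open W, open V, (forall y, W y -> flow X t y (phi y)) &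
      diffeo W (Cinf_on W) V (Cinf_on V) phi psi].

Definition vector_field (X : operator) : Prop :=
  derivation [set: S] (@Cinf R S) X /\
  forall x : S, exists2 U, open_nbhs x U & exists2 e : R, 0 < e &
    forall t : R, `|t| < e ->
      exists V phi psi, flow_diffeo X t U V phi psi.

(* Smooth vector fields on the manifold [stratum i] are derivations of its
   algebra of smooth functions. *)
Definition strongly_stratified (X : operator) : Prop :=
  vector_field X /\
  forall i : stratum_index S, exists2 XM : operator,
    derivation (stratum i) (manifold_Cinf (stratum_atlas i)) XM &
    forall f : S -> R, Cinf f -> forall y, stratum i y -> X f y = XM f y.

(* Value at [x] of the restriction of the derivation [Y] to an open set
   containing [x], applied to a smooth function [f] on this open set:
   [Y h x] for any global [h] that agrees with [f] near [x].  Derivations are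
   local, so this does not depend on [h]; the default value 0 is never used
   for such an [f]. *)
Definition restr_deriv (Y : operator) (f : S -> R) (x : S) : R :=
  xget 0 [set v | exists h : S -> R,
                    [/\ Cinf h, \forall y \near x, h y = f y & Y h x = v]].

(* (phi_* Y) f = (Y (f o phi)) o phi^-1, with [psi] the inverse of [phi]. *)
Definition pushforward (phi psi : S -> S) (Y : operator) : operator :=
  fun f x => restr_deriv Y (f \o phi) (psi x).

(* The pushforward of Y by the time-[t] flow of X is defined at [x] when [x] is
   in the range of that flow.  Equality with [Z] on [U] is that of derivations
   of the smooth functions on [U], and includes that the flow is a
   diffeomorphism from some open [W] onto [U]. *)
Definition locally_complete (Fam : set operator) : Prop :=
  forall X Y, Fam X -> Fam Y -> forall (t : R) (x : S),
    (exists x0, flow X t x0 x) ->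
    exists (U : set S) (Z : operator),
      [/\ open_nbhs x U, Fam Z &
          exists (W : set S) (phi psi : S -> S),
            flow_diffeo X t W U phi psi /\
            forall f, Cinf_on U f -> forall y, U y ->
              pushforward phi psi Y f y = restr_deriv Z f y].

End VectorFields.

Definition strongly_stratified_fields (R : realType) (S : strat_space R) :
    set ((S -> R) -> (S -> R)) :=
  [set X | strongly_stratified X].

(* Main.v *)
Require Import Defs.
From mathcomp Require Import all_boot all_order all_algebra.
From mathcomp Require Import all_classical all_reals all_analysis.
From mathcomp Require Import ring lra.

(** Let [X] and [Y] be strongly stratified and let the time-[t] flow of [X]
    send [x0] to [x].  Composing flows of small time along the integral curve
    from [x0] to [x] gives a diffeomorphism [phi : W -> V], with inverse [psi],
    between open neighbourhoods of [x0] and [x], which is the time-[t] flow on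
    [W] ([local_flow]).  The pushforward of [Y] by [phi] is only defined on
    [V]; for a bump function [chi] which is 1 near [x] and supported in [V],
    the formula [Z f = chi * (Y (f \o phi) \o psi)] defines a derivation [Z] on
    all of [S] ([transport]) which is the pushforward near [x].  What has to be
    shown is that [Z] is again a strongly stratified vector field.

    [Z] is a vector field.  A derivation is a vector field as soon as near
    every point its integral curves exist for a uniform time ([flow_box]):
    there are coordinates with values in R^n, smooth on all of [S]
    ([coords_exist]), in which a derivation is the restriction of a smooth
    field of R^n ([local_field]); the flow of the latter is smooth
    ([flow_smooth]), and by uniqueness for differential equations it describes
    the integral curves of the derivation.  Integral curves of [Z] are obtained
    from those of [Y] by applying [phi] and slowing down: if [c] is an integral
    curve of [Y], then [phi (c (tau s))] is one of [Z] for the solution [tau]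
    of the scalar equation [tau' = chi (phi (c tau))]
    ([transport_loc_integrable]).

    Smooth dependence of a flow of R^n on the initial point goes as follows.
    The difference quotients of the flow converge to a solution of the
    variational equation ([flow_variation]).  So the flow together with its
    derivative is the flow of another smooth field, the tangent lift
    ([tflow_flow]), and an induction on the number of derivatives, for all
    fields simultaneously, gives [flow_smooth].

    [Z] is stratified.  The flow of [X] preserves the strata
    ([icurve_stratum]): in a chart which straightens a stratum, the transverse
    components of [X] vanish on the stratum, so along an integral curve they
    are bounded by a multiple of the transverse coordinates, which therefore
    remain zero by Gronwall.  Hence if [f] vanishes on a stratum [M] near a
    point [y], then [f \o phi] vanishes on [M] near [psi y], where [Y] kills it
    because [Y] is tangent to [M] ([tangent_zero]); so [Z] is tangent to [M].
    To conclude that [Z] induces a derivation of the smooth functions of [M],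
    these functions must extend locally to smooth functions on [S].  That is
    what local triviality gives: near a point of [M], the space is a product of
    [M] with another space, and functions extend as constants along the second
    factor ([stratum_extension], [restrict_to_stratum]). *)

Set Implicit Arguments.
Unset Strict Implicit.
Unset Printing Implicit Defensive.

Import Order.TTheory GRing.Theory Num.Theory.
Import numFieldNormedType.Exports.

Local Open Scope classical_set_scope.
Local Open Scope ring_scope.

(** * Derivatives relative to a set of reals, and Gronwall inequalities *)

Section HasDeriv.
Variable R : realType.
Implicit Types (I J : set R) (g f u : R -> R) (t l a b c s K M : R).

(** The o-form of the derivative makes sense at isolated points of [I] too,
    and at them imposes nothing; it avoids the punctured filters of
    [deriv_within]. *)
Definition has_deriv I g t l := forall e, 0 < e -> exists2 d, 0 < d &
  forall s, I s -> `|s - t| < d -> `|g s - g t - l * (s - t)| <= e * `|s - t|.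

Lemma withinP I (P : R -> Prop) t :
  (\forall s \near within I (nbhs t), P s) <->
  exists2 d, 0 < d & forall s, I s -> `|s - t| < d -> P s.
Proof.
rewrite near_withinE; split.
  move=> /nbhs_ballP[d d0 H]; exists d => // s Is sd; apply: H => //.
  by rewrite -ball_normE /ball_ /= distrC.
case=> d d0 H; apply/nbhs_ballP; exists d => // s.
by rewrite -ball_normE /ball_ /= distrC => sd Is; apply: H.
Qed.

Lemma nbhsRP (P : R -> Prop) t :
  (\forall s \near t, P s) <-> exists2 d, 0 < d & forall s, `|s - t| < d -> P s.
Proof.
split.
  move=> /nbhs_ballP[d d0 H]; exists d => // s sd; apply: H => //.
  by rewrite -ball_normE /ball_ /= distrC.
case=> d d0 H; apply/nbhs_ballP; exists d => // s.
by rewrite -ball_normE /ball_ /= distrC => sd; apply: H.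
Qed.

Lemma deriv_withinE I g t l : deriv_within I g t l <-> has_deriv I g t l.
Proof.
split.
- move=> /cvgrPdist_le H e e0; have := H e e0.
  rewrite near_withinE => /nbhs_ballP[d /= d0 Hd]; exists d => // s Is sd.
  have [->|st] := eqVneq s t; first by rewrite !subrr mulr0 subrr normr0 mulr0.
  have /Hd : ball t d s by rewrite -ball_normE /ball_ /= distrC.
  move=> /(_ st Is); have st0 : s - t != 0 by rewrite subr_eq0.
  rewrite distrC -(ler_pM2r (_ : 0 < `|s - t|)) ?normr_gt0// -normrM mulrBl.
  by rewrite mulfVK.
- move=> H; apply/cvgrPdist_le => e e0; have [d d0 Hd] := H e e0.
  rewrite near_withinE; apply/nbhs_ballP; exists d => //= s.
  rewrite -ball_normE /ball_ /= distrC => sd st Is.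
  have st0 : s - t != 0 by rewrite subr_eq0.
  rewrite distrC -(ler_pM2r (_ : 0 < `|s - t|)) ?normr_gt0// -normrM mulrBl.
  by rewrite mulfVK//; apply: Hd.
Qed.

Lemma is_derive_hasE (V : normedModType R) (f : V -> R) (x v : V) l :
  is_derive x v f l <-> has_deriv setT (fun h => f (h *: v + x)) 0 l.
Proof.
have E : ((fun h : R => h^-1 *: ((f \o shift x) (h *: v) - f x)) @ 0^' --> l) <->
   has_deriv setT (fun h => f (h *: v + x)) 0 l.
  rewrite -deriv_withinE /deriv_within.
  have -> : within setT (0 : R)^' = (0 : R)^'.
    apply/funext => A; apply/propext; rewrite /within /=; split => H.
      by apply: filterS H => s; apply.
    by apply: filterS H => s.
  have -> // : (fun h : R => h^-1 *: ((f \o shift x) (h *: v) - f x)) =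
    (fun s => (f (s *: v + x) - f (0 *: v + x)) / (s - 0)).
  by apply/funext => s; rewrite /= scale0r add0r subr0 mulrC.
rewrite -E; split.
  by case=> H <-; apply: H.
move=> H; have D : derivable f x v by apply/cvg_ex; exists l.
by apply: DeriveDef => //; apply: cvg_lim H.
Qed.

Lemma is_derive1_hasE g t l : is_derive t 1 g l <-> has_deriv setT g t l.
Proof.
rewrite is_derive_hasE; split => H e /H[d d0 Hd]; exists d => // s _.
  move=> sd; have := Hd (s - t) I; rewrite !subr0 => /(_ sd).
  by rewrite scale0r add0r [_ *: _]mulr1 subrK.
rewrite subr0 => sd; have := Hd (s + t) I; rewrite addrK => /(_ sd).
by rewrite scale0r add0r [_ *: _]mulr1.
Qed.

(** Caratheodory's form of the derivative: the slope [h] is continuous at [t].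
    Products need no estimates in this form. *)
Lemma has_derivP I g t l : has_deriv I g t l <->
  exists h, [/\ h t = l, h @ within I (nbhs t) --> l &
    forall s, I s -> g s - g t = h s * (s - t)].
Proof.
split.
- move=> H; exists (fun s => if s == t then l else (g s - g t) / (s - t)).
  split; first by rewrite eqxx.
    apply/cvgrPdist_le => e e0; have [d d0 Hd] := H e e0; apply/withinP; exists d => // s Is sd.
    case: eqVneq => [_|st]; first by rewrite subrr normr0; exact: ltW.
    have st0 : s - t != 0 by rewrite subr_eq0.
    rewrite distrC -(ler_pM2r (_ : 0 < `|s - t|)) ?normr_gt0// -normrM mulrBl.
    by rewrite mulfVK//; apply: Hd.
  move=> s _; case: eqVneq => [->|st]; first by rewrite !subrr mulr0.
  by rewrite mulfVK// subr_eq0.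
- case=> h [ht ch E] e e0; have := ch; move=> /cvgrPdist_le/(_ e e0)/withinP[d d0 Hd].
  exists d => // s Is sd; rewrite E// -mulrBl normrM ler_wpM2r// distrC.
  exact: Hd.
Qed.

Lemma has_deriv_cvg I g t l : has_deriv I g t l -> g @ within I (nbhs t) --> g t.
Proof.
move=> /has_derivP[h [ht ch E]].
have : (fun s => g t + h s * (s - t)) @ within I (nbhs t) --> g t + l * (t - t).
  apply: cvgD; first exact: cvg_cst.
  apply: cvgM => //; apply: cvgB; last exact: cvg_cst.
  exact: cvg_within.
rewrite subrr mulr0 addr0; apply: cvg_trans; apply: near_eq_cvg.
by apply/withinP; exists 1 => // s Is _; rewrite -E// addrC subrK.
Qed.

Lemma has_derivW I J g t l : J `<=` I -> has_deriv I g t l -> has_deriv J g t l.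
Proof.
by move=> JI H e /H[d d0 Hd]; exists d => // s /JI; apply: Hd.
Qed.

(** With [d = 1] this serves to replace a function by an equal one inside
    [has_deriv]. *)
Lemma has_deriv_near I J f g t l d : 0 < d ->
  (forall s, J s -> `|s - t| < d -> I s /\ f s = g s) -> f t = g t ->
  has_deriv I f t l -> has_deriv J g t l.
Proof.
move=> d0 E Et H e /H[d' d'0 Hd]; exists (Num.min d d'); first by rewrite lt_min d0.
move=> s Js; rewrite lt_min => /andP[sd sd']; have [Is <-] := E s Js sd.
by rewrite -Et; apply: Hd.
Qed.

Lemma has_deriv_cst I c t : has_deriv I (fun=> c) t 0.
Proof.
move=> e e0; exists 1 => // s _ _; rewrite subrr mul0r subr0 normr0.
by rewrite mulr_ge0// ltW.
Qed.

Lemma has_deriv_id I t : has_deriv I id t 1.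
Proof.
move=> e e0; exists 1 => // s _ _; rewrite mul1r subrr normr0.
by rewrite mulr_ge0// ltW.
Qed.

Lemma has_derivD I f g t a b : has_deriv I f t a -> has_deriv I g t b ->
  has_deriv I (fun s => f s + g s) t (a + b).
Proof.
move=> /has_derivP[h [ht ch E]] /has_derivP[k [kt ck F]].
apply/has_derivP; exists (fun s => h s + k s); split; first by rewrite ht kt.
  exact: cvgD.
by move=> s Is; rewrite mulrDl -E// -F//; ring.
Qed.

Lemma has_derivM I f g t a b : has_deriv I f t a -> has_deriv I g t b ->
  has_deriv I (fun s => f s * g s) t (a * g t + f t * b).
Proof.
move=> Hf /[dup] Hg /has_derivP[k [kt ck F]].
move: (Hf) => /has_derivP[h [ht ch E]].
apply/has_derivP; exists (fun s => h s * g s + f t * k s); split.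
- by rewrite ht kt.
- apply: cvgD; first by apply: cvgM => //; apply: has_deriv_cvg Hg.
  by apply: cvgM => //; apply: cvg_cst.
- move=> s Is; transitivity ((f s - f t) * g s + f t * (g s - g t)); first ring.
  by rewrite E// F//; ring.
Qed.

Lemma has_derivZ I f t c a : has_deriv I f t a ->
  has_deriv I (fun s => c * f s) t (c * a).
Proof.
move=> H; have := has_derivM (@has_deriv_cst I c t) H.
by rewrite mul0r add0r.
Qed.

Lemma has_derivB I f g t a b : has_deriv I f t a -> has_deriv I g t b ->
  has_deriv I (fun s => f s - g s) t (a - b).
Proof.
move=> Hf Hg; have := has_derivD Hf (has_derivZ (-1) Hg); rewrite mulN1r.
by apply: (has_deriv_near ltr01) => [s Is _|]; rewrite mulN1r.
Qed.

Lemma has_deriv_sum I (T : Type) (r : seq T) (P : pred T) (F : T -> R -> R)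
    (dF : T -> R) t :
  (forall i, P i -> has_deriv I (F i) t (dF i)) ->
  has_deriv I (fun s => \sum_(i <- r | P i) F i s) t (\sum_(i <- r | P i) dF i).
Proof.
move=> H; elim: r => [|i r IH].
  rewrite big_nil; have := @has_deriv_cst I 0 t.
  by apply: (has_deriv_near ltr01) => [s Is _|]; rewrite big_nil.
rewrite big_cons; case: ifP => Pi.
  have := has_derivD (H i Pi) IH.
  by apply: (has_deriv_near ltr01) => [s Is _|]; rewrite big_cons Pi.
by move: IH; apply: (has_deriv_near ltr01) => [s Is _|]; rewrite big_cons Pi.
Qed.

Lemma has_deriv_comp I J g u t a b d : 0 < d ->
  (forall s, J s -> `|s - t| < d -> I (u s)) ->
  has_deriv J u t a -> has_deriv I g (u t) b ->
  has_deriv J (g \o u) t (b * a).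
Proof.
move=> d0 JI /[dup] Hu /has_derivP[h [ht ch E]] Hg e e0.
have He : 0 < e / (`|a| + 1 + `|b|).
  by rewrite divr_gt0// -addrA ltr_wpDl// ltr_pwDl.
have [d1 d10 H1] := Hg _ He.
have He1 : 0 < Num.min 1 (e / (`|a| + 1 + `|b|)) by rewrite lt_min ltr01.
have [d2 d20 H2] := Hu _ He1.
have /cvgrPdist_lt/(_ d1 d10)/withinP[d3 d30 H3] := has_deriv_cvg Hu.
have d4 : 0 < Num.min d (Num.min d2 d3) by rewrite !lt_min d0 d20 d30.
exists (Num.min d (Num.min d2 d3)) => // s Js; rewrite !lt_min => /and3P[sd sd2 sd3] /=.
have := H1 (u s) (JI s Js sd); rewrite distrC => /(_ (H3 s Js sd3)) H1'.
have H2' := H2 s Js sd2; rewrite distrC in H1'.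
set e' := e / _ in He H1' H2'.
set A := g (u s) - _ - _ in H1'; set B := u s - u t - _ in H2'.
have -> : g (u s) - g (u t) - b * a * (s - t) = A + b * B by rewrite /A /B; ring.
have uB : `|u s - u t| <= (`|a| + 1) * `|s - t|.
  have -> : u s - u t = a * (s - t) + B by rewrite /B; ring.
  apply: le_trans (ler_normD _ _) _; rewrite normrM mulrDl lerD2l.
  by apply: le_trans H2' _; apply: ler_wpM2r => //; rewrite ge_min lexx.
have B' : `|B| <= e' * `|s - t|.
  by apply: le_trans H2' _; apply: ler_wpM2r => //; rewrite ge_min lexx orbT.
apply: le_trans (ler_normD _ _) _; rewrite normrM.
have A' : `|A| <= e' * ((`|a| + 1) * `|s - t|).
  by apply: le_trans H1' _; rewrite ler_pM2l.
have bB : `|b| * `|B| <= `|b| * (e' * `|s - t|) by apply: ler_wpM2l.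
have Ee : e = e' * (`|a| + 1 + `|b|).
  by rewrite /e' mulfVK// gt_eqF// -addrA ltr_wpDl// ltr_pwDl.
rewrite [in leRHS]Ee; nra.
Qed.

Lemma mvt_has_deriv a b g (dg : R -> R) : a < b ->
  (forall t, a <= t <= b -> has_deriv `[a, b] g t (dg t)) ->
  exists2 c, a < c < b & g b - g a = dg c * (b - a).
Proof.
move=> ab H; have [||c] := @MVT R g dg a b ab.
- move=> x; rewrite in_itv /= => /andP[ax xb]; apply/is_derive1_hasE.
  have xab : a <= x <= b by rewrite !ltW.
  have d0 : 0 < Num.min (x - a) (b - x) by rewrite lt_min !subr_gt0 ax.
  apply: (has_deriv_near d0 _ erefl (H x xab)) => s _.
  rewrite lt_min !ltr_norml => /andP[/andP[s1 s2] /andP[s3 s4]]; split => //=.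
  rewrite in_itv /=; lra.
- apply/continuous_within_itvP.
    exact: ab.
  have aab : a <= a <= b by rewrite lexx ltW.
  have bab : a <= b <= b by rewrite lexx ltW.
  split.
  + move=> x; rewrite in_itv /= => /andP[ax xb].
    have xab : a <= x <= b by rewrite !ltW.
    apply/cvgrPdist_lt => e e0.
    have /cvgrPdist_lt/(_ e e0)/withinP[d d0 Hd] := has_deriv_cvg (H x xab).
    apply/nbhsRP; exists (Num.min d (Num.min (x - a) (b - x))).
      by rewrite /= !lt_min d0 !subr_gt0 ax.
    move=> s; rewrite !lt_min => /and3P[s0 s1 s2].
    apply: Hd => //=; move: s1 s2; rewrite !ltr_norml in_itv /=.
    move=> /andP[s1 s1'] /andP[s2 s2']; lra.
  + apply/cvgrPdist_lt => e e0.
    have /cvgrPdist_lt/(_ e e0)/withinP[d d0 Hd] := has_deriv_cvg (H a aab).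
    rewrite near_withinE; apply/nbhsRP; exists (Num.min d (b - a)).
      by rewrite /= !lt_min d0 !subr_gt0 ab.
    move=> s; rewrite !lt_min => /andP[s0 s1] sa.
    apply: Hd => //=; move: s1; rewrite !ltr_norml in_itv /=.
    move=> /andP[s1 s1']; lra.
  + apply/cvgrPdist_lt => e e0.
    have /cvgrPdist_lt/(_ e e0)/withinP[d d0 Hd] := has_deriv_cvg (H b bab).
    rewrite near_withinE; apply/nbhsRP; exists (Num.min d (b - a)).
      by rewrite /= !lt_min d0 !subr_gt0 ab.
    move=> s; rewrite !lt_min => /andP[s0 s1] sa.
    apply: Hd => //=; move: s1; rewrite !ltr_norml in_itv /=.
    move=> /andP[s1 s1']; lra.
- rewrite in_itv /= => cab E; exists c => //.
Qed.

(** Connectedness of an interval, as an induction principle: a property which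
    spreads between any two nearby points, from left to right and from right
    to left, holds everywhere once it holds somewhere. *)
Lemma interval_ind I (P : R -> Prop) : is_interval I ->
  (forall t, I t -> exists2 d, 0 < d & forall s s', I s -> I s' ->
     `|s - t| < d -> `|s' - t| < d -> P s -> P s') ->
  forall s s', I s -> I s' -> P s -> P s'.
Proof.
move=> /connected_intervalP cI H s s' Is Is' Ps.
have near_open (Q : R -> Prop) :
    open [set u | exists2 e, 0 < e & forall v, I v -> `|v - u| < e -> Q v].
  rewrite openE => u [e e0 He]; apply/nbhsRP; exists (e / 2).
    by rewrite divr_gt0.
  move=> v vu; exists (e / 2); first by rewrite divr_gt0.
  move=> w Iw wv; apply: He => //.
  have -> : w - u = (w - v) + (v - u) by ring.
  by rewrite (le_lt_trans (ler_normD _ _))// [e]splitr ltrD.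
suff E : [set t | I t /\ P t] = I by have : I s' by []; rewrite -{1}E => -[].
apply: cI.
- by exists s.
- exists [set u | exists2 e, 0 < e & forall v, I v -> `|v - u| < e -> P v] => //.
  apply/seteqP; split => t /=.
    move=> [It Pt]; split => //; have [d d0 Hd] := H t It; exists d => // v Iv vt.
    by apply: (Hd t v) => //; rewrite subrr normr0.
  by move=> [It [e e0 He]]; split => //; apply: He => //; rewrite subrr normr0.
- exists (~` [set u | exists2 e, 0 < e & forall v, I v -> `|v - u| < e -> ~ P v]).
    exact: open_closedC.
  apply/seteqP; split => t /=.
    move=> [It Pt]; split => // -[e e0 He]; apply: (He t) => //.
    by rewrite subrr normr0.
  move=> [It nt]; split => //; apply: contrapT => nP; apply: nt.
  have [d d0 Hd] := H t It; exists d => // v Iv vt Pv; apply: nP.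
  by apply: (Hd v t) => //; rewrite subrr normr0.
Qed.

Lemma has_deriv_expZ I k t :
  has_deriv I (fun s => expR (k * s)) t (k * expR (k * t)).
Proof.
have H : has_deriv setT (fun s => k * s) t k.
  by rewrite -[X in has_deriv _ _ _ X](mulr1 k); apply: has_derivZ (@has_deriv_id _ _).
have G : has_deriv setT (@expR R) (k * t) (expR (k * t)).
  by apply/is_derive1_hasE; apply: is_derive_expR.
rewrite mulrC; apply: (@has_derivW setT) => //.
exact: (has_deriv_comp (d := 1) _ _ H G).
Qed.

(** The function [f t * expR (- K * t)] does not increase. *)
Lemma gronwall_fwd a b f (df : R -> R) K : a <= b ->
  (forall t, a <= t <= b -> has_deriv `[a, b] f t (df t)) ->
  (forall t, a <= t <= b -> df t <= K * f t) ->
  f b <= f a * expR (K * (b - a)).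
Proof.
rewrite le_eqVlt => /predU1P[->|ab] Hf Hd.
  by rewrite subrr mulr0 expR0 mulr1.
have [t tab|c /andP[ac cb] E] := @mvt_has_deriv a b (fun s => f s * expR ((- K) * s))
    (fun t => df t * expR (- K * t) + f t * (- K * expR (- K * t))) ab.
  by apply: has_derivM; [exact: Hf|exact: has_deriv_expZ].
have cab : a <= c <= b by rewrite !ltW.
have : f b * expR (- K * b) - f a * expR (- K * a) <= 0.
  rewrite E /=; set e := expR _.
  have -> : (df c * e + f c * (- K * e)) * (b - a) = (df c - K * f c) * (e * (b - a)).
    by ring.
  apply: mulr_le0_ge0; last first.
    by rewrite mulr_ge0 ?expR_ge0// subr_ge0 ltW.
  by have := Hd c cab; lra.
rewrite subr_le0 => H.
have := ler_wpM2r (expR_ge0 (K * b)) H.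
rewrite -!mulrA -!expRD => {}H.
have -> : K * (b - a) = - K * a + K * b by ring.
by move: H; rewrite mulNr addNr expR0 mulr1.
Qed.

(** [gronwall_fwd] with time reversed. *)
Lemma gronwall_bwd a b f (df : R -> R) K : a <= b ->
  (forall t, a <= t <= b -> has_deriv `[a, b] f t (df t)) ->
  (forall t, a <= t <= b -> - (K * f t) <= df t) ->
  f a <= f b * expR (K * (b - a)).
Proof.
move=> ab Hf Hd.
have := @gronwall_fwd (- b) (- a) (fun s => f (- s)) (fun s => - df (- s)) K.
rewrite /= lerN2 !opprK [- a + b]addrC; apply => // t /andP[t1 t2].
- have tab : a <= - t <= b by lra.
  rewrite -[- df _]mulrN1.
  apply: (@has_deriv_comp `[a, b] `[- b, - a] f (fun s => - s) t (-1) _ 1 ltr01).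
  + by move=> s /=; rewrite !in_itv /= => /andP[s1 s2] _; lra.
  + have := has_derivB (@has_deriv_cst `[- b, - a] 0 t) (@has_deriv_id `[- b, - a] t).
    by rewrite sub0r; apply: (has_deriv_near ltr01) => [s Is _|]; rewrite sub0r.
  + exact: Hf.
- have tab : a <= - t <= b by lra.
  by have := Hd _ tab; lra.
Qed.

Lemma gronwall_between J s s' f (df : R -> R) K : is_interval J -> J s -> J s' ->
  (forall t, J t -> has_deriv J f t (df t)) ->
  (forall t, J t -> `|df t| <= K * f t) ->
  f s' <= f s * expR (K * `|s' - s|).
Proof.
move=> iJ Js Js' Hf Hd.
have sub a b : J a -> J b -> forall t, a <= t <= b -> J t.
  by move=> Ja Jb t tab; apply: iJ tab.
have sub' a b : J a -> J b -> `[a, b] `<=` J.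
  by move=> Ja Jb t /=; rewrite in_itv /=; apply: sub.
case: (lerP s s') => ss'.
  apply: (gronwall_fwd (df := df)) => // t tab.
    by apply: has_derivW (sub' _ _ Js Js') _; apply: Hf; apply: sub tab.
  by have := Hd t (sub _ _ Js Js' t tab); rewrite ler_norml => /andP[].
have ss := ltW ss'.
apply: (gronwall_bwd (df := df)) => // t tab.
  by apply: has_derivW (sub' _ _ Js' Js) _; apply: Hf; apply: sub tab.
by have := Hd t (sub _ _ Js' Js t tab); rewrite ler_norml => /andP[].
Qed.

(** The differential inequality is only supposed below the level [M]. But the
    exponential bound which it implies stays below [M], so [f] has no
    opportunity to cross that level; [interval_ind] turns this into a proof. *)
Lemma gronwall_barrier b f (df : R -> R) K M : 0 <= b -> 0 <= K -> 0 <= f 0 ->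
  (forall t, 0 <= t <= b -> has_deriv `[0, b] f t (df t)) ->
  (forall t, 0 <= t <= b -> f t <= M -> df t <= K * f t) ->
  f 0 * expR (K * b) < M ->
  forall t, 0 <= t <= b -> f t <= f 0 * expR (K * t).
Proof.
move=> b0 K0 f0 Hf Hd fM.
have mono t : t <= b -> f 0 * expR (K * t) <= f 0 * expR (K * b).
  by move=> tb; rewrite ler_wpM2l// ler_expR ler_wpM2l.
suff H t : 0 <= t <= b -> forall v, 0 <= v <= t -> f v <= f 0 * expR (K * v).
  by move=> t tb; apply: (H t tb); rewrite lexx; case/andP: tb => ->.
have itv : is_interval `[0, b]%classic by apply: interval_is_interval.
move=> tb; move: (t) (tb).
have : `[0, b]%classic 0 by rewrite /= in_itv /= lexx.
move=> H0 {t tb} t tb.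
have Ht : `[0, b]%classic t by rewrite /= in_itv.
apply: (interval_ind (P := fun t => forall v, 0 <= v <= t -> f v <= f 0 * expR (K * v))
  itv _ H0 Ht); last first.
  move=> u; rewrite -eq_le => /eqP <-; by rewrite mulr0 expR0 mulr1.
move=> t0; rewrite /= in_itv /= => t0b.
have ct := has_deriv_cvg (Hf t0 t0b).
case: (ltrP (f t0) M) => ft0.
- have e0 : 0 < M - f t0 by rewrite subr_gt0.
  have /cvgrPdist_lt/(_ _ e0)/withinP[d d0 Hdd] := ct.
  have near v : 0 <= v <= b -> `|v - t0| < d -> f v < M.
    move=> ub ud; have := Hdd v; rewrite /= in_itv /= => /(_ ub ud).
    by rewrite ltr_norml => /andP[]; lra.
  exists d => // s s'; rewrite /= !in_itv /= => sb s'b sd s'd Ps u /andP[u0 us'].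
  case: (lerP u s) => us; first by apply: Ps; rewrite u0.
  have ub : u <= b by lra.
  have bd v : 0 <= v <= u -> f v <= M.
    move=> /andP[v0 vu]; case: (lerP v s) => vs.
      have vb : v <= b by lra.
      by have := Ps v; rewrite v0 vs => /(_ isT); have := mono v vb; lra.
    apply/ltW/near; first by lra.
    by move: sd s'd; rewrite !ltr_norml => /andP[? ?] /andP[? ?]; lra.
  have := @gronwall_fwd 0 u f df K u0; rewrite subr0; apply => v vu.
  + apply: (@has_derivW `[0, b]); last by apply: Hf; lra.
    by move=> w /=; rewrite !in_itv /=; lra.
  + by apply: Hd; [lra|exact: bd].
(* at a time t0 with M <= f t0 the bound fails at all nearby times, so there
   is nothing to propagate *)
- have e0 : 0 < M - f 0 * expR (K * b) by rewrite subr_gt0.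
  have /cvgrPdist_lt/(_ _ e0)/withinP[d d0 Hdd] := ct.
  exists d => // s s'; rewrite /= !in_itv /= => sb s'b sd s'd Ps.
  have := Hdd s; rewrite /= in_itv /= => /(_ sb sd).
  have ss : 0 <= s <= s by rewrite lexx; case/andP: sb => ->.
  have sb' : s <= b by case/andP: sb.
  have := Ps s ss; have := mono s sb'.
  rewrite ltr_norml => ? ? /andP[? ?]; lra.
Qed.

(** Unlike the mean value theorem, this bound holds for end points in either
    order, equal ones included, which saves case distinctions later. *)
Lemma mean_value_bound J s s' f (df : R -> R) B : is_interval J -> J s -> J s' ->
  (forall t, J t -> has_deriv J f t (df t)) ->
  (forall t, J t -> `|df t| <= B) -> `|f s' - f s| <= B * `|s' - s|.
Proof.
move=> iJ.
have main a b : a < b -> J a -> J b ->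
    (forall t, J t -> has_deriv J f t (df t)) ->
    (forall t, J t -> `|df t| <= B) -> `|f b - f a| <= B * `|b - a|.
  move=> ab Ja Jb Hf Hd.
  have sub t : a <= t <= b -> J t by move=> tab; apply: iJ tab.
  have [t tab|c /andP[ac cb] ->] := @mvt_has_deriv a b f df ab.
    apply: (@has_derivW J); last by apply/Hf/sub.
    by move=> u /=; rewrite in_itv /=; apply: sub.
  by rewrite normrM ler_wpM2r// Hd//; apply: sub; rewrite !ltW.
move=> Js Js' Hf Hd; case: (ltgtP s s') => [ss'|ss'|->].
- exact: main.
- by rewrite distrC [`|s' - _|]distrC; apply: main.
- by rewrite !subrr normr0 mulr0.
Qed.

End HasDeriv.

Section RowNorm.
Variables (R : realType) (n : nat).
Implicit Types x y : 'rV[R]_n.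

Lemma coord_le_norm x j : `|x ord0 j| <= `|x|.
Proof.
rewrite [leRHS]/Num.Def.normr /= mx_normrE.
by apply: (le_bigmax _ (fun ij : 'I_1 * 'I_n => `|x ij.1 ij.2|) (ord0, j)).
Qed.

Lemma coordB x y j : (x - y) ord0 j = x ord0 j - y ord0 j.
Proof. by rewrite !mxE. Qed.

Lemma norm_le_coord x c : 0 <= c -> (forall j, `|x ord0 j| <= c) -> `|x| <= c.
Proof.
move=> c0 H; rewrite [leLHS]/Num.Def.normr /= mx_normrE; apply/bigmax_leP; split => //.
by case=> i j _ /=; rewrite ord1.
Qed.

Lemma norm_lt_coord x c : 0 < c -> (forall j, `|x ord0 j| < c) -> `|x| < c.
Proof.
move=> c0 H; rewrite [ltLHS]/Num.Def.normr /= mx_normrE; apply/bigmax_ltP; split => //.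
by case=> i j _ /=; rewrite ord1.
Qed.

(** The norm of ['rV[R]_n] is the maximum norm, which is not differentiable;
    differential inequalities are applied to this quantity, which is
    equivalent to its square. *)
Definition sqn x := \sum_j x ord0 j ^+ 2.

Lemma norm_sqn x : `|x| ^+ 2 <= sqn x.
Proof.
rewrite -[`|x|]/(mx_norm x).
have [->|/mx_norm_neq0[[i j] /= E]] := eqVneq (mx_norm x) 0.
  by rewrite expr0n; apply: sumr_ge0 => j _; apply: sqr_ge0.
rewrite E ord1 real_normK ?num_real// /sqn (bigD1 j)//= lerDl.
by apply: sumr_ge0 => k _; apply: sqr_ge0.
Qed.

Lemma sqn_norm x : sqn x <= n%:R * `|x| ^+ 2.
Proof.
rewrite -[X in X%:R](card_ord n) mulr_natl -sumr_const; apply: ler_sum => j _.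
by rewrite -real_normK ?num_real// ler_sqr ?nnegrE// coord_le_norm.
Qed.

Lemma sqn_ge0 x : 0 <= sqn x.
Proof. by apply: sumr_ge0 => j _; apply: sqr_ge0. Qed.

Lemma has_deriv_sqn I (w dw : R -> 'rV[R]_n) t :
  (forall j, has_deriv I (fun s => w s ord0 j) t (dw t ord0 j)) ->
  has_deriv I (fun s => sqn (w s)) t (\sum_j 2 * w t ord0 j * dw t ord0 j).
Proof.
move=> H; apply: has_deriv_sum => j _.
have := has_derivM (H j) (H j).
have -> : dw t ord0 j * w t ord0 j + w t ord0 j * dw t ord0 j =
  2 * w t ord0 j * dw t ord0 j by ring.
by apply: (has_deriv_near ltr01) => [s Is _|]; rewrite expr2.
Qed.

(** In each coordinate, [2 * a * b <= c * (2 * L * c + 2 * e)] for [c] the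
    norm of [w], and [2 * c * e <= c ^+ 2 + e ^+ 2]. *)
Lemma sqn_deriv_bound (w dw : 'rV[R]_n) L e : 0 <= L ->
  (forall j, `|dw ord0 j| <= L * `|w| + e) ->
  `|\sum_j 2 * w ord0 j * dw ord0 j| <= n%:R * (2 * L + 1) * (sqn w + e ^+ 2).
Proof.
move=> L0 H; apply: le_trans (ler_norm_sum _ _ _) _.
have -> : n%:R * (2 * L + 1) * (sqn w + e ^+ 2) =
    \sum_(j < n) (2 * L + 1) * (sqn w + e ^+ 2).
  by rewrite sumr_const card_ord -mulrA mulr_natl.
apply: ler_sum => j _; rewrite !normrM ger0_norm//.
have := norm_sqn w; have := H j; have := coord_le_norm w j.
have : 0 <= `|w ord0 j| by []. have : 0 <= `|dw ord0 j| by [].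
move: `|w ord0 j| `|dw ord0 j| `|w| (sqn w) => a b c q b0 a0 ac bc cq.
have : a * b <= c * (L * c + e) by apply: ler_pM.
have : 0 <= (c - e) ^+ 2 by apply: sqr_ge0.
have : 0 <= L * (q - c ^+ 2) by rewrite mulr_ge0// subr_ge0.
have : 0 <= L * e ^+ 2 by rewrite mulr_ge0// sqr_ge0.
rewrite !expr2; nra.
Qed.

(** The defect [e] makes the lemma applicable to approximate solutions. *)
Lemma gronwall_norm (J : set R) (w dw : R -> 'rV[R]_n) L e s s' :
  is_interval J -> J s -> J s' -> 0 <= L ->
  (forall t j, J t -> has_deriv J (fun u => w u ord0 j) t (dw t ord0 j)) ->
  (forall t j, J t -> `|dw t ord0 j| <= L * `|w t| + e) ->
  `|w s'| ^+ 2 <= (n%:R * `|w s| ^+ 2 + e ^+ 2) *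
     expR (n%:R * (2 * L + 1) * `|s' - s|).
Proof.
move=> iJ Js Js' L0 Hw Hd.
have := @gronwall_between _ J s s' (fun t => sqn (w t) + e ^+ 2)
  (fun t => \sum_j 2 * w t ord0 j * dw t ord0 j) (n%:R * (2 * L + 1)) iJ Js Js'.
move=> H; have {H}: sqn (w s') + e ^+ 2 <=
    (sqn (w s) + e ^+ 2) * expR (n%:R * (2 * L + 1) * `|s' - s|).
  apply: H => t Jt; last by apply: sqn_deriv_bound => // j; apply: Hd.
  rewrite -[X in has_deriv _ _ _ X]addr0; apply: has_derivD.
    by apply: has_deriv_sqn => j; apply: Hw.
  exact: has_deriv_cst.
have := norm_sqn (w s'); have := sqn_norm (w s).
have := expR_ge0 (n%:R * (2 * L + 1) * `|s' - s|).
have := sqr_ge0 e.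
move: (expR _) => E; nra.
Qed.

Lemma gronwall_zero (J : set R) (w dw : R -> 'rV[R]_n) L s s' :
  is_interval J -> J s -> J s' -> 0 <= L ->
  (forall t j, J t -> has_deriv J (fun u => w u ord0 j) t (dw t ord0 j)) ->
  (forall t j, J t -> `|dw t ord0 j| <= L * `|w t|) -> w s = 0 -> w s' = 0.
Proof.
move=> iJ Js Js' L0 Hw Hd ws.
have := @gronwall_norm J w dw L 0 s s' iJ Js Js' L0 Hw.
rewrite ws normr0 expr0n /= mulr0 addr0 mul0r => H.
apply/normr0_eq0/eqP; rewrite -sqrf_eq0 eq_le sqr_ge0 andbT; apply: H => t j Jt.
by rewrite addr0; apply: Hd.
Qed.

End RowNorm.

(** * Functions of class C^k of several variables *)

Section Calculus.
Variable R : realType.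

Lemma nbhsEP (V : normedModType R) (P : V -> Prop) (p : V) :
  (\forall z \near p, P z) <-> exists2 d, 0 < d & forall z, `|z - p| < d -> P z.
Proof.
split.
  move=> /nbhs_ballP[d d0 H]; exists d => // z zd; apply: H => //.
  by rewrite -ball_normE /ball_ /= distrC.
case=> d d0 H; apply/nbhs_ballP; exists d => // z.
by rewrite -ball_normE /ball_ /= distrC => zd; apply: H.
Qed.

Lemma fin_bound (T : finType) (P : T -> R -> Prop) :
  (forall i a b, a <= b -> P i a -> P i b) ->
  (forall i, exists2 L, 0 <= L & P i L) -> exists2 L, 0 <= L & forall i, P i L.
Proof.
move=> mono H.
have {H} [F HF] : {F : T -> R & forall i, 0 <= F i /\ P i (F i)}.
  apply: (@choice _ _ (fun i L => 0 <= L /\ P i L)) => i.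
  by have [L L0 PL] := H i; exists L.
exists (\sum_i F i); first by apply: sumr_ge0 => i _; case: (HF i).
move=> i; apply: mono (HF i).2; rewrite (bigD1 i)//= lerDl.
by apply: sumr_ge0 => j _; case: (HF j).
Qed.

Lemma filter_forall_ord (T : Type) n (P : 'I_n -> set T) (F : set_system T)
    (FF : Filter F) : (forall i, F (P i)) -> F [set x | forall i, P i x].
Proof. by move=> H; apply: (filter_forall FF). Qed.

Section Ck.
Variable n : nat.
Implicit Types (O : set 'rV[R]_n) (f g : 'rV[R]_n -> R) (x p z : 'rV[R]_n).

Definition partial (i : 'I_n) f x : R := 'D_('e_i) f x.

(** Continuity is part of the notion because [smooth_on] asks for it at every
    order, and the existence of partial derivatives does not imply it. *)
Definition pderivable_at f x := {for x, continuous f} /\ forall i : 'I_n, derivable f x 'e_i.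

(** The recursion peels off the derivative which is taken first; this is what
    turns smoothness into a statement about all [Ck]. *)
Lemma smooth_onE O f : smooth_on O f <->
  (forall x, O x -> pderivable_at f x) /\ forall i, smooth_on O (partial i f).
Proof.
split=> [H|[H1 H2] s].
  split; first by move=> x Ox; exact: (H [::] x Ox).
  move=> i s x Ox; have := H (rcons s i) x Ox.
  by rewrite /pderivs foldr_rcons.
case/lastP: s => [|s i] x Ox; first exact: H1.
by rewrite /pderivs foldr_rcons; apply: H2.
Qed.

(** Closure of smooth functions under products and compositions is an
    induction on the order of differentiability which mixes [f] with its
    derivatives, hence the need for finite orders. *)
Fixpoint Ck k O f : Prop :=
  if k is k'.+1 then (forall x, O x -> pderivable_at f x) /\ forall i, Ck k' O (partial i f)
  else forall x, O x -> {for x, continuous f}.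

Lemma CkW k O f : Ck k.+1 O f -> Ck k O f.
Proof.
elim: k f => [|k IH] f; first by case=> H _ x Ox; case: (H x Ox).
by case=> H1 H2; split => // i; apply: IH; apply: H2.
Qed.

Lemma Ck_cont k O f x : Ck k O f -> O x -> {for x, continuous f}.
Proof. by case: k => [|k] H Ox; [exact: H|case: H => H _; case: (H x Ox)]. Qed.

Lemma smooth_CkP O f : smooth_on O f <-> forall k, Ck k O f.
Proof.
split.
  move=> H k; elim: k f H => [|k IH] f /smooth_onE[H1 H2].
    by move=> x Ox; case: (H1 x Ox).
  by split => // i; apply: IH.
move=> H s; have : Ck (size s).+1 O f by [].
elim/last_ind: s f {H} => [|s i IH] f H x Ox; first by case: H => H _; exact: H.
rewrite /pderivs foldr_rcons; apply: IH => //.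
by move: H; rewrite size_rcons => -[_]; apply.
Qed.

Lemma smooth_onS O O' f : O' `<=` O -> smooth_on O f -> smooth_on O' f.
Proof. by move=> S H s x /S Ox; apply: H. Qed.

Lemma smooth_on_cont O f x : smooth_on O f -> O x -> {for x, continuous f}.
Proof. by move=> /smooth_onE[H _] Ox; case: (H x Ox). Qed.

Lemma smooth_on_partial O f i : smooth_on O f -> smooth_on O (partial i f).
Proof. by move=> /smooth_onE[_ H]. Qed.

Lemma eq_near_pderivable_at f g x : (\forall z \near x, f z = g z) -> pderivable_at f x -> pderivable_at g x.
Proof.
move=> E [cf df]; split.
  have Ex : f x = g x by exact: nbhs_singleton E.
  change (g @ x --> g x); rewrite -Ex; apply: cvg_trans cf; exact: (near_eq_cvg E).
by move=> i; exact: (near_eq_derivable E).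
Qed.

Lemma eq_near_partial f g x i : (\forall z \near x, f z = g z) ->
  partial i f x = partial i g x.
Proof. exact: near_eq_derive. Qed.

Lemma eq_Ck k O f g : open O -> (forall x, O x -> f x = g x) -> Ck k O f -> Ck k O g.
Proof.
move=> oO.
have near (f' g' : 'rV[R]_n -> R) x : (forall x, O x -> f' x = g' x) -> O x ->
    \forall z \near x, f' z = g' z.
  by move=> E Ox; apply: filterS (open_nbhs_nbhs (conj oO Ox)).
elim: k f g => [|k IH] f g E.
  move=> H x Ox; have Ex := near f g x E Ox.
  change (g @ x --> g x); rewrite -(E x Ox); apply: cvg_trans (H x Ox); exact: (near_eq_cvg Ex).
case=> H1 H2; split=> [x Ox|i].
  by apply: eq_near_pderivable_at (H1 x Ox); apply: near.
by apply: IH (H2 i) => x Ox; apply: eq_near_partial; apply: near.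
Qed.

Lemma eq_smooth_on O f g : open O -> (forall x, O x -> f x = g x) ->
  smooth_on O f -> smooth_on O g.
Proof.
by move=> oO E /smooth_CkP H; apply/smooth_CkP => k; apply: eq_Ck (H k).
Qed.

Lemma Ck_cst k O (c : R) : Ck k O (fun=> c).
Proof.
elim: k c => [|k IH] c; first by move=> x _; apply: cst_continuous.
split.
  move=> x _; split; first by apply: cst_continuous.
  by move=> i; exact: derivable_cst.
move=> i; have -> : partial i (fun=> c) = (fun=> 0).
  by apply/funext => x; rewrite /partial derive_cst.
exact: IH.
Qed.

Lemma partial_hasE f x i l :
  derivable f x 'e_i /\ partial i f x = l <->
  has_deriv setT (fun h => f (h *: 'e_i + x)) 0 l.
Proof.
rewrite -is_derive_hasE; split; first by case=> D E; apply: DeriveDef.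
by case.
Qed.

Lemma pderivable_at_has f x i : pderivable_at f x ->
  has_deriv setT (fun h => f (h *: 'e_i + x)) 0 (partial i f x).
Proof. by case=> _ H; apply/partial_hasE. Qed.

Lemma pderivable_at_line f x i t : pderivable_at f (t *: 'e_i + x) ->
  has_deriv setT (fun h => f (h *: 'e_i + x)) t (partial i f (t *: 'e_i + x)).
Proof.
move=> H e e0; have [d d0 Hd] := pderivable_at_has i H e0; exists d => // s _ sd.
have := Hd (s - t) I; rewrite subr0 => /(_ sd).
by rewrite scale0r add0r addrA -scalerDl subrK.
Qed.

Lemma Ck_coord k O j : Ck k O (fun z => z ord0 j).
Proof.
have D i x : derivable (fun z : 'rV[R]_n => z ord0 j) x 'e_i /\
    partial i (fun z => z ord0 j) x = (i == j)%:R.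
  apply/partial_hasE.
  have -> : (fun h : R => (h *: 'e_i + x) ord0 j) = (fun h => (i == j)%:R * h + x ord0 j).
    by apply/funext => h; rewrite !mxE eqxx /= mulrC eq_sym.
  rewrite -[X in has_deriv _ _ _ X]addr0; apply: has_derivD (@has_deriv_cst _ _ _ _).
  by rewrite -[X in has_deriv _ _ _ X]mulr1; apply: has_derivZ (@has_deriv_id _ _ _).
case: k => [|k]; first by move=> x _; exact: coord_continuous.
split.
  move=> x _; split; first exact: coord_continuous.
  by move=> i; case: (D i x).
move=> i; have -> : partial i (fun z => z ord0 j) = (fun=> (i == j)%:R).
  by apply/funext => x; case: (D i x).
exact: Ck_cst.
Qed.

Lemma CkD k O f g : Ck k O f -> Ck k O g -> open O -> Ck k O (fun x => f x + g x).
Proof.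
move=> + + oO; elim: k f g => [|k IH] f g.
  by move=> H1 H2 x Ox; exact: continuousD (H1 x Ox) (H2 x Ox).
case=> f1 f2 [g1 g2].
have D i x : O x -> derivable (fun z => f z + g z) x 'e_i /\
    partial i (fun z => f z + g z) x = partial i f x + partial i g x.
  move=> Ox; apply/partial_hasE.
  by apply: has_derivD; apply: pderivable_at_has; [exact: f1|exact: g1].
split.
  move=> x Ox; split; last by move=> i; case: (D i x Ox).
  by apply: continuousD; [case: (f1 x Ox)|case: (g1 x Ox)].
move=> i; apply: (@eq_Ck k O (fun x => partial i f x + partial i g x)) => //.
  by move=> x Ox; case: (D i x Ox).
by apply: IH; [exact: f2|exact: g2].
Qed.

Lemma CkM k O f g : Ck k O f -> Ck k O g -> open O -> Ck k O (fun x => f x * g x).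
Proof.
move=> + + oO; elim: k f g => [|k IH] f g.
  by move=> H1 H2 x Ox; exact: continuousM (H1 x Ox) (H2 x Ox).
move=> /[dup] /CkW Hf [f1 f2] /[dup] /CkW Hg [g1 g2].
have D i x : O x -> derivable (fun z => f z * g z) x 'e_i /\
    partial i (fun z => f z * g z) x = partial i f x * g x + f x * partial i g x.
  move=> Ox; apply/partial_hasE.
  have := has_derivM (pderivable_at_has i (f1 x Ox)) (pderivable_at_has i (g1 x Ox)).
  by rewrite /= scale0r add0r.
split.
  move=> x Ox; split; last by move=> i; case: (D i x Ox).
  by apply: continuousM; [case: (f1 x Ox)|case: (g1 x Ox)].
move=> i; apply: (@eq_Ck k O (fun x => partial i f x * g x + f x * partial i g x)) => //.
  by move=> x Ox; case: (D i x Ox).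
by apply: CkD => //; apply: IH => //; [exact: f2|exact: g2].
Qed.

Lemma Ck_sum k O (T : Type) (r : seq T) (F : T -> 'rV[R]_n -> R) : open O ->
  (forall i, Ck k O (F i)) -> Ck k O (fun x => \sum_(i <- r) F i x).
Proof.
move=> oO H; elim: r => [|i r IH].
  apply: (@eq_Ck k O (fun=> 0)) => //; last exact: Ck_cst.
  by move=> x _; rewrite big_nil.
apply: (@eq_Ck k O (fun x => F i x + \sum_(i <- r) F i x)) => //.
  by move=> x _; rewrite big_cons.
exact: CkD.
Qed.

Lemma smooth_on_cst O (c : R) : smooth_on O (fun=> c).
Proof. by apply/smooth_CkP => k; apply: Ck_cst. Qed.

Lemma smooth_on_coord O j : smooth_on O (fun z => z ord0 j).
Proof. by apply/smooth_CkP => k; apply: Ck_coord. Qed.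

Lemma smooth_onD O f g : open O -> smooth_on O f -> smooth_on O g ->
  smooth_on O (fun x => f x + g x).
Proof.
by move=> oO /smooth_CkP Hf /smooth_CkP Hg; apply/smooth_CkP => k; apply: CkD.
Qed.

Lemma smooth_onM O f g : open O -> smooth_on O f -> smooth_on O g ->
  smooth_on O (fun x => f x * g x).
Proof.
by move=> oO /smooth_CkP Hf /smooth_CkP Hg; apply/smooth_CkP => k; apply: CkM.
Qed.

Lemma smooth_on_sum O (T : Type) (r : seq T) (F : T -> 'rV[R]_n -> R) : open O ->
  (forall i, smooth_on O (F i)) -> smooth_on O (fun x => \sum_(i <- r) F i x).
Proof.
move=> oO H; apply/smooth_CkP => k; apply: Ck_sum => // i.
by have /smooth_CkP := H i.
Qed.

(** Frechet differentiability at [p], with gradient [l]. *)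
Definition has_grad f p (l : 'I_n -> R) := forall e, 0 < e -> exists2 d, 0 < d &
  forall z, `|z - p| < d ->
    `|f z - f p - \sum_j l j * (z ord0 j - p ord0 j)| <= e * `|z - p|.

(** Going from [p] to [z] parallel to the axes, one coordinate at a time, the
    mean value inequality on each segment compares [f] with its linear part. *)
Lemma C1_grad O f p : open O -> (forall z, O z -> pderivable_at f z) -> O p ->
  (forall j, {for p, continuous (partial j f)}) ->
  has_grad f p (fun j => partial j f p).
Proof.
move=> oO Hf Op Hc e e0.
have e'0 : 0 < e / (n%:R + 1) by rewrite divr_gt0// ltr_wpDl.
have : \forall z \near p, O z /\ forall j, `|partial j f z - partial j f p| <= e / (n%:R + 1).
  apply: filterI; first exact: open_nbhs_nbhs.
  apply: filter_forall_ord => j; have /cvgrPdist_le/(_ _ e'0) := Hc j.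
  by apply: filterS => z; rewrite distrC.
move=> /nbhsEP[d d0 Hd]; exists d => // z zd.
(* the vertices of the path parallel to the axes *)
pose w (k : nat) : 'rV[R]_n := \row_j (if (j < k)%N then z ord0 j else p ord0 j).
have -> : f z - f p = \sum_(k < n) (f (w k.+1) - f (w k)).
  rewrite -(big_mkord xpredT (fun k => f (w k.+1) - f (w k))) telescope_sumr//.
  by congr (f _ - f _); apply/rowP => j; rewrite mxE ?ltn_ord.
rewrite -sumrB.
apply: le_trans (ler_norm_sum _ _ _) _.
apply: (@le_trans _ _ (\sum_(j < n) (e / (n%:R + 1) * `|z - p|))); last first.
  rewrite sumr_const card_ord -[leLHS]mulr_natr mulrAC ler_wpM2r//.
  by rewrite mulrAC ler_pdivrMr ?ltr_wpDl// ler_wpM2l ?(ltW e0)// lerDl.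
apply: ler_sum => k _; set t := z ord0 k - p ord0 k.
have tz : `|t| <= `|z - p|.
  by have := coord_le_norm (z - p) k; rewrite !mxE.
have -> : w k.+1 = t *: 'e_k + w k.
  apply/rowP => j; rewrite !mxE eqxx /= ltnS leq_eqVlt.
  case: (eqVneq j k) => [->|jk].
    by rewrite eqxx ltnn /= mulr1 subrK.
  by rewrite /= mulr0 add0r; case: eqP => // /val_inj jk'; rewrite jk' eqxx in jk.
have in_ball s : `|s| <= `|t| -> `|s *: 'e_k + w k - p| < d.
  move=> st; apply: le_lt_trans zd.
  apply: norm_le_coord => // j; rewrite !mxE eqxx /=.
  case: (eqVneq j k) => [->|jk].
    by rewrite ltnn mulr1 addrK; apply: le_trans st tz.
  rewrite mulr0 add0r; case: ifP => _; last by rewrite subrr normr0.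
  by have := coord_le_norm (z - p) j; rewrite !mxE.
pose J := [set s : R | `|s| <= `|t|].
have iJ : is_interval J.
  move=> a b; rewrite /J /= => Ha Hb c; move: Ha Hb; rewrite !ler_norml.
  by move=> /andP[? ?] /andP[? ?] /andP[? ?]; lra.
have := @mean_value_bound R J 0 t (fun s => f (s *: 'e_k + w k) - partial k f p * s)
  (fun s => partial k f (s *: 'e_k + w k) - partial k f p) (e / (n%:R + 1)) iJ.
rewrite scale0r add0r mulr0 !subr0 => H.
apply: (@le_trans _ _ (e / (n%:R + 1) * `|t|)); last by rewrite ler_wpM2l// ltW.
have {}H : `|f (t *: 'e_k + w k) - partial k f p * t - f (w k)| <= e / (n%:R + 1) * `|t|.
  apply: H; rewrite /J /= ?normr0//.
  - move=> s sJ; apply: has_derivB.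
      by apply: (has_derivW (@subsetT _ _)); apply: pderivable_at_line; apply: Hf; case: (Hd _ (in_ball _ sJ)).
    by rewrite -[X in has_deriv _ _ _ X]mulr1; apply: has_derivZ; apply: has_deriv_id.
  - by move=> s sJ; case: (Hd _ (in_ball _ sJ)).
by rewrite addrAC.
Qed.

Lemma smooth_grad O f p : open O -> smooth_on O f -> O p ->
  has_grad f p (fun j => partial j f p).
Proof.
move=> oO Hf Op; apply: (C1_grad oO _ Op).
  by case/smooth_onE: Hf.
by move=> j; apply: smooth_on_cont (smooth_on_partial j Hf) Op.
Qed.

Lemma has_deriv_curve_lip I (u : R -> 'rV[R]_n) t (a : 'I_n -> R) :
  (forall j, has_deriv I (fun s => u s ord0 j) t (a j)) ->
  exists2 C, 0 < C & exists2 d, 0 < d & forall s, I s -> `|s - t| < d ->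
    `|u s - u t| <= C * `|s - t|.
Proof.
move=> Hu; exists (\sum_j `|a j| + 1); first by rewrite ltr_wpDl// sumr_ge0.
have : \forall s \near within I (nbhs t), forall j,
    `|u s ord0 j - u t ord0 j - a j * (s - t)| <= 1 * `|s - t|.
  by apply: filter_forall_ord => j; apply/withinP; apply: Hu.
move=> /withinP[d d0 Hd]; exists d => // s Is sd; apply: norm_le_coord.
  by rewrite mulr_ge0// addr_ge0// sumr_ge0.
move=> j; rewrite !mxE.
have -> : u s ord0 j - u t ord0 j =
  u s ord0 j - u t ord0 j - a j * (s - t) + a j * (s - t) by ring.
apply: le_trans (ler_normD _ _) _; rewrite addrC mulrDl lerD//; last exact: Hd.
rewrite normrM ler_wpM2r// (bigD1 j)//= lerDl.
exact: sumr_ge0.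
Qed.

(** The linear part of [f] is differentiated along [u] coordinate by
    coordinate; the remainder has derivative 0 because [u] is locally
    Lipschitz. *)
Lemma has_deriv_chain I f (u : R -> 'rV[R]_n) t (l a : 'I_n -> R) :
  has_grad f (u t) l -> (forall j, has_deriv I (fun s => u s ord0 j) t (a j)) ->
  has_deriv I (fun s => f (u s)) t (\sum_j l j * a j).
Proof.
move=> Hf Hu.
have [C C0 [d1 d10 H1]] := has_deriv_curve_lip Hu.
have Hs : has_deriv I (fun s => \sum_j l j * u s ord0 j) t (\sum_j l j * a j).
  by apply: has_deriv_sum => j _; apply: has_derivZ.
have Hr : has_deriv I (fun s => f (u s) - \sum_j l j * u s ord0 j) t 0.
  move=> e e0; have eC : 0 < e / C by rewrite divr_gt0.
  have [d d0 Hd] := Hf _ eC.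
  exists (Num.min d1 (d / C)); first by rewrite lt_min d10 divr_gt0.
  move=> s Is; rewrite lt_min => /andP[sd1 sdC].
  have us := H1 s Is sd1.
  have := Hd (u s); move=> H; have {}H := H (le_lt_trans us _).
  rewrite mulrC -ltr_pdivlMr// in H; have {}H := H sdC.
  rewrite mul0r subr0.
  have -> : f (u s) - \sum_j l j * u s ord0 j - (f (u t) - \sum_j l j * u t ord0 j) =
     f (u s) - f (u t) - \sum_j l j * (u s ord0 j - u t ord0 j).
    by under [X in _ = _ - X]eq_bigr do rewrite mulrBr; rewrite sumrB; ring.
  apply: le_trans H _; apply: le_trans (ler_wpM2l (ltW eC) us) _.
  by rewrite mulrA mulfVK ?gt_eqF.
have := has_derivD Hr Hs; rewrite add0r.
by apply: (has_deriv_near ltr01) => [s Is _|]; rewrite subrK.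
Qed.

End Ck.
End Calculus.

(** * Composition of smooth maps, Lipschitz and Taylor estimates *)

Section SmoothMaps.
Variable R : realType.

Lemma rV_continuous (T : topologicalType) n (h : T -> 'rV[R]_n) (x : T) :
  (forall j, {for x, continuous (fun y => h y ord0 j)}) -> {for x, continuous h}.
Proof.
move=> H; apply/cvgrPdist_lt => e e0.
have : \forall y \near x, forall j, `|h x ord0 j - h y ord0 j| < e.
  by apply: filter_forall_ord => j; have /cvgrPdist_lt := H j; apply.
apply: filterS => y Hy; apply: norm_lt_coord => // j.
by rewrite !mxE.
Qed.

Section Comp.
Variables (n m : nat).
Implicit Types (O : set 'rV[R]_n).

Lemma Ck_comp k O (O' : set 'rV[R]_m) (f : 'rV[R]_m -> R) (h : 'rV[R]_n -> 'rV[R]_m) :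
  open O -> open O' -> (forall x, O x -> O' (h x)) ->
  (forall j, Ck k O (fun x => h x ord0 j)) -> Ck k O' f ->
  Ck k O (fun x => f (h x)).
Proof.
move=> oO oO' hO; elim: k f => [|k IH] f Hh Hf.
  move=> x Ox; apply: continuous_comp; last by apply: Hf; apply: hO.
  by apply: rV_continuous => j; apply: Hh.
have ch x : O x -> {for x, continuous h}.
  by move=> Ox; apply: rV_continuous => j; apply: Ck_cont (Hh j) Ox.
have Hh' j : Ck k O (fun x => h x ord0 j) by apply: CkW.
have D i x : O x -> derivable (fun x => f (h x)) x 'e_i /\
    partial i (fun x => f (h x)) x =
    \sum_j partial j f (h x) * partial i (fun y => h y ord0 j) x.
  move=> Ox; apply/partial_hasE.
  apply: (has_deriv_chain (u := fun t => h (t *: 'e_i + x))).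
    rewrite scale0r add0r; apply: (C1_grad oO' _ (hO x Ox)); first by case: Hf.
    by move=> j; case: Hf => _ Hf; apply: Ck_cont (Hf j) (hO x Ox).
  by move=> j; apply: pderivable_at_has; case: (Hh j) => Hj _; apply: Hj.
split.
  move=> x Ox; split; last by move=> i; case: (D i x Ox).
  apply: continuous_comp; first exact: ch.
  exact: Ck_cont Hf (hO x Ox).
move=> i; apply: (@eq_Ck _ _ k O (fun x =>
    \sum_j partial j f (h x) * partial i (fun y => h y ord0 j) x)) => //.
  by move=> x Ox; case: (D i x Ox).
apply: Ck_sum => // j; apply: CkM => //.
  by apply: IH => //; case: Hf => _; apply.
by case: (Hh j) => _; apply.
Qed.

Lemma smooth_on_comp O (O' : set 'rV[R]_m) (f : 'rV[R]_m -> R) (h : 'rV[R]_n -> 'rV[R]_m) :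
  open O -> open O' -> (forall x, O x -> O' (h x)) ->
  smooth_map_on O h -> smooth_on O' f -> smooth_on O (fun x => f (h x)).
Proof.
move=> oO oO' hO Hh /smooth_CkP Hf; apply/smooth_CkP => k.
by apply: (Ck_comp oO oO') => // j; have /smooth_CkP := Hh j.
Qed.

Lemma smooth_map_on_cont O (h : 'rV[R]_n -> 'rV[R]_m) x :
  smooth_map_on O h -> O x -> {for x, continuous h}.
Proof. by move=> H Ox; apply: rV_continuous => j; apply: smooth_on_cont (H j) Ox. Qed.

End Comp.

Lemma smooth_map_on_comp n m p (O : set 'rV[R]_n) (O' : set 'rV[R]_m)
   (f : 'rV[R]_m -> 'rV[R]_p) (h : 'rV[R]_n -> 'rV[R]_m) :
  open O -> open O' -> (forall x, O x -> O' (h x)) ->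
  smooth_map_on O h -> smooth_map_on O' f -> smooth_map_on O (fun x => f (h x)).
Proof.
move=> oO oO' hO Hh Hf j.
exact: (smooth_on_comp (f := fun z => f z ord0 j) oO oO' hO Hh (Hf j)).
Qed.

Lemma open_preimage_on n (T : topologicalType) (O : set 'rV[R]_n)
    (h : 'rV[R]_n -> T) (O' : set T) : open O -> open O' ->
  (forall x, O x -> {for x, continuous h}) -> open [set x | O x /\ O' (h x)].
Proof.
move=> oO oO' ch; rewrite openE => x [Ox O'x].
apply: filterI; first exact: open_nbhs_nbhs.
by apply: (ch x Ox); apply: open_nbhs_nbhs; split.
Qed.

(** For a function of one real variable, the tower [d] of its successive
    derivatives takes the place of smoothness on a space of row vectors. *)
Lemma smooth_on_comp1 n (O : set 'rV[R]_n) (d : nat -> R -> R) (g : 'rV[R]_n -> R) :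
  open O -> (forall k t, has_deriv setT (d k) t (d k.+1 t)) ->
  smooth_on O g -> smooth_on O (fun x => d 0%N (g x)).
Proof.
move=> oO Hd /smooth_CkP Hg; apply/smooth_CkP => k.
suff H m : Ck k O (fun x => d m (g x)) by exact: H.
elim: k m (Hg k) => [|k IH] m Hgk.
  move=> x Ox; apply: (continuous_comp (f := g)); first exact: Hgk.
  have := has_deriv_cvg (Hd m (g x)) => /cvgrPdist_lt H.
  apply/cvgrPdist_lt => e e0; have /withinP[r r0 Hr] := H e e0.
  by apply/nbhsRP; exists r => // s; apply: Hr.
have D (i : 'I_n) (x : 'rV[R]_n) : O x -> derivable (fun x : 'rV[R]_n => d m (g x)) x 'e_i /\
    partial i (fun x : 'rV[R]_n => d m (g x)) x = d m.+1 (g x) * partial i g x.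
  move=> Ox; apply/partial_hasE.
  apply: (has_deriv_comp (d := 1) (I := setT) (u := fun t => g (t *: 'e_i + x))) => //.
    by apply: pderivable_at_has; case: Hgk => Hgk _; apply: Hgk.
  by rewrite scale0r add0r.
split.
  move=> x Ox; split; last by move=> i; case: (D i x Ox).
  apply: (continuous_comp (f := g)); first exact: (Ck_cont Hgk).
  have := has_deriv_cvg (Hd m (g x)) => /cvgrPdist_lt H.
  apply/cvgrPdist_lt => e e0; have /withinP[r r0 Hr] := H e e0.
  by apply/nbhsRP; exists r => // s; apply: Hr.
move=> i; apply: (@eq_Ck _ _ k O (fun x => d m.+1 (g x) * partial i g x)) => //.
  by move=> x Ox; case: (D i x Ox).
apply: CkM => //; last by case: Hgk => _; apply.
by apply: IH; apply: CkW.
Qed.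

Lemma compact_fun_bound (T : topologicalType) (K : set T) (f : T -> R) :
  compact K -> (forall x, K x -> {for x, continuous f}) ->
  exists2 M, 0 <= M & forall x, K x -> `|f x| <= M.
Proof.
move=> cK cf; have [->|/set0P K0] := eqVneq K set0; first by exists 0.
have [|c Kc Hc] := @compact_EVT_max T R (fun x => `|f x|) K K0 cK.
  apply: continuous_in_subspaceT => x; rewrite inE => Kx.
  by apply: continuous_comp; [exact: cf|exact: norm_continuous].
exists `|f c| => // x Kx; apply: Hc; exact: mem_set.
Qed.

Section Lipschitz.
Variable n : nat.
Implicit Types (O : set 'rV[R]_n) (a x y : 'rV[R]_n).

Lemma cball_compact a (r : R) : compact [set x : 'rV[R]_n | `|x - a| <= r].
Proof.
apply: bounded_closed_compact.
  exists (`|a| + r); split; first exact: num_real.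
  move=> M rM x /= xr; apply: le_trans (ltW rM).
  by rewrite -[x](subrK a) addrC (le_trans (ler_normD _ _))// lerD2l.
have -> : [set x : 'rV[R]_n | `|x - a| <= r] =
    (fun x : 'rV[R]_n => `|x - a|) @^-1` [set t : R | t <= r] by [].
apply: closed_comp; last exact: closed_le.
move=> x _; apply: (@continuous_comp _ _ _ (fun x : 'rV[R]_n => x - a)).
  by apply: continuousB; [move=> A; exact|apply: cst_continuous].
exact: norm_continuous.
Qed.

Lemma segment_ball a r x y (t : R) : `|x - a| <= r -> `|y - a| <= r -> 0 <= t <= 1 ->
  `|t *: (y - x) + x - a| <= r.
Proof.
move=> xr yr /andP[t0 t1].
have -> : t *: (y - x) + x - a = t *: (y - a) + (1 - t) *: (x - a).
  by rewrite !scalerBr !scalerBl !scale1r; apply/rowP => j; rewrite !mxE; ring.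
apply: le_trans (ler_normD _ _) _; rewrite !normrZ ger0_norm// ger0_norm ?subr_ge0//.
have := ler_wpM2l t0 yr; have t1' : 0 <= 1 - t by rewrite subr_ge0.
by have := ler_wpM2l t1' xr; lra.
Qed.

Lemma has_deriv_segment I x y t (j : 'I_n) :
  has_deriv I (fun t => (t *: (y - x) + x) ord0 j) t (y ord0 j - x ord0 j).
Proof.
have := has_derivD (has_derivZ (y ord0 j - x ord0 j) (@has_deriv_id R I t))
  (@has_deriv_cst R I (x ord0 j) t); rewrite addr0 mulr1.
by apply: (has_deriv_near ltr01) => [s Is _|]; rewrite !mxE mulrC.
Qed.

Lemma itv01 : is_interval `[0, (1:R)]%classic.
Proof. exact: interval_is_interval. Qed.

(** The gradient is bounded on the compact ball, and a ball contains the
    segment between any two of its points. *)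
Lemma smooth_lipschitz O (f : 'rV[R]_n -> R) a r : open O -> smooth_on O f ->
  (forall x, `|x - a| <= r -> O x) ->
  exists2 L, 0 <= L & forall x y, `|x - a| <= r -> `|y - a| <= r ->
    `|f y - f x| <= L * `|y - x|.
Proof.
move=> oO Hf KO.
have [|j|M M0 HM] := @fin_bound R 'I_n (fun j M => forall x, `|x - a| <= r -> `|partial j f x| <= M).
- by move=> i u v uv H x /H Hx; apply: le_trans uv.
- apply: compact_fun_bound (cball_compact (a := a) (r := r)) _ => x xr.
  by apply: smooth_on_cont (smooth_on_partial j Hf) _; apply: KO.
exists (n%:R * M) => [|x y xr yr]; first by rewrite mulr_ge0.
have H0 : `[0, (1:R)]%classic 0 by rewrite /= in_itv /= lexx ler01.
have H1 : `[0, (1:R)]%classic 1 by rewrite /= in_itv /= lexx ler01.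
have seg t : `[0, (1:R)]%classic t -> `|t *: (y - x) + x - a| <= r.
  by rewrite /= in_itv /=; apply: segment_ball.
have := @mean_value_bound R `[0, 1]%classic 0 1 (fun t => f (t *: (y - x) + x))
  (fun t => \sum_j partial j f (t *: (y - x) + x) * (y ord0 j - x ord0 j))
  (n%:R * M * `|y - x|) itv01 H0 H1.
rewrite scale1r subrK scale0r add0r subr0 normr1 mulr1; apply.
- move=> t Jt; apply: (has_deriv_chain (u := fun t => t *: (y - x) + x)).
    by apply: (smooth_grad oO Hf); apply: KO; apply: seg.
  by move=> j; apply: has_deriv_segment.
- move=> t Jt; apply: le_trans (ler_norm_sum _ _ _) _.
  rewrite -mulrA mulr_natl -[X in _ *+ X](card_ord n) -sumr_const; apply: ler_sum => j _.
  rewrite normrM; apply: ler_pM => //; first by apply: HM; apply: seg.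
  by have := coord_le_norm (y - x) j; rewrite !mxE.
Qed.

(** The mean value inequality along the segment, for [f] minus its linear part
    at [x]: the derivative of that difference is small because the partial
    derivatives are Lipschitz. *)
Lemma smooth_taylor O (f : 'rV[R]_n -> R) a r : open O -> smooth_on O f ->
  (forall x, `|x - a| <= r -> O x) ->
  exists2 L, 0 <= L & forall x y, `|x - a| <= r -> `|y - a| <= r ->
    `|f y - f x - \sum_j partial j f x * (y ord0 j - x ord0 j)| <= L * `|y - x| ^+ 2.
Proof.
move=> oO Hf KO.
have [|j|M M0 HM] := @fin_bound R 'I_n (fun j L => forall x y, `|x - a| <= r -> `|y - a| <= r ->
    `|partial j f y - partial j f x| <= L * `|y - x|).
- by move=> i u v uv H x y xr yr; apply: le_trans (H x y xr yr) _; rewrite ler_wpM2r.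
- exact: smooth_lipschitz oO (smooth_on_partial j Hf) KO.
exists (n%:R * M) => [|x y xr yr]; first by rewrite mulr_ge0.
have H0 : `[0, (1:R)]%classic 0 by rewrite /= in_itv /= lexx ler01.
have H1 : `[0, (1:R)]%classic 1 by rewrite /= in_itv /= lexx ler01.
have seg t : `[0, (1:R)]%classic t -> `|t *: (y - x) + x - a| <= r.
  by rewrite /= in_itv /=; apply: segment_ball.
pose S := \sum_j partial j f x * (y ord0 j - x ord0 j).
have := @mean_value_bound R `[0, 1]%classic 0 1 (fun t => f (t *: (y - x) + x) - S * t)
  (fun t => \sum_j partial j f (t *: (y - x) + x) * (y ord0 j - x ord0 j) - S)
  (n%:R * M * `|y - x| ^+ 2) itv01 H0 H1.
rewrite scale1r subrK scale0r add0r !subr0 normr1 !mulr1 mulr0 subr0 -/S => H.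
rewrite addrAC; apply: H.
- move=> t Jt; apply: has_derivB.
    apply: (has_deriv_chain (u := fun t => t *: (y - x) + x)).
      by apply: (smooth_grad oO Hf); apply: KO; apply: seg.
    by move=> j; apply: has_deriv_segment.
  by rewrite -[X in has_deriv _ _ _ X]mulr1; apply: has_derivZ; apply: has_deriv_id.
- move=> t Jt; rewrite -sumrB; apply: le_trans (ler_norm_sum _ _ _) _.
  rewrite -mulrA mulr_natl -[X in _ *+ X](card_ord n) -sumr_const; apply: ler_sum => j _.
  rewrite -mulrBl normrM expr2 mulrA; apply: ler_pM => //.
    apply: le_trans (HM j _ _ xr (seg t Jt)) _; rewrite addrK normrZ ler_wpM2l//.
    move: Jt; rewrite /= in_itv /= => /andP[t0 t1].
    by rewrite ger0_norm// ler_piMl.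
  by have := coord_le_norm (y - x) j; rewrite !mxE.
Qed.

End Lipschitz.
End SmoothMaps.

(** * Bump functions on R^n *)

Section Bump.
Variable R : realType.

Lemma has_deriv_inv (t : R) : t != 0 ->
  has_deriv setT (fun s => s^-1) t (- (t^-1) ^+ 2).
Proof.
move=> t0; apply/is_derive1_hasE.
have H := @is_deriveV R id t 1 1 t0 (is_derive_id _ _).
by apply: is_derive_eq H _; rewrite exprVn [_ *: _]mulr1.
Qed.

Lemma has_deriv_horner (p : {poly R}) (t : R) :
  has_deriv setT (horner p) t (p^`()).[t].
Proof.
apply/is_derive1_hasE; apply: is_derive_eq (derivableP (derivable_horner p t)) _.
Qed.

(** The extension by 0 of [p(1/x) exp(-1/x)]. The derivative of such a
    function is the one of [flat_deriv p], so all of them are smooth at once. *)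
Definition flat (p : {poly R}) (x : R) : R :=
  if 0 < x then p.[x^-1] * expR (- x^-1) else 0.

Definition flat_deriv (p : {poly R}) : {poly R} := 'X^2 * (p - p^`()).

(** The exponential of [y] is the power [k.+1] of that of [y / k.+1], which is
    at least [y / k.+1]. *)
Lemma expXn_bound k (y : R) : 0 < y ->
  y ^+ k * expR (- y) <= (k.+1%:R ^+ k.+1) * y^-1.
Proof.
move=> y0; rewrite expRN ler_pdivrMr ?expR_gt0// -mulrA mulrC -mulrA.
rewrite ler_pdivlMl// -exprS.
have -> : expR y = expR (y / k.+1%:R) ^+ k.+1.
  by rewrite -expRM_natl mulrC divfK// pnatr_eq0.
rewrite -exprMn; apply: lerXn2r; rewrite ?nnegrE ?(ltW y0)//.
rewrite -ler_pdivrMr ?ltr0n//.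
by apply: le_trans (expR_ge1Dx _); rewrite lerDr.
Qed.

Lemma flat_bound (p : {poly R}) : exists2 C, 0 <= C &
  forall s, 0 < s -> `|flat p s| <= C * s.
Proof.
exists (\sum_(i < size p) `|p`_i| * (i.+1%:R ^+ i.+1)).
  by apply: sumr_ge0 => i _; rewrite mulr_ge0.
move=> s s0; rewrite /flat s0 normrM (ger0_norm (expR_ge0 _)) horner_coef.
apply: (le_trans (ler_wpM2r (expR_ge0 _) (ler_norm_sum _ _ _))).
rewrite !mulr_suml; apply: ler_sum => i _.
have si0 : 0 < s^-1 by rewrite invr_gt0.
rewrite normrM (ger0_norm (exprn_ge0 _ (ltW si0))) -!mulrA ler_wpM2l//.
by apply: le_trans (expXn_bound i si0) _; rewrite invrK.
Qed.

Lemma flat_has_deriv (p : {poly R}) (t : R) :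
  has_deriv setT (flat p) t (flat (flat_deriv p) t).
Proof.
case: (ltgtP t 0) => [t0|t0|->].
- rewrite {2}/flat ltNge (ltW t0) /=; have d0 : 0 < - t by rewrite oppr_gt0.
  apply: (has_deriv_near d0 _ _ (@has_deriv_cst R setT 0 t)).
    move=> s _; rewrite ltr_norml => /andP[_ st]; split => //.
    rewrite /flat ltNge; have -> // : s <= 0 by lra.
  by rewrite /flat ltNge (ltW t0).
- have t0' : t != 0 by rewrite gt_eqF.
  have Hi := has_deriv_inv t0'.
  have H1 := has_deriv_comp (d := 1) (I := setT) ltr01 (fun _ _ _ => I) Hi (has_deriv_horner p _).
  have H2 := has_deriv_comp (d := 1) (I := setT) ltr01 (fun _ _ _ => I) Hi
    (@has_deriv_expZ R setT (-1) _).
  have := has_derivM H1 H2; rewrite /=.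
  have -> : p^`().[t^-1] * - t^-1 ^+ 2 * expR (-1 * t^-1) +
      p.[t^-1] * (-1 * expR (-1 * t^-1) * - t^-1 ^+ 2) = flat (flat_deriv p) t.
    rewrite /flat t0 /flat_deriv hornerM hornerXn hornerD hornerN mulN1r.
    ring.
  apply: (has_deriv_near t0); last by rewrite /flat t0 mulN1r.
  move=> s _; rewrite ltr_norml => /andP[st _]; split => //.
  have s0 : 0 < s by lra.
  by rewrite /flat s0 /= mulN1r.
- have E q : flat q 0 = 0 by rewrite /flat ltxx.
  (* the difference quotient of flat p at 0 is flat ('X * p), which tends to 0 *)
  rewrite E => e e0; have [C C0 HC] := flat_bound ('X * p).
  exists (e / (C + 1)); first by rewrite divr_gt0// ltr_wpDl.
  move=> s _; rewrite E !subr0 mul0r subr0; case: (ltrP 0 s) => s0.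
    rewrite ger0_norm ?(ltW s0)// ltr_pdivlMr ?ltr_wpDl// => sC.
    have -> : flat p s = flat ('X * p) s * s.
      rewrite /flat s0 hornerM hornerX; set q := p.[_]; set e1 := expR _; have sn0 : s != 0 by rewrite gt_eqF.
      by rewrite [s^-1 * q]mulrC -[q * _ * e1]mulrA [s^-1 * e1]mulrC !mulrA mulfVK.
    rewrite normrM (ger0_norm (ltW s0)) ler_wpM2r ?(ltW s0)//.
    apply: le_trans (HC s s0) _; lra.
  by move=> _; rewrite /flat ltNge s0 /= normr0 mulr_ge0// ltW.
Qed.

Definition rho : R -> R := flat 1.

Lemma rho_smooth n (O : set 'rV[R]_n) (g : 'rV[R]_n -> R) : open O ->
  smooth_on O g -> smooth_on O (fun x => rho (g x)).
Proof.
move=> oO; apply: (@smooth_on_comp1 R n O (fun k => flat (iter k flat_deriv 1)) g oO).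
by move=> k t; rewrite iterS; apply: flat_has_deriv.
Qed.

Lemma rho_gt0 x : 0 < x -> 0 < rho x.
Proof. by move=> x0; rewrite /rho /flat x0 hornerC mul1r expR_gt0. Qed.

Lemma rho_le0 x : x <= 0 -> rho x = 0.
Proof. by move=> x0; rewrite /rho /flat ltNge x0. Qed.

Lemma rho_ge0 x : 0 <= rho x.
Proof. by case: (lerP x 0) => [/rho_le0->//|/rho_gt0/ltW]. Qed.

Lemma rho_mono x y : x <= y -> rho x <= rho y.
Proof.
move=> xy; case: (lerP x 0) => [/rho_le0->|x0]; first exact: rho_ge0.
have y0 := lt_le_trans x0 xy.
by rewrite /rho /flat x0 y0 !hornerC !mul1r ler_expR lerN2 lef_pV2// posrE.
Qed.

(** Using [rho] twice avoids a quotient of functions: [rho 1 - rho x] is the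
    positive constant [rho 1] for [x <= 0] and is not positive for [1 <= x]. *)
Definition plateau x : R := (rho (rho 1))^-1 * rho (rho 1 - rho x).

Lemma rho11 : 0 < rho (rho 1).
Proof. by do 2 apply: rho_gt0. Qed.

Lemma plateau1 x : x <= 0 -> plateau x = 1.
Proof. by move=> /rho_le0 H; rewrite /plateau H subr0 mulVf// gt_eqF// rho11. Qed.

Lemma plateau0 x : 1 <= x -> plateau x = 0.
Proof. by move=> /rho_mono H; rewrite /plateau [rho (_ - _)]rho_le0 ?mulr0// subr_le0. Qed.

Lemma plateau_itv x : 0 <= plateau x <= 1.
Proof.
rewrite /plateau mulr_ge0 ?rho_ge0 ?invr_ge0 ?rho_ge0//=.
by rewrite ler_pdivrMl ?rho11// mulr1 rho_mono// gerBl rho_ge0.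
Qed.

Section BumpRV.
Variable n : nat.

Lemma bump_rV (a : 'rV[R]_n) (r : R) : 0 < r -> exists b : 'rV[R]_n -> R,
  [/\ smooth_on setT b, forall x, 0 <= b x <= 1,
      exists2 r', 0 < r' & forall x, `|x - a| < r' -> b x = 1 &
      forall x, r <= `|x - a| -> b x = 0].
Proof.
(* c is chosen so that the argument of plateau, which is about -1 near a, is
   at least 1 outside the ball of radius r *)
move=> r0; pose c := 2 / r ^+ 2.
have c0 : 0 < c by rewrite divr_gt0// exprn_gt0.
exists (fun x => plateau (c * (\sum_j (x ord0 j - a ord0 j) * (x ord0 j - a ord0 j)) - 1)).
have oT : open [set: 'rV[R]_n] by exact: openT.
have E (x : 'rV[R]_n) : \sum_j (x ord0 j - a ord0 j) * (x ord0 j - a ord0 j) = sqn (x - a).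
  by apply: eq_bigr => j _; rewrite !mxE expr2.
split.
- apply: smooth_onM => //; first exact: smooth_on_cst.
  apply: rho_smooth => //; apply: smooth_onD => //; first exact: smooth_on_cst.
  apply: (@eq_smooth_on _ _ _ (fun x => -1 * rho (c * (\sum_j (x ord0 j - a ord0 j) * (x ord0 j - a ord0 j)) - 1))) => //.
    by move=> x _; rewrite mulN1r.
  apply: smooth_onM => //; first exact: smooth_on_cst.
  apply: rho_smooth => //; apply: smooth_onD => //; last exact: smooth_on_cst.
  apply: smooth_onM => //; first exact: smooth_on_cst.
  apply: smooth_on_sum => // j.
  have H : smooth_on [set: 'rV[R]_n] (fun x : 'rV_n => x ord0 j - a ord0 j).
    by apply: smooth_onD => //; [exact: smooth_on_coord|exact: smooth_on_cst].
  exact: smooth_onM.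
- by move=> x; exact: plateau_itv.
- exists (r / (n%:R + 1)); first by rewrite divr_gt0// ltr_wpDl.
  move=> x xr; apply: plateau1; rewrite E subr_le0 /c mulrAC ler_pdivrMr ?exprn_gt0// mul1r.
  have n1 : (0 : R) < n%:R + 1 by rewrite ltr_wpDl.
  move: xr; rewrite ltr_pdivlMr// => xr.
  have H : (`|x - a| * (n%:R + 1)) ^+ 2 <= r ^+ 2.
    by rewrite ler_sqr ?nnegrE ?(ltW r0) ?(ltW xr)// mulr_ge0// ltW.
  have := sqn_norm (x - a).
  have : 0 <= `|x - a| ^+ 2 * (n%:R ^+ 2 + 1) by rewrite mulr_ge0 ?addr_ge0 ?sqr_ge0.
  move: H; rewrite exprMn; move: (sqn _) (`|x - a| ^+ 2) (r ^+ 2) => s q w; nra.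
- move=> x xr; apply: plateau0; rewrite E.
  have H : r ^+ 2 <= sqn (x - a).
    by apply: le_trans (norm_sqn _); rewrite ler_sqr ?nnegrE// ltW.
  have : 2 <= c * sqn (x - a).
    by rewrite /c mulrAC ler_pdivlMr ?exprn_gt0// ler_wpM2l.
  lra.
Qed.

Lemma open_ball_norm (a : 'rV[R]_n) (r : R) : open [set x : 'rV[R]_n | `|x - a| < r].
Proof.
rewrite openE => x /= xr; change (\forall z \near x, `|z - a| < r).
apply/nbhsEP; exists (r - `|x - a|).
  by rewrite subr_gt0.
move=> z zx; have -> : z - a = (z - x) + (x - a) by rewrite subrKA.
by apply: le_lt_trans (ler_normD _ _) _; rewrite -ltrBrDr.
Qed.

Lemma open_ball_out (a : 'rV[R]_n) (r : R) : open [set x : 'rV[R]_n | r < `|x - a|].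
Proof.
rewrite openE => x /= xr; change (\forall z \near x, r < `|z - a|).
apply/nbhsEP; exists (`|x - a| - r).
  by rewrite subr_gt0.
move=> z zx; have : `|x - a| <= `|z - x| + `|z - a|.
  have -> : x - a = (x - z) + (z - a) by rewrite subrKA.
  by rewrite [`|z - x|]distrC ler_normD.
lra.
Qed.

(** A bump function supported in a closed ball inside [O] makes any product
    with a function smooth on [O] smooth on the whole space. *)
Lemma smooth_cutoff (O : set 'rV[R]_n) (a : 'rV[R]_n) : open O -> O a ->
  exists b : 'rV[R]_n -> R,
  [/\ smooth_on setT b, forall x, 0 <= b x <= 1,
      exists2 r, 0 < r & forall x, `|x - a| < r -> O x /\ b x = 1,
      exists r, forall x, r <= `|x - a| -> b x = 0 &
      forall f, smooth_on O f -> smooth_on setT (fun x => b x * f x)].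
Proof.
move=> oO Oa; have /nbhsEP[r r0 Hr] : nbhs a O by apply: open_nbhs_nbhs.
have r20 : 0 < r / 2 by rewrite divr_gt0.
have [b [sb b01 [r' r'0 b1] b0]] := bump_rV a r20.
exists b; split => //.
- exists (Num.min r r'); first by rewrite lt_min r0.
  by move=> x; rewrite lt_min => /andP[/Hr ? /b1 ?].
- by exists (r / 2).
- move=> f sf s x _; case: (ltrP `|x - a| r) => xr.
    have : smooth_on [set x : 'rV[R]_n | `|x - a| < r] (fun x => b x * f x).
      apply: smooth_onM; first exact: open_ball_norm.
        by apply: smooth_onS sb.
      by apply: smooth_onS sf => z; apply: Hr.
    exact.
  have : smooth_on [set x : 'rV[R]_n | r / 2 < `|x - a|] (fun x => b x * f x).
    apply: (@eq_smooth_on _ _ _ (fun=> 0)).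
    - exact: open_ball_out.
    - by move=> z /= zr; rewrite b0 ?mul0r// ltW.
    - exact: smooth_on_cst.
  apply => /=; lra.
Qed.

(** Chart transitions and local fields are smooth on open sets only, while the
    smooth functions of a stratified space are locally given by functions
    smooth on the whole of R^n. *)
Lemma smooth_extend m (O : set 'rV[R]_n) (a : 'rV[R]_n) (f : 'rV[R]_n -> 'rV[R]_m) :
  open O -> O a -> smooth_map_on O f ->
  exists g : 'rV[R]_n -> 'rV[R]_m, smooth_map_on setT g /\
    exists2 r, 0 < r & forall x, `|x - a| < r -> O x /\ g x = f x.
Proof.
move=> oO Oa sf; have [b [sb _ [r r0 Hr] _ Hb]] := smooth_cutoff oO Oa.
exists (fun x => b x *: f x); split.
  move=> j; apply: (@eq_smooth_on _ _ _ (fun x => b x * f x ord0 j)).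
  - exact: openT.
  - by move=> x _; rewrite mxE.
  - exact: Hb.
exists r => // x /Hr[Ox bx]; split => //; by rewrite bx scale1r.
Qed.

Lemma smooth_extend1 (O : set 'rV[R]_n) (a : 'rV[R]_n) (f : 'rV[R]_n -> R) :
  open O -> O a -> smooth_on O f ->
  exists g : 'rV[R]_n -> R, smooth_on setT g /\
    exists2 r, 0 < r & forall x, `|x - a| < r -> O x /\ g x = f x.
Proof.
move=> oO Oa sf; have [b [sb _ [r r0 Hr] _ Hb]] := smooth_cutoff oO Oa.
exists (fun x => b x * f x); split; first exact: Hb.
by exists r => // x /Hr[Ox bx]; rewrite bx mul1r.
Qed.

End BumpRV.
End Bump.

(** * Flows of Lipschitz fields *)

Section ODE.
Variable R : realType.

(** The intervals with centres [a i] and radii [e i] meet pairwise, so the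
    supremum of their left ends belongs to all of them. *)
Lemma nested_limit (T : Type) (a e : T -> R) : inhabited T ->
  (forall i j, `|a i - a j| <= e i + e j) -> exists l, forall i, `|l - a i| <= e i.
Proof.
case=> i0 H; pose S := [set x | exists i, x = a i - e i].
have Hi i j : a i - e i <= a j + e j.
  by have := H i j; rewrite ler_norml => /andP[]; lra.
have S0 : S !=set0 by exists (a i0 - e i0), i0.
have ub i : ubound S (a i + e i) by move=> x [j ->]; apply: Hi.
exists (sup S) => i; rewrite ler_norml; apply/andP; split.
  have : a i - e i <= sup S by apply: ub_le_sup; [exists (a i + e i); exact: ub|exists i].
  lra.
have : sup S <= a i + e i by apply: ge_sup.
lra.
Qed.

Definition antiderivative_of (g G : R -> R) :=
  G 0 = 0 /\ forall t, has_deriv setT G t (g t).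

Lemma antiderivative_from (g : R -> R) (N : R) : 0 < N -> continuous g ->
  exists G : R -> R, G 0 = 0 /\ forall t, - N < t -> has_deriv setT G t (g t).
Proof.
move=> N0 cg; pose F (x : R) : R := (\int[lebesgue_measure]_(t in `[- N, x]) (g t))%R.
exists (fun x => F x - F 0); split; first by rewrite subrr.
move=> t Nt; rewrite -[g t]subr0; apply: has_derivB; last exact: has_deriv_cst.
apply/is_derive1_hasE.
have tt : t < t + 1 by rewrite ltrDl.
have ig : (@lebesgue_measure R).-integrable `[- N, t + 1] (EFin \o g).
  apply: continuous_compact_integrable; first exact: segment_compact.
  exact: continuous_subspaceT.
have [D E] := continuous_FTC1_closed tt ig Nt (cg t).
by apply: is_derive_eq (derivableP D) _; rewrite -derive1E.
Qed.

(** The integral from [- N] is an antiderivative to the right of [- N] only;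
    for different [N], the antiderivatives vanishing at 0 coincide on their
    common domain and can be patched together. *)
Lemma antiderivative_exists (g : R -> R) : continuous g ->
  exists G, antiderivative_of g G.
Proof.
move=> cg.
have {cg} [F HF] : {F : R -> R -> R & forall N, 0 < N ->
    F N 0 = 0 /\ forall t, - N < t -> has_deriv setT (F N) t (g t)}.
  apply: (@choice _ _ (fun N G => 0 < N -> G 0 = 0 /\ forall t, - N < t -> has_deriv setT G t (g t))).
  move=> N; have [N0|N0] := ltP 0 N; last by exists (fun=> 0).
  by have [G HG] := antiderivative_from N0 cg; exists G.
have E N M t : 0 < N -> - N < t -> N <= M -> F N t = F M t.
  move=> N0 Nt NM; have M0 := lt_le_trans N0 NM.
  have [FN HN] := HF N N0; have [FM HM] := HF M M0.
  pose J := [set s : R | - N < s].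
  have iJ : is_interval J.
    by move=> a b; rewrite /J /= => Ha Hb c /andP[? ?]; lra.
  have := @mean_value_bound R J 0 t (fun s => F N s - F M s) (fun s => g s - g s) 0 iJ.
  rewrite FN FM subrr subr0 mul0r normr_le0 subr_eq0 => H.
  apply/eqP; apply: H; rewrite /J /= ?oppr_lt0//.
  - move=> s Ns; apply: has_derivB; apply: (has_derivW (@subsetT _ _)).
      exact: HN.
    by apply: HM; lra.
  - by move=> s _; rewrite subrr normr0.
(* at t the value of F N does not depend on N > - t *)
exists (fun t => F (`|t| + 1) t); split.
  by rewrite normr0 add0r; case: (HF 1 ltr01).
move=> t; have t2 : 0 < `|t| + 2 by rewrite ltr_wpDl.
have [_ H] := HF _ t2; have tt : - (`|t| + 2) < t.
  by have := ler_norm (- t); rewrite normrN; lra.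
have N1 (s : R) : - (`|s| + 1) < s by have := ler_norm (- s); rewrite normrN; lra.
have N0 (s : R) : (0 : R) < `|s| + 1 by rewrite ltr_wpDl.
apply: (has_deriv_near ltr01 _ _ (H t tt)).
  move=> s _ st; split => //; apply/esym; apply: E => //.
  have : `|s| <= `|s - t| + `|t| by rewrite -{1}[s](subrK t) ler_normD.
  lra.
by apply/esym; apply: E => //; lra.
Qed.

Definition antider (g : R -> R) : R -> R := xget (fun=> 0) [set G | antiderivative_of g G].

Lemma antiderP (g : R -> R) : continuous g -> antiderivative_of g (antider g).
Proof. by move=> /antiderivative_exists[G HG]; exact: (xgetPex (fun=> 0) (ex_intro _ G HG)). Qed.

Lemma has_deriv_continuous (g : R -> R) t l : has_deriv setT g t l ->
  {for t, continuous g}.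
Proof.
move=> /has_deriv_cvg/cvgrPdist_lt H; apply/cvgrPdist_lt => e e0.
by have /withinP[r r0 Hr] := H e e0; apply/nbhsRP; exists r => // s; apply: Hr.
Qed.

(** The approximations differ little from [q], and the mean value inequality
    bounds how far each of them is from its tangent line, uniformly: their
    derivatives stay close to [p], which hardly varies near [t]. *)
Lemma limit_has_deriv (q p : R -> R) (t d : R) : 0 < d ->
  (forall e, 0 < e -> exists r dr : R -> R,
    {for t, continuous dr} /\
    forall s, `|s - t| < d ->
      [/\ has_deriv setT r s (dr s), `|r s - q s| <= e & `|dr s - p s| <= e]) ->
  has_deriv setT q t (p t).
Proof.
move=> d0 H e e0.
have e60 : 0 < e / 6 by rewrite divr_gt0.
have [r1 [dr1 [c1 H1]]] := H _ e60.
have /cvgrPdist_le/(_ _ e60)/nbhsRP[d1 d10 Hd1] := c1.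
exists (Num.min d d1); first by rewrite lt_min d0.
move=> s _; rewrite lt_min => /andP[sd sd1].
have [->|st] := eqVneq s t; first by rewrite !subrr mulr0 subrr normr0 mulr0.
have st0 : 0 < `|s - t| by rewrite normr_gt0 subr_eq0.
have tt : `|t - t| < d by rewrite subrr normr0.
have pc u : `|u - t| < d -> `|u - t| < d1 -> `|p u - p t| <= e / 2.
  move=> ud ud1; have [_ _ Eu] := H1 u ud; have [_ _ Et] := H1 t tt.
  have := Hd1 u ud1.
  have -> : p u - p t = - (dr1 u - p u) + (dr1 t - p t) - (dr1 t - dr1 u) by ring.
  have := ler_normB (- (dr1 u - p u) + (dr1 t - p t)) (dr1 t - dr1 u).
  have := ler_normD (- (dr1 u - p u)) (dr1 t - p t).
  by rewrite normrN; lra.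
(* the second approximation may depend on s, so its precision can be chosen
   small compared with the distance of s and t *)
pose eta := e / 2 * `|s - t| / (2 + `|s - t|).
have p0 : 0 < 2 + `|s - t| by rewrite ltr_pwDl.
have eta0 : 0 < eta by rewrite /eta !mulr_gt0// ?invr_gt0.
have [r [dr [_ Hr]]] := H _ eta0.
pose J := [set u : R | `|u - t| < Num.min d d1].
have iJ : is_interval J.
  move=> a b; rewrite /J /= => Ha Hb c; move: Ha Hb; rewrite !ltr_norml.
  by move=> /andP[? ?] /andP[? ?] /andP[? ?]; lra.
have Js : J s by rewrite /J /= lt_min sd.
have Jt : J t by rewrite /J /= lt_min subrr normr0 d0.
have := @mean_value_bound R J t s (fun u => r u - p t * u) (fun u => dr u - p t) (eta + e / 2) iJ Jt Js.
move=> M; have {}M : `|r s - p t * s - (r t - p t * t)| <= (eta + e / 2) * `|s - t|.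
  apply: M => u; rewrite /J /= lt_min => /andP[ud ud1]; have [Hu _ Eu] := Hr u ud.
    apply: has_derivB; first exact: (has_derivW (@subsetT _ _) Hu).
    by rewrite -[X in has_deriv _ _ _ X]mulr1; apply: has_derivZ; apply: has_deriv_id.
  have -> : dr u - p t = (dr u - p u) + (p u - p t) by ring.
  by have := pc u ud ud1; have := ler_normD (dr u - p u) (p u - p t); lra.
have [_ Es _] := Hr s sd; have [_ Et _] := Hr t tt.
have -> : q s - q t - p t * (s - t) =
  (r s - p t * s - (r t - p t * t)) + ((r t - q t) - (r s - q s)) by ring.
have := ler_normD (r s - p t * s - (r t - p t * t)) ((r t - q t) - (r s - q s)).
have := ler_normB (r t - q t) (r s - q s).
have : eta * (2 + `|s - t|) = e / 2 * `|s - t| by rewrite /eta mulfVK// gt_eqF.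
lra.
Qed.

Definition is_flow n (V : 'rV[R]_n -> 'rV[R]_n) (Phi : R -> 'rV[R]_n -> 'rV[R]_n) :=
  (forall x, Phi 0 x = x) /\
  forall t x j, has_deriv setT (fun s => Phi s x ord0 j) t (V (Phi t x) ord0 j).

Lemma exp_compare_fwd (w dw : R -> R) B K t : 0 < K -> 0 <= B -> 0 <= t -> w 0 = 0 ->
  (forall s, has_deriv setT w s (dw s)) ->
  (forall s, dw s <= B * expR (K * `|s|)) -> w t <= B / K * expR (K * t).
Proof.
move=> K0 B0 t0 w0 Hw Hd.
have := @gronwall_fwd R 0 t (fun s => w s - B / K * expR (K * s))
  (fun s => dw s - B / K * (K * expR (K * s))) 0 t0.
rewrite !mul0r expR0 mulr1 mulr0 expR0 mulr1 w0 => H.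
have : 0 <= B / K by rewrite divr_ge0// ltW.
suff : w t - B / K * expR (K * t) <= 0 - B / K by lra.
apply: H => s /andP[s0 _].
  apply: has_derivB; first exact: (has_derivW (@subsetT _ _)).
  by apply: has_derivZ; apply: has_deriv_expZ.
rewrite mul0r mulrA divfK ?gt_eqF// subr_le0.
by have := Hd s; rewrite ger0_norm.
Qed.

Lemma has_deriv_reflect (w : R -> R) l t : has_deriv setT w (- t) l ->
  has_deriv setT (fun s => w (- s)) t (- l).
Proof.
move=> H; rewrite -mulrN1.
apply: (@has_deriv_comp R setT setT w (fun s => - s) t (-1) _ 1 ltr01) => //.
have := has_derivB (@has_deriv_cst R setT 0 t) (@has_deriv_id R setT t).
by rewrite sub0r; apply: (has_deriv_near ltr01) => [s Is _|]; rewrite sub0r.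
Qed.

(** Comparison with [B / K * expR (K * t)], whose derivative is the bound
    supposed for the derivative of [w]. *)
Lemma exp_compare (w dw : R -> R) B K t : 0 < K -> 0 <= B -> w 0 = 0 ->
  (forall s, has_deriv setT w s (dw s)) ->
  (forall s, `|dw s| <= B * expR (K * `|s|)) -> `|w t| <= B / K * expR (K * `|t|).
Proof.
move=> K0 B0.
have pos (w' dw' : R -> R) t' : 0 <= t' -> w' 0 = 0 ->
    (forall s, has_deriv setT w' s (dw' s)) ->
    (forall s, `|dw' s| <= B * expR (K * `|s|)) -> `|w' t'| <= B / K * expR (K * t').
  move=> t0 w0 Hw Hd; rewrite ler_norml; apply/andP; split; last first.
    by apply: (exp_compare_fwd (dw := dw')) => // s; apply: le_trans (Hd s); exact: ler_norm.
  rewrite lerNl; apply: (@exp_compare_fwd (fun s => - w' s) (fun s => - dw' s)) => //.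
  - by rewrite w0 oppr0.
  - move=> s; have := has_derivZ (-1) (Hw s); rewrite mulN1r.
    by apply: (has_deriv_near ltr01) => [u Iu _|]; rewrite mulN1r.
  - by move=> s; apply: le_trans (Hd s); rewrite -normrN; exact: ler_norm.
move=> w0 Hw Hd; have [t0|t0] := leP 0 t.
  by rewrite (ger0_norm t0); apply: pos.
have := pos (fun s => w (- s)) (fun s => - dw (- s)) (- t).
rewrite oppr0 opprK (ltr0_norm t0) oppr_ge0 (ltW t0) => /(_ isT w0); apply.
  by move=> s; apply: has_deriv_reflect.
by move=> s; rewrite normrN -(normrN s).
Qed.

Lemma pow2_small (c e : R) : 0 < e -> exists k, c * (2^-1) ^+ k <= e.
Proof.
move=> e0; have [c0|c0] := leP c 0.
  by exists 0%N; rewrite expr0 mulr1; apply: le_trans c0 (ltW e0).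
have [k Hk] : exists k : nat, c / e <= k%:R.
  by exists (Num.truncn (c / e)).+1; apply/ltW/truncnS_gt.
exists k; rewrite exprVn ler_pdivrMr ?exprn_gt0// mulrC -ler_pdivrMr//.
apply: le_trans Hk _; rewrite -natrX ler_nat; exact: ltnW (ltn_expl _ _).
Qed.

Lemma continuous_eps (T : topologicalType) (f : T -> R) (x : T) :
  (forall e, 0 < e -> \forall z \near x, `|f x - f z| < e) -> {for x, continuous f}.
Proof. by move=> H; apply/cvgrPdist_lt. Qed.

Section Picard.
Variables (n : nat) (V : 'rV[R]_n -> 'rV[R]_n) (L : R).
Hypotheses (L0 : 0 < L) (HL : forall x y, `|V x - V y| <= L * `|x - y|).

Fixpoint picard (x : 'rV[R]_n) (k : nat) : R -> 'rV[R]_n :=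
  if k is k'.+1 then
    fun t => \row_j (x ord0 j + antider (fun s => V (picard x k' s) ord0 j) t)
  else fun=> x.

Lemma V_coord_cont j (x : 'rV[R]_n) : {for x, continuous (fun x => V x ord0 j)}.
Proof.
apply: continuous_eps => e e0; apply/nbhsEP; exists (e / L); first by rewrite divr_gt0.
move=> z; rewrite ltr_pdivlMr// => zx.
have := coord_le_norm (V x - V z) j; rewrite !mxE => H.
apply: le_lt_trans H _; apply: le_lt_trans (HL _ _) _.
by rewrite distrC mulrC.
Qed.

Lemma picard_continuous x k : continuous (picard x k).
Proof.
elim: k => [|k IH] t; first by apply: cst_continuous.
apply: rV_continuous => j.
have [|_ H] := @antiderP (fun s => V (picard x k s) ord0 j).
  move=> s; exact: (continuous_comp (f := picard x k) (g := fun z => V z ord0 j) (IH s) (@V_coord_cont j _)).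
have Hc := has_deriv_continuous (H t).
have -> : (fun y => picard x k.+1 y ord0 j) =
   (fun y => x ord0 j + antider (fun s => V (picard x k s) ord0 j) y).
  by apply/funext => s; rewrite /= mxE.
by apply: continuousD => //; apply: cst_continuous.
Qed.

Lemma Vpicard_continuous x k j : continuous (fun s => V (picard x k s) ord0 j).
Proof.
move=> s; exact: (continuous_comp (f := picard x k) (g := fun z => V z ord0 j)
  (@picard_continuous x k s) (@V_coord_cont j _)).
Qed.

Lemma picard_deriv x k j t :
  has_deriv setT (fun s => picard x k.+1 s ord0 j) t (V (picard x k t) ord0 j).
Proof.
have [_ H] := antiderP (@Vpicard_continuous x k j).
have := has_derivD (@has_deriv_cst R setT (x ord0 j) t) (H t); rewrite add0r.
by apply: (has_deriv_near ltr01) => [s Is _|]; rewrite /= mxE.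
Qed.

Lemma picard0 x k : picard x k 0 = x.
Proof.
case: k => [//|k]; apply/rowP => j; rewrite /= mxE.
by have [-> _] := antiderP (@Vpicard_continuous x k j); rewrite addr0.
Qed.

(** Measured with the weight [expR (2 * L * `|t|)], the Picard operator
    contracts by the factor 1/2 on the whole real line; no restriction to
    short times is needed. *)
Lemma picard_step x k t : `|picard x k.+1 t - picard x k t| <=
  `|V x| / (2 * L) * (2^-1) ^+ k * expR (2 * L * `|t|).
Proof.
have K0 : 0 < 2 * L by rewrite mulr_gt0.
elim: k t => [|k IH] t.
  rewrite expr0 mulr1; apply: norm_le_coord.
    by rewrite mulr_ge0 ?expR_ge0// divr_ge0// ltW.
  move=> j; rewrite coordB.
  apply: (@exp_compare (fun t => picard x 1 t ord0 j - x ord0 j) (fun=> V x ord0 j - 0)) => //.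
  - by rewrite picard0 subrr.
  - by move=> s; apply: has_derivB; [exact: picard_deriv|exact: has_deriv_cst].
  - move=> s; rewrite subr0; apply: le_trans (coord_le_norm _ _) _.
    rewrite ler_peMr//; apply: le_trans (expR_ge1Dx _).
    by rewrite lerDl mulr_ge0// ltW.
set C := _ / _ in IH *.
have C0 : 0 <= C by rewrite divr_ge0// ltW.
have P0 : 0 <= (2^-1 : R) ^+ k by rewrite exprn_ge0.
apply: norm_le_coord.
  apply: mulr_ge0 (expR_ge0 _); apply: mulr_ge0 => //; exact: exprn_ge0.
move=> j; rewrite coordB.
have -> : C * 2^-1 ^+ k.+1 = L * (C * 2^-1 ^+ k) / (2 * L).
  by rewrite exprSr; field; rewrite gt_eqF.
apply: (@exp_compare (fun t => picard x k.+2 t ord0 j - picard x k.+1 t ord0 j)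
   (fun s => V (picard x k.+1 s) ord0 j - V (picard x k s) ord0 j)) => //.
- by apply: mulr_ge0 (ltW L0) _; exact: mulr_ge0.
- by rewrite !picard0 subrr.
- by move=> s; apply: has_derivB; exact: picard_deriv.
- move=> s; rewrite -[L * _ * _]mulrA.
  have := coord_le_norm (V (picard x k.+1 s) - V (picard x k s)) j.
  rewrite coordB => H; apply: le_trans H _.
  by apply: le_trans (HL _ _) _; rewrite ler_wpM2l// ltW.
Qed.

Lemma picard_cauchy x k m t : `|picard x (k + m) t - picard x k t| <=
  `|V x| / L * expR (2 * L * `|t|) * ((2^-1) ^+ k - (2^-1) ^+ (k + m)).
Proof.
elim: m => [|m IH]; first by rewrite addn0 !subrr normr0 mulr0.
rewrite addnS.
have -> : picard x (k + m).+1 t - picard x k t =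
  (picard x (k + m).+1 t - picard x (k + m) t) + (picard x (k + m) t - picard x k t).
  by rewrite subrKA.
apply: le_trans (ler_normD _ _) _; apply: le_trans (lerD (picard_step _ _ _) IH) _.
rewrite exprSr; set E := expR _; set a := _ ^+ k; set b := _ ^+ (k + m).
rewrite le_eqVlt; apply/orP; left; apply/eqP; field; by rewrite gt_eqF.
Qed.

Lemma picard_limit x t : exists l : 'rV[R]_n, forall k,
  `|l - picard x k t| <= `|V x| / L * expR (2 * L * `|t|) * (2^-1) ^+ k.
Proof.
set C := _ * expR _; have C0 : 0 <= C.
  by rewrite /C !mulr_ge0 ?expR_ge0 ?invr_ge0// ltW.
have P0 k : 0 <= (2^-1 : R) ^+ k by rewrite exprn_ge0.
have main k m : `|picard x (k + m) t - picard x k t| <= C * 2^-1 ^+ k + C * 2^-1 ^+ (k + m).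
  apply: le_trans (picard_cauchy x k m t) _; rewrite -/C -mulrDr ler_wpM2l//.
  by have := P0 (k + m)%N; lra.
have {}main k m : `|picard x k t - picard x m t| <= C * 2^-1 ^+ k + C * 2^-1 ^+ m.
  have [km|mk] := leqP k m.
    by have := main k (m - k)%N; rewrite subnKC// distrC.
  by have := main m (k - m)%N; rewrite subnKC ?(ltnW mk)// => H; rewrite [leRHS]addrC.
have H j : exists l, forall k, `|l - picard x k t ord0 j| <= C * 2^-1 ^+ k.
  apply: nested_limit => [|k m]; first exact: inhabits 0%N.
  apply: le_trans (main k m).
  by have := coord_le_norm (picard x k t - picard x m t) j; rewrite coordB.
have [l Hl] := choice H; exists (\row_j l j) => k; apply: norm_le_coord.
  by rewrite mulr_ge0.
by move=> j; rewrite coordB mxE.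
Qed.

Theorem picard_flow : exists Phi, is_flow V Phi.
Proof.
have [F HF] : {F : R * 'rV[R]_n -> 'rV[R]_n & forall p k,
   `|F p - picard p.2 k p.1| <= `|V p.2| / L * expR (2 * L * `|p.1|) * (2^-1) ^+ k}.
  apply: (@choice _ _ (fun (p : R * 'rV[R]_n) l => forall k,
   `|l - picard p.2 k p.1| <= `|V p.2| / L * expR (2 * L * `|p.1|) * (2^-1) ^+ k)) => p.
  exact: picard_limit.
exists (fun t x => F (t, x)); split.
  move=> x; apply/eqP; rewrite -subr_eq0 -normr_le0; apply/ler_addgt0Pr => e e0.
  have [k Hk] := pow2_small (`|V x| / L * expR (2 * L * `|0 : R|)) e0.
  rewrite add0r; apply: le_trans Hk; have := HF (0, x) k; by rewrite /= picard0.
move=> t x j.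
apply: (@limit_has_deriv _ (fun s => V (F (s, x)) ord0 j) t 1 ltr01) => e e0.
have K0 : 0 < 2 * L by rewrite mulr_gt0.
pose C := `|V x| / L * expR (2 * L * (`|t| + 1)).
have [k Hk] := pow2_small ((L + 1) * C) e0.
exists (fun s => picard x k.+1 s ord0 j), (fun s => V (picard x k s) ord0 j); split.
  exact: Vpicard_continuous.
move=> s st.
have C0 : 0 <= C by rewrite /C !mulr_ge0 ?expR_ge0 ?invr_ge0// ltW.
have P0 : 0 <= (2^-1 : R) ^+ k by rewrite exprn_ge0.
have Es : expR (2 * L * `|s|) <= expR (2 * L * (`|t| + 1)).
  rewrite ler_expR ler_wpM2l ?(ltW K0)//.
  have : `|s| <= `|s - t| + `|t| by rewrite -{1}[s](subrK t) ler_normD.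
  lra.
have HC m : `|F (s, x) - picard x m s| <= C * 2^-1 ^+ m.
  apply: le_trans (HF (s, x) m) _; rewrite /= ler_wpM2r ?exprn_ge0//.
  by rewrite ler_wpM2l// divr_ge0// ltW.
have CP : 0 <= C * 2^-1 ^+ k by rewrite mulr_ge0.
have LP : 0 <= L * (C * 2^-1 ^+ k) by rewrite mulr_ge0// ltW.
split.
- exact: picard_deriv.
- have := coord_le_norm (F (s, x) - picard x k.+1 s) j.
  rewrite coordB distrC => H; apply: le_trans H _.
  apply: le_trans (HC _) _; rewrite exprSr; lra.
- have := coord_le_norm (V (F (s, x)) - V (picard x k s)) j.
  rewrite coordB distrC => H; apply: le_trans H _.
  apply: le_trans (HL _ _) _; apply: le_trans (ler_wpM2l (ltW L0) (HC k)) _.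
  lra.
Qed.

End Picard.
End ODE.

(** * The variational equation *)

Section SmoothDependence.
Variable R : realType.

Lemma itv_sym (T : R) : is_interval [set t : R | `|t| <= T].
Proof.
move=> a b /= Ha Hb c; move: Ha Hb; rewrite !ler_norml.
by move=> /andP[? ?] /andP[? ?] /andP[? ?]; apply/andP; split; lra.
Qed.

Section Flow.
Variable n : nat.
Implicit Types (V : 'rV[R]_n -> 'rV[R]_n) (Phi : R -> 'rV[R]_n -> 'rV[R]_n).

Lemma smooth_map_lipschitz (O : set 'rV[R]_n) m (V : 'rV[R]_n -> 'rV[R]_m) a r :
  open O -> smooth_map_on O V -> (forall x, `|x - a| <= r -> O x) ->
  exists2 L, 0 <= L & forall x y j, `|x - a| <= r -> `|y - a| <= r ->
    `|V y ord0 j - V x ord0 j| <= L * `|y - x|.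
Proof.
move=> oO sV HO.
have [|j|L L0 HL] := @fin_bound R 'I_m (fun j L => forall x y, `|x - a| <= r -> `|y - a| <= r ->
    `|V y ord0 j - V x ord0 j| <= L * `|y - x|).
- by move=> i u v uv H x y xr yr; apply: le_trans (H x y xr yr) _; rewrite ler_wpM2r.
- exact: smooth_lipschitz oO (sV j) HO.
by exists L => // x y j xr yr; apply: HL.
Qed.

Lemma is_flow_reflect V Phi : is_flow V Phi ->
  is_flow (fun x => - V x) (fun t => Phi (- t)).
Proof.
case=> P0 PD; split => [x|t x j]; first by rewrite oppr0.
by rewrite mxE; apply: (@has_deriv_reflect R (fun s => Phi s x ord0 j)).
Qed.

Lemma smooth_map_opp V : smooth_map_on setT V -> smooth_map_on setT (fun x => - V x).
Proof.
move=> sV j; apply: (@eq_smooth_on _ _ _ (fun x => -1 * V x ord0 j)); first exact: openT.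
  by move=> x _; rewrite mxE mulN1r.
by apply: smooth_onM; [exact: openT|exact: smooth_on_cst|exact: sV].
Qed.

Lemma flow_bounded V Phi x T : is_flow V Phi ->
  exists2 M, 0 <= M & forall t, `|t| <= T -> `|Phi t x| <= M.
Proof.
case=> _ PD.
have [t _|M M0 HM] := @compact_fun_bound R _ `[- T, T]%classic (fun t => `|Phi t x|)
  (@segment_compact _ _ _).
- apply: (continuous_comp (f := fun s => Phi s x)).
    by apply: rV_continuous => j; apply: has_deriv_continuous (PD t x j).
  exact: norm_continuous.
- exists M => // t tT; have := HM t; rewrite normr_id; apply.
  by rewrite /= in_itv /= -ler_norml.
Qed.

(** The field is Lipschitz only on bounded sets. As long as the two
    trajectories are at distance at most 1, they stay in a ball on which a
    constant [L] is available; and [r] is so small that the resulting bound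
    keeps the distance below 1. This is the situation of [gronwall_barrier]. *)
Lemma flow_tube_fwd V Phi (x : 'rV[R]_n) (T : R) : smooth_map_on setT V -> is_flow V Phi -> 0 <= T ->
  exists r C, [/\ 0 < r, 0 <= C & forall y t, `|y - x| <= r -> 0 <= t <= T ->
    `|Phi t y - Phi t x| <= C * `|y - x| /\ `|Phi t y - Phi t x| <= 1].
Proof.
move=> sV fl T0; have [M M0 HM] := flow_bounded x T fl.
have [|L L0 HL] := smooth_map_lipschitz (a := 0) (r := M + 1) (@openT _) sV; first by [].
pose K := n%:R * (2 * L + 1); have K0 : 0 <= K by rewrite mulr_ge0 ?addr_ge0 ?mulr_ge0.
pose E := expR (K * T); have E1 : 1 <= E.
  by apply: le_trans (expR_ge1Dx _); rewrite lerDl mulr_ge0.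
have E0 : 0 < E by rewrite expR_gt0.
have n1 : (0 : R) < n%:R + 1 by rewrite ltr_wpDl.
exists ((n%:R + 1)^-1 / E), ((n%:R + 1) * E); split.
- by rewrite divr_gt0// invr_gt0.
- by rewrite mulr_ge0 ?(ltW n1)// ltW.
move=> y t yr tT; case: fl => P0 PD.
pose w s := Phi s y - Phi s x; pose dw s := V (Phi s y) - V (Phi s x).
have Hw s j : has_deriv setT (fun s => w s ord0 j) s (dw s ord0 j).
  rewrite [dw s ord0 j]mxE [X in _ + X]mxE.
  have := has_derivB (PD s y j) (PD s x j).
  by apply: (has_deriv_near ltr01) => [u Iu _|]; rewrite !mxE.
have f0 : sqn (w 0) <= n%:R * `|y - x| ^+ 2 by rewrite /w !P0; exact: sqn_norm.
have sm : n%:R * `|y - x| ^+ 2 * E < 1.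
  have yr2 : `|y - x| ^+ 2 <= ((n%:R + 1)^-1 / E) ^+ 2.
    by rewrite ler_sqr ?nnegrE ?divr_ge0 ?invr_ge0 ?(ltW E0) ?(ltW n1).
  have H : n%:R * `|y - x| ^+ 2 * E <= n%:R * ((n%:R + 1)^-1 / E) ^+ 2 * E.
    by rewrite ler_wpM2r ?(ltW E0)// ler_wpM2l.
  apply: le_lt_trans H _.
  have -> : n%:R * ((n%:R + 1)^-1 / E) ^+ 2 * E = n%:R / ((n%:R + 1) ^+ 2 * E).
    by field; rewrite !gt_eqF.
  rewrite ltr_pdivrMr ?mulr_gt0 ?exprn_gt0// mul1r.
  have : (n%:R : R) < (n%:R + 1) ^+ 2.
    have : (0 : R) <= n%:R by []. by rewrite sqrrD1; have := sqr_ge0 (n%:R : R); lra.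
  move=> H; apply: lt_le_trans H _.
  by rewrite ler_peMr// sqr_ge0.
have bar : sqn (w 0) * expR (K * T) < 1.
  by apply: le_lt_trans sm; rewrite ler_wpM2r ?(ltW E0).
have itvT s : 0 <= s <= T -> `|s| <= T by move=> /andP[s0 sT]; rewrite ger0_norm.
have := @gronwall_barrier R T (fun s => sqn (w s))
  (fun s => \sum_j 2 * w s ord0 j * dw s ord0 j) K 1 T0 K0 (sqn_ge0 _).
move=> H; have {H}Hs : sqn (w t) <= sqn (w 0) * expR (K * t).
  apply: H => //.
  - move=> s sT; apply: has_deriv_sqn => j; exact: (has_derivW (@subsetT _ _)).
  - move=> s sT ws; apply: le_trans (ler_norm _) _.
    have := @sqn_deriv_bound R n (w s) (dw s) L 0 L0.
    rewrite expr0n /= !addr0 -/K; apply => j.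
    have w1 : `|w s| <= 1.
      by rewrite -ler_sqr ?nnegrE// expr1n; apply: le_trans (norm_sqn _) ws.
    have xM := HM s (itvT s sT).
    rewrite [dw s ord0 j]mxE [X in _ + X]mxE; apply: HL; rewrite subr0.
      by apply: le_trans xM _; rewrite lerDl.
    have -> : Phi s y = w s + Phi s x by rewrite /w subrK.
    by apply: le_trans (ler_normD _ _) _; rewrite addrC lerD.
have tE : expR (K * t) <= E.
  by rewrite ler_expR ler_wpM2l//; case/andP: tT.
have wt2 : `|w t| ^+ 2 <= n%:R * `|y - x| ^+ 2 * E.
  apply: le_trans (norm_sqn _) _; apply: le_trans Hs _.
  exact: ler_pM (sqn_ge0 _) (expR_ge0 _) f0 tE.
split; last first.
  rewrite -ler_sqr ?nnegrE// expr1n; apply: le_trans wt2 (ltW sm).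
rewrite -ler_sqr ?nnegrE ?mulr_ge0 ?(ltW n1) ?(ltW E0)//.
apply: le_trans wt2 _; rewrite exprMn mulrAC ler_wpM2r ?sqr_ge0// exprMn.
have : (n%:R : R) <= (n%:R + 1) ^+ 2.
  have : (0 : R) <= n%:R by []. by rewrite sqrrD1; have := sqr_ge0 (n%:R : R); lra.
move=> H; apply: ler_pM => //; first exact: ltW.
by rewrite expr2 ler_peMl// ltW.
Qed.

Lemma flow_tube V Phi (x : 'rV[R]_n) (T : R) : smooth_map_on setT V -> is_flow V Phi -> 0 <= T ->
  exists r C, [/\ 0 < r, 0 <= C & forall y t, `|y - x| <= r -> `|t| <= T ->
    `|Phi t y - Phi t x| <= C * `|y - x| /\ `|Phi t y - Phi t x| <= 1].
Proof.
move=> sV fl T0.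
have [r1 [C1 [r10 C10 H1]]] := flow_tube_fwd x sV fl T0.
have [r2 [C2 [r20 C20 H2]]] := flow_tube_fwd x (smooth_map_opp sV) (is_flow_reflect fl) T0.
exists (Num.min r1 r2), (C1 + C2); split; first by rewrite lt_min r10.
  exact: addr_ge0.
move=> y t; rewrite le_min => /andP[yr1 yr2] tT; rewrite mulrDl.
have [t0|t0] := leP 0 t.
  have tT' : 0 <= t <= T by rewrite t0 -(ger0_norm t0).
  have [A B] := H1 y t yr1 tT'.
  by split => //; apply: le_trans A _; rewrite lerDl mulr_ge0.
have tT' : 0 <= - t <= T by rewrite oppr_ge0 (ltW t0) -(ltr0_norm t0).
have := H2 y (- t) yr2 tT'; rewrite opprK => -[A B].
by split => //; apply: le_trans A _; rewrite lerDr mulr_ge0.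
Qed.

Definition jac V (x v : 'rV[R]_n) : 'rV[R]_n :=
  \row_j \sum_k partial k (fun z => V z ord0 j) x * v ord0 k.

(** By Taylor's formula and [flow_tube], the difference quotients [q_ h]
    satisfy the variational equation up to an error proportional to [h].
    Gronwall's inequality makes them a Cauchy family as [h] tends to 0, and
    [limit_has_deriv] shows that the limit solves the equation. *)
Lemma flow_variation V Phi (x v : 'rV[R]_n) (T : R) : smooth_map_on setT V -> is_flow V Phi -> 0 < T ->
  exists q : R -> 'rV[R]_n,
    (forall t j, `|t| <= T -> has_deriv setT (fun h => Phi t (h *: v + x) ord0 j) 0 (q t ord0 j)) /\
    (forall t j, `|t| < T -> has_deriv setT (fun s => q s ord0 j) t (jac V (Phi t x) (q t) ord0 j)).
Proof.
move=> sV fl T0.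
have [r [C [r0 C0 HC]]] := flow_tube x sV fl (ltW T0).
have [M M0 HM] := flow_bounded x T fl.
have inb y t : `|y - x| <= r -> `|t| <= T -> `|Phi t y - 0| <= M + 1.
  move=> yr tT; have [_ H] := HC y t yr tT.
  rewrite subr0 -[Phi t y](subrK (Phi t x)); apply: le_trans (ler_normD _ _) _.
  by rewrite addrC lerD// HM.
have [|j|Lt Lt0 HLt] := @fin_bound R 'I_n (fun j L => forall x y, `|x - 0| <= M + 1 -> `|y - 0| <= M + 1 ->
    `|V y ord0 j - V x ord0 j - \sum_k partial k (fun z => V z ord0 j) x * (y ord0 k - x ord0 k)|
    <= L * `|y - x| ^+ 2).
- by move=> i a b ab H y z yr zr; apply: le_trans (H y z yr zr) _; rewrite ler_wpM2r// sqr_ge0.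
- exact: (smooth_taylor (@openT _) (sV j)).
have [||B B0 HB] := @fin_bound R ('I_n * 'I_n)%type (fun p B => forall t, `|t| <= T ->
    `|partial p.2 (fun z => V z ord0 p.1) (Phi t x)| <= B).
- by move=> i a b ab H t /H Ht; apply: le_trans ab.
- move=> [j k] /=.
  have [|D D0 HD] := compact_fun_bound (f := partial k (fun z => V z ord0 j)) (cball_compact (a := 0 : 'rV[R]_n) (r := M + 1)).
    by move=> y _; apply: smooth_on_cont (smooth_on_partial k (sV j)) _.
  by exists D => // t tT; apply: HD; apply: inb => //; rewrite subrr normr0 ltW.
pose dV j t (u : 'rV[R]_n) := \sum_k partial k (fun z => V z ord0 j) (Phi t x) * u ord0 k.
have dV_bound j t u : `|t| <= T -> `|dV j t u| <= n%:R * B * `|u|.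
  move=> tT; apply: le_trans (ler_norm_sum _ _ _) _.
  rewrite -mulrA mulr_natl -[X in _ *+ X](card_ord n) -sumr_const; apply: ler_sum => k _.
  rewrite normrM; apply: ler_pM => //; [exact: (HB (j, k))|exact: coord_le_norm].
have dV_lin j t u w : dV j t u - dV j t w = dV j t (u - w).
  by rewrite /dV -sumrB; apply: eq_bigr => k _; rewrite [(u - w) _ _]mxE [X in _ * (_ + X)]mxE mulrBr.
pose q_ h t := h^-1 *: (Phi t (h *: v + x) - Phi t x).
pose dq_ h t := h^-1 *: (V (Phi t (h *: v + x)) - V (Phi t x)).
(* the increments for which the Taylor and tube estimates are available *)
pose small (h : R) := h != 0 /\ `|h| * `|v| <= r.
have hr h : small h -> `|h *: v + x - x| <= r by case=> _; rewrite addrK normrZ.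
have Hq h t j : has_deriv setT (fun s => q_ h s ord0 j) t (dq_ h t ord0 j).
  rewrite [dq_ _ _ _ _]mxE [X in _ * X]mxE [X in _ * (_ + X)]mxE; case: fl => _ PD.
  have := has_derivZ h^-1 (has_derivB (PD t (h *: v + x) j) (PD t x j)).
  by apply: (has_deriv_near ltr01) => [s Is _|]; rewrite /q_ !mxE.
pose C1 := Lt * C ^+ 2 * `|v| ^+ 2.
have C10 : 0 <= C1 by rewrite /C1 !mulr_ge0 ?sqr_ge0.
have Hdq h t j : small h -> `|t| <= T -> `|dq_ h t ord0 j - dV j t (q_ h t)| <= C1 * `|h|.
  move=> /[dup] sh [h0 _] tT; have hh : 0 < `|h| by rewrite normr_gt0.
  have [HC1 _] := HC _ t (hr h sh) tT.
  have xx : `|x - x| <= r by rewrite subrr normr0 ltW.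
  have := HLt j _ _ (inb x t xx tT) (inb _ t (hr h sh) tT).
  have -> : dq_ h t ord0 j - dV j t (q_ h t) = h^-1 * (V (Phi t (h *: v + x)) ord0 j -
     V (Phi t x) ord0 j - \sum_k partial k (fun z => V z ord0 j) (Phi t x) *
       (Phi t (h *: v + x) ord0 k - Phi t x ord0 k)).
    rewrite /dq_ [X in X - _]mxE [X in _ * X - _]mxE [X in _ * (_ + X) - _]mxE.
    rewrite [RHS]mulrBr; congr (_ - _); rewrite mulr_sumr; apply: eq_bigr => k _.
    by rewrite /q_ !mxE mulrCA.
  rewrite normrM normfV => H.
  rewrite ler_pdivrMl//; apply: le_trans H _.
  have : `|Phi t (h *: v + x) - Phi t x| ^+ 2 <= (C * (`|h| * `|v|)) ^+ 2.
    rewrite ler_sqr ?nnegrE ?mulr_ge0//; apply: le_trans HC1 _.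
    by rewrite addrK normrZ.
  move=> H; apply: le_trans (ler_wpM2l Lt0 H) _.
  by rewrite /C1 !exprMn le_eqVlt; apply/orP; left; apply/eqP; ring.
pose L := n%:R * B; have L0 : 0 <= L by rewrite mulr_ge0.
pose E := expR (n%:R * (2 * L + 1) * T).
have E1 : 1 <= E.
  apply: le_trans (expR_ge1Dx _); rewrite lerDl mulr_ge0 ?(ltW T0)//.
  by rewrite mulr_ge0 ?addr_ge0 ?mulr_ge0.
pose C2 := C1 * E; have C20 : 0 <= C2 by rewrite mulr_ge0// (le_trans ler01).
have q0 h : h != 0 -> q_ h 0 = v.
  by move=> h0; case: fl => P0 _; rewrite /q_ !P0 addrK scalerA mulVf// scale1r.
have cauchy h k t : small h -> small k -> `|t| <= T ->
    `|q_ h t - q_ k t| <= C2 * `|h| + C2 * `|k|.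
  move=> sh sk tT; pose e := C1 * (`|h| + `|k|).
  have e0 : 0 <= e by rewrite mulr_ge0 ?addr_ge0.
  have J0 : [set t : R | `|t| <= T] 0 by rewrite /= normr0 ltW.
  have := @gronwall_norm R n [set t | `|t| <= T] (fun t => q_ h t - q_ k t)
    (fun t => dq_ h t - dq_ k t) L e 0 t (@itv_sym T) J0 tT L0.
  rewrite subr0 => H.
  have {H} : `|q_ h t - q_ k t| ^+ 2 <=
     (n%:R * `|q_ h 0 - q_ k 0| ^+ 2 + e ^+ 2) * expR (n%:R * (2 * L + 1) * `|t|).
    apply: H => s j Js.
      rewrite [(dq_ h s - _) _ _]mxE [X in has_deriv _ _ _ (_ + X)]mxE.
      have := has_derivB (Hq h s j) (Hq k s j) => /(has_derivW (@subsetT _ [set t | `|t| <= T])).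
      by apply: (has_deriv_near ltr01) => [u Iu _|]; rewrite ?[(q_ h u - q_ k u) _ _]mxE ?[(- q_ k u) _ _]mxE ?[(q_ h s - q_ k s) _ _]mxE ?[(- q_ k s) _ _]mxE.
    rewrite [(dq_ h s - _) _ _]mxE [X in _ + X]mxE.
    have -> : dq_ h s ord0 j - dq_ k s ord0 j =
      (dq_ h s ord0 j - dV j s (q_ h s)) - (dq_ k s ord0 j - dV j s (q_ k s)) +
      dV j s (q_ h s - q_ k s) by rewrite -dV_lin; ring.
    have := dV_bound j s (q_ h s - q_ k s) Js; rewrite -/L.
    have := Hdq h s j sh Js; have := Hdq k s j sk Js.
    set A := dq_ h s ord0 j - _; set D := dq_ k s ord0 j - _; set F := dV _ _ _.
    have := ler_normD (A - D) F; have := ler_normB A D.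
    rewrite /e mulrDr; lra.
  have [h0 _] := sh; have [k0 _] := sk.
  rewrite !q0// subrr normr0 expr0n /= mulr0 add0r -/L => H.
  have {H} H : `|q_ h t - q_ k t| ^+ 2 <= (e * E) ^+ 2.
    apply: le_trans H _; rewrite [(e * E) ^+ 2]exprMn ler_wpM2l ?sqr_ge0//.
    apply: (@le_trans _ _ E).
      by rewrite ler_expR ler_wpM2l// mulr_ge0 ?addr_ge0 ?mulr_ge0.
    by rewrite expr2 ler_peMl// (le_trans ler01).
  rewrite -mulrDr; have -> : C2 * (`|h| + `|k|) = e * E by rewrite /C2 /e; ring.
  by rewrite -ler_sqr ?nnegrE// mulr_ge0// (le_trans ler01).
have [h0 h00 hs] : exists2 h0, 0 < h0 & forall h, h != 0 -> `|h| <= h0 -> small h.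
  have v1 : 0 < `|v| + 1 by rewrite ltr_wpDl.
  exists (r / (`|v| + 1)); first by rewrite divr_gt0.
  move=> h h1 hh; split => //.
  apply: (@le_trans _ _ (r / (`|v| + 1) * (`|v| + 1))); last by rewrite divfK// gt_eqF.
  by apply: ler_pM => //; rewrite lerDl.
have lim t j : exists l, `|t| <= T -> forall h, small h -> `|l - q_ h t ord0 j| <= C2 * `|h|.
  have [tT|] := boolP (`|t| <= T); last by exists 0.
  have [||l Hl] := @nested_limit R {h : R | small h} (fun h => q_ (sval h) t ord0 j) (fun h => C2 * `|sval h|).
  - by exists; exists h0; apply: hs; rewrite ?gt_eqF// gtr0_norm.
  - move=> [h sh] [k sk] /=; apply: le_trans (cauchy h k t sh sk tT).
    by have := coord_le_norm (q_ h t - q_ k t) j; rewrite coordB.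
  by exists l => _ h sh; have := Hl (exist _ h sh).
have [f Hf] : {f : R -> 'I_n -> R & forall t j, `|t| <= T -> forall h, small h -> `|f t j - q_ h t ord0 j| <= C2 * `|h|}.
  have [f Hf] := choice (fun p : R * 'I_n => lim p.1 p.2).
  by exists (fun t j => f (t, j)) => t j; exact: (Hf (t, j)).
exists (fun t => \row_j f t j).
have Hf' t h : `|t| <= T -> small h -> `|\row_j f t j - q_ h t| <= C2 * `|h|.
  move=> tT sh; apply: norm_le_coord; first by rewrite mulr_ge0.
  by move=> j; rewrite coordB mxE; apply: Hf.
split.
- move=> t j tT e e0; exists (Num.min h0 (e / (C2 + 1))).
    by rewrite lt_min h00 divr_gt0// ltr_wpDl.
  move=> h _; rewrite subr0 lt_min => /andP[hh0 he]; rewrite scale0r add0r mxE.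
  have [->|h1] := eqVneq h 0; first by rewrite scale0r add0r subrr mulr0 subrr normr0 mulr0.
  have := Hf t j tT h (hs h h1 (ltW hh0)) => H.
  have -> : Phi t (h *: v + x) ord0 j - Phi t x ord0 j - f t j * h =
     - (f t j - q_ h t ord0 j) * h.
    by rewrite /q_ !mxE; field.
  rewrite normrM normrN ler_wpM2r//; apply: le_trans H _.
  move: he; rewrite ltr_pdivlMr ?ltr_wpDl// => he.
  by have := normr_ge0 h; lra.
- move=> t j tT; have d0 : 0 < T - `|t| by rewrite subr_gt0.
  have near s : `|s - t| < T - `|t| -> `|s| <= T.
    move=> st; have : `|s| <= `|s - t| + `|t| by rewrite -{1}[s](subrK t) ler_normD.
    lra.
  have E0 s j' : jac V (Phi s x) (\row_k f s k) ord0 j' = dV j' s (\row_k f s k).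
    by rewrite mxE.
  rewrite E0.
  have -> : (fun s => (\row_j0 f s j0) ord0 j) = (fun s => f s j) by apply/funext => s; rewrite mxE.
  apply: (@limit_has_deriv _ _ (fun s => dV j s (\row_k f s k)) t (T - `|t|) d0) => e e0.
  pose h := Num.min h0 (e / (C1 + C2 + L * C2 + 1)).
  have P0 : 0 < C1 + C2 + L * C2 + 1 by rewrite ltr_wpDl// !addr_ge0// mulr_ge0.
  have hp : 0 < h by rewrite lt_min h00 divr_gt0.
  have sh : small h by apply: hs; rewrite ?gt_eqF// gtr0_norm// ge_min lexx.
  have he : h * (C1 + C2 + L * C2 + 1) <= e by rewrite -ler_pdivlMr// ge_min lexx orbT.
  exists (fun s => q_ h s ord0 j), (fun s => dq_ h s ord0 j); split.
    have cV y : {for t, continuous (fun s => V (Phi s y) ord0 j)}.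
      apply: (continuous_comp (f := fun s => Phi s y) (g := fun z => V z ord0 j)).
        by apply: rV_continuous => k; case: fl => _ PD; apply: has_deriv_continuous (PD t y k).
      exact: smooth_on_cont (sV j) _.
    have -> : (fun s => dq_ h s ord0 j) = (fun s => h^-1 * (V (Phi s (h *: v + x)) ord0 j - V (Phi s x) ord0 j)).
      by apply/funext => s; rewrite /dq_ !mxE.
    apply: continuousM; first by apply: cst_continuous.
    by apply: continuousB; apply: cV.
  move=> s /near sT; split; first exact: Hq.
    rewrite distrC; apply: le_trans (Hf s j sT h sh) _; rewrite gtr0_norm//.
    have : 0 <= h * C1 by apply: mulr_ge0 (ltW hp) _.
    have : 0 <= h * (L * C2) by apply: mulr_ge0 (ltW hp) _; exact: mulr_ge0.
    by move: he; rewrite !mulrDr; lra.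
  have -> : dq_ h s ord0 j - dV j s (\row_k f s k) =
     (dq_ h s ord0 j - dV j s (q_ h s)) - dV j s (\row_k f s k - q_ h s).
    by rewrite -dV_lin; ring.
  apply: le_trans (ler_normB _ _) _.
  have := Hdq h s j sh sT; have := dV_bound j s (\row_k f s k - q_ h s) sT; rewrite -/L.
  have := ler_wpM2l L0 (Hf' s h sT sh).
  rewrite gtr0_norm//.
  have : 0 <= h * C2 by apply: mulr_ge0 (ltW hp) _.
  by move: he; rewrite !mulrDr; lra.
Qed.

End Flow.
End SmoothDependence.

(** * Flows of smooth fields are smooth *)

Section TangentLift.
Variable R : realType.

Section Lift.
Variables (n : nat) (V : 'rV[R]_n -> 'rV[R]_n) (Phi : R -> 'rV[R]_n -> 'rV[R]_n).

Definition dflow t (x v : 'rV[R]_n) : 'rV[R]_n :=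
  \row_j ('D_v (fun y : 'rV[R]_n => Phi t y ord0 j) x : R).

(** The tangent lift of [V], in the coordinates (point, vector). *)
Definition tlift (z : 'rV[R]_(n + n)) : 'rV[R]_(n + n) :=
  row_mx (V (lsubmx z)) (jac V (lsubmx z) (rsubmx z)).

Definition tflow t (z : 'rV[R]_(n + n)) : 'rV[R]_(n + n) :=
  row_mx (Phi t (lsubmx z)) (dflow t (lsubmx z) (rsubmx z)).

Hypotheses (sV : smooth_map_on setT V) (fl : is_flow V Phi).

Lemma dflow_unique t (x v l : 'rV[R]_n) : (forall j, has_deriv setT (fun h => Phi t (h *: v + x) ord0 j) 0 (l ord0 j)) ->
  dflow t x v = l.
Proof.
move=> H; apply/rowP => j; rewrite mxE.
by have /(is_derive_hasE (fun y => Phi t y ord0 j)) [] := H j.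
Qed.

Lemma dflowP t x v j :
  has_deriv setT (fun h => Phi t (h *: v + x) ord0 j) 0 (dflow t x v ord0 j).
Proof.
have T0 : 0 < `|t| + 1 by rewrite ltr_wpDl.
have [q [H _]] := flow_variation x v sV fl T0.
have tt : `|t| <= `|t| + 1 by rewrite lerDl.
by rewrite (@dflow_unique _ _ _ (q t)) => [|k]; apply: H.
Qed.

Lemma dflow_ode t x v j : has_deriv setT (fun s => dflow s x v ord0 j) t
  (jac V (Phi t x) (dflow t x v) ord0 j).
Proof.
have T0 : 0 < `|t| + 1 by rewrite ltr_wpDl.
have [q [H1 H2]] := flow_variation x v sV fl T0.
have tt : `|t| < `|t| + 1 by rewrite ltrDl.
have E s : `|s| <= `|t| + 1 -> dflow s x v = q s.
  by move=> sT; apply: dflow_unique => k; apply: H1.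
rewrite (E t (ltW tt)); apply: (has_deriv_near ltr01 _ _ (H2 t j tt)).
  move=> s _ st; split => //; rewrite E//.
  have : `|s| <= `|s - t| + `|t| by rewrite -{1}[s](subrK t) ler_normD.
  lra.
by rewrite E// ltW.
Qed.

Lemma dflow0 x v : dflow 0 x v = v.
Proof.
apply: dflow_unique => j; case: fl => P0 _.
have := has_derivD (has_derivZ (v ord0 j) (@has_deriv_id R setT 0)) (@has_deriv_cst R setT (x ord0 j) 0).
rewrite mulr1 addr0.
by apply: (has_deriv_near ltr01) => [s Is _|]; rewrite !P0 !mxE mulrC.
Qed.

(** The variational equation says that the derivative of a flow is a component
    of another flow, of a field which is as smooth as [V]. *)
Lemma tflow_flow : is_flow tlift tflow.
Proof.
split=> [z|t z j]; first by rewrite /tflow dflow0 fl.1 hsubmxK.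
case: (split_ordP j) => k -> {j}.
  rewrite /tlift /tflow row_mxEl row_mxKl; have := fl.2 t (lsubmx z) k.
  by apply: (has_deriv_near ltr01) => [s Is _|]; rewrite row_mxEl.
rewrite /tlift /tflow row_mxEr row_mxKl row_mxKr; have := dflow_ode t (lsubmx z) (rsubmx z) k.
by apply: (has_deriv_near ltr01) => [s Is _|]; rewrite row_mxEr.
Qed.

Lemma tlift_smooth : smooth_map_on setT tlift.
Proof.
have oT m : open [set: 'rV[R]_m] by exact: openT.
have sl : smooth_map_on setT (fun z : 'rV[R]_(n + n) => lsubmx z).
  move=> j; apply: (@eq_smooth_on _ _ _ (fun z => z ord0 (lshift n j))) => //.
    by move=> z _; rewrite mxE.
  exact: smooth_on_coord.
have sr : smooth_map_on setT (fun z : 'rV[R]_(n + n) => rsubmx z).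
  move=> j; apply: (@eq_smooth_on _ _ _ (fun z => z ord0 (rshift n j))) => //.
    by move=> z _; rewrite mxE.
  exact: smooth_on_coord.
move=> j; case: (split_ordP j) => k -> {j}.
  apply: (@eq_smooth_on _ _ _ (fun z => V (lsubmx z) ord0 k)) => //.
    by move=> z _; rewrite row_mxEl.
  exact: (smooth_on_comp (O' := setT) (oT _) (oT _) _ sl (sV k)).
apply: (@eq_smooth_on _ _ _ (fun z => \sum_i partial i (fun z => V z ord0 k) (lsubmx z) * rsubmx z ord0 i)) => //.
  by move=> z _; rewrite row_mxEr mxE.
apply: smooth_on_sum => // i; apply: smooth_onM => //.
exact: (smooth_on_comp (O' := setT) (oT _) (oT _) _ sl (smooth_on_partial i (sV k))).
Qed.

Lemma flow_continuous t x : {for x, continuous (Phi t)}.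
Proof.
apply: rV_continuous => j; apply: continuous_eps => e e0.
have [r [C [r0 C0 H]]] := flow_tube x sV fl (normr_ge0 t).
apply/nbhsEP; exists (Num.min r (e / (C + 1))).
  by rewrite lt_min r0 divr_gt0// ltr_wpDl.
move=> y; rewrite lt_min => /andP[yr ye].
have [HC _] := H y t (ltW yr) (lexx _).
have := coord_le_norm (Phi t y - Phi t x) j; rewrite coordB distrC => HH.
apply: le_lt_trans HH _; apply: le_lt_trans HC _.
move: ye; rewrite ltr_pdivlMr ?ltr_wpDl// => ye.
by have := normr_ge0 (y - x); lra.
Qed.

End Lift.

Section SliceDeriv.
Variables (n m : nat) (c : 'rV[R]_m).

Lemma slice_line (h : R) (x : 'rV[R]_n) i :
  row_mx (h *: 'e_i + x) c = h *: 'e_(lshift m i) + row_mx x c.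
Proof.
apply/rowP => j; case: (split_ordP j) => k ->; rewrite [RHS]mxE.
  by rewrite !row_mxEl !mxE (inj_eq (@lshift_inj _ _)).
by rewrite !row_mxEr !mxE eq_rlshift eqxx /= mulr0 add0r.
Qed.

Lemma slice_derivable (G : 'rV[R]_(n + m) -> R) (x : 'rV[R]_n) i :
  derivable G (row_mx x c) 'e_(lshift m i) ->
  derivable (fun x => G (row_mx x c)) x 'e_i.
Proof.
rewrite /derivable; suff -> : (fun h : R =>
    h^-1 *: ((G \o shift (row_mx x c)) (h *: 'e_(lshift m i)) - G (row_mx x c))) =
    (fun h => h^-1 *: (((fun x => G (row_mx x c)) \o shift x) (h *: 'e_i) - G (row_mx x c))) by [].
by apply/funext => h /=; rewrite slice_line.
Qed.

(** Differentiating in the first group of variables commutes with freezing the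
    second group at [c]. *)
Lemma slice_pderivs (G : 'rV[R]_(n + m) -> R) (s : seq 'I_n) :
  pderivs s (fun x => G (row_mx x c)) =
  (fun x => pderivs (map (@lshift n m) s) G (row_mx x c)).
Proof.
elim: s => [//|i s IH]; rewrite /= IH; apply/funext => x.
rewrite /derive; congr (lim (_ @ 0^')); apply/funext => h /=.
by rewrite slice_line.
Qed.

Lemma slice_continuous (G : 'rV[R]_(n + m) -> R) (x : 'rV[R]_n) :
  {for row_mx x c, continuous G} -> {for x, continuous (fun x => G (row_mx x c))}.
Proof.
move=> cG; apply: continuous_comp => //.
apply: rV_continuous => j; case: (split_ordP j) => k ->.
  have -> : (fun y : 'rV[R]_n => row_mx y c ord0 (lshift m k)) = (fun y => y ord0 k).
    by apply/funext => y; rewrite row_mxEl.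
  exact: coord_continuous.
have -> : (fun y : 'rV[R]_n => row_mx y c ord0 (rshift n k)) = (fun=> c ord0 k).
  by apply/funext => y; rewrite row_mxEr.
by apply: cst_continuous.
Qed.

End SliceDeriv.

(** A partial derivative of [Phi t] is a component of the tangent flow, with
    the vector frozen at a basis vector; the induction hypothesis is applied
    to the tangent lift, and therefore has to be about all fields and all
    dimensions. *)
Theorem flow_smooth n (V : 'rV[R]_n -> 'rV[R]_n) Phi : smooth_map_on setT V ->
  is_flow V Phi -> forall t, smooth_map_on setT (Phi t).
Proof.
move=> sV fl t j s x _; move: {2}(size s) (erefl (size s)) => k Hk.
elim: k n V Phi sV fl j s x Hk => [|k IH] n V Phi sV fl j s x.
  move=> /size0nil ->; split.
    apply: (continuous_comp (f := Phi t) (g := fun z => z ord0 j)).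
      exact: (flow_continuous sV fl).
    exact: coord_continuous.
  move=> i; have := dflowP sV fl t x 'e_i j.
  by move=> /(is_derive_hasE (fun y => Phi t y ord0 j)) [].
case/lastP: s => [//|s i]; rewrite size_rcons => -[Hs].
rewrite /pderivs foldr_rcons.
have -> : (fun x : 'rV[R]_n => 'D_('e_i) (fun x => Phi t x ord0 j) x : R) =
    (fun x : 'rV[R]_n => tflow Phi t (row_mx x 'e_i) ord0 (rshift n j)).
  by apply/funext => y; rewrite /tflow row_mxEr row_mxKl row_mxKr mxE.
rewrite -/(pderivs _ _) (slice_pderivs 'e_i (fun z => tflow Phi t z ord0 (rshift n j))).
have [] := IH _ _ _ (tlift_smooth sV) (tflow_flow sV fl) (rshift n j)
  (map (@lshift n n) s) (row_mx x 'e_i).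
  by rewrite size_map.
move=> H1 H2; split; first exact: slice_continuous.
by move=> a; apply: slice_derivable; apply: H2.
Qed.

Lemma ode_unique n (V : 'rV[R]_n -> 'rV[R]_n) (I : set R) (u v : R -> 'rV[R]_n) s s' L :
  is_interval I -> I s -> I s' -> 0 <= L ->
  (forall t j, I t -> has_deriv I (fun s => u s ord0 j) t (V (u t) ord0 j)) ->
  (forall t j, I t -> has_deriv I (fun s => v s ord0 j) t (V (v t) ord0 j)) ->
  (forall t j, I t -> `|V (u t) ord0 j - V (v t) ord0 j| <= L * `|u t - v t|) ->
  u s = v s -> u s' = v s'.
Proof.
move=> iI Is Is' L0 Hu Hv HL Es; apply/eqP; rewrite -subr_eq0; apply/eqP.
apply: (@gronwall_zero R n I (fun t => u t - v t) (fun t => V (u t) - V (v t)) L s s') => //.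
- move=> t j It; rewrite coordB.
  have := has_derivB (Hu t j It) (Hv t j It).
  by apply: (has_deriv_near ltr01) => [z Iz _|]; rewrite !mxE.
- by move=> t j It; rewrite coordB; apply: HL.
- by rewrite Es subrr.
Qed.

(** A smooth field which vanishes outside a ball is bounded and Lipschitz on
    the whole space. *)
Lemma compact_field_flow n (V : 'rV[R]_n -> 'rV[R]_n) a r : smooth_map_on setT V ->
  (forall x, r <= `|x - a| -> V x = 0) ->
  exists Phi : R -> 'rV[R]_n -> 'rV[R]_n,
  exists2 M, 0 <= M &
  [/\ is_flow V Phi, forall t, smooth_map_on setT (Phi t),
      forall s t x, Phi (s + t) x = Phi s (Phi t x) &
      (forall t x, `|Phi t x - x| <= M * `|t|) /\
      exists2 L, 0 <= L & forall x y j, `|V x ord0 j - V y ord0 j| <= L * `|x - y|].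
Proof.
move=> sV V0.
have [|L0 L00 HL0] := smooth_map_lipschitz (a := a) (r := `|r| + 1) (@openT _) sV; first by [].
have [|j|B B0 HB] := @fin_bound R 'I_n (fun j B => forall x, `|x - a| <= `|r| + 1 -> `|V x ord0 j| <= B).
- by move=> i b c bc H x /H Hx; apply: le_trans bc.
- apply: compact_fun_bound (cball_compact (a := a) (r := `|r| + 1)) _ => x _.
  exact: smooth_on_cont (sV j) _.
have {}HB x j : `|V x ord0 j| <= B.
  have [xr|xr] := leP `|x - a| (`|r| + 1); first exact: HB.
  rewrite V0 ?mxE ?normr0//; have := ler_norm r; lra.
(* if only one of the points is in the larger ball, either the field vanishes
   at both or their distance is at least 1 *)
have half x y j : `|x - a| <= `|r| + 1 -> `|V x ord0 j - V y ord0 j| <= (L0 + B) * `|x - y|.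
  move=> xr; have [yr|yr] := leP `|y - a| (`|r| + 1).
    by apply: le_trans (HL0 _ _ _ yr xr) _; rewrite mulrDl lerDl mulr_ge0.
  have rr := ler_norm r.
  rewrite [V y]V0; last by lra.
  rewrite [X in _ - X]mxE subr0; have [xr'|xr'] := leP r `|x - a|.
    by rewrite V0// mxE normr0 mulr_ge0// addr_ge0.
  have : `|y - a| <= `|x - y| + `|x - a|.
    have -> : y - a = (y - x) + (x - a) by rewrite subrKA.
    by rewrite [`|x - y|]distrC ler_normD.
  move=> H; have xy : 1 <= `|x - y| by lra.
  apply: le_trans (HB x j) _; rewrite -[leLHS]mulr1.
  by apply: ler_pM => //; rewrite lerDr.
have HL x y j : `|V x ord0 j - V y ord0 j| <= (L0 + B) * `|x - y|.
  have [xr|xr] := leP `|x - a| (`|r| + 1); first exact: half.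
  have [yr|yr] := leP `|y - a| (`|r| + 1); first by rewrite distrC [`|x - y|]distrC; exact: half.
  have rr := ler_norm r.
  rewrite ![V _]V0; [|lra|lra].
  by rewrite subrr normr0 mulr_ge0// addr_ge0.
have LB : 0 <= L0 + B by rewrite addr_ge0.
have L1 : 0 < L0 + B + 1 by rewrite ltr_wpDl.
have [|Phi fl] := @picard_flow R n V (L0 + B + 1) L1.
  move=> x y; apply: norm_le_coord; first by rewrite mulr_ge0// ltW.
  move=> j; rewrite coordB; apply: le_trans (HL x y j) _.
  by rewrite ler_wpM2r// lerDl.
have iT : is_interval [set: R] by [].
exists Phi, B => //; split => //.
- exact: flow_smooth fl.
- move=> s t x.
  have := @ode_unique n V setT (fun s => Phi (s + t) x) (fun s => Phi s (Phi t x)) 0 s (L0 + B).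
  apply => //.
  + move=> u j _; have Hs : has_deriv setT (fun s => s + t) u 1.
      by have := has_derivD (@has_deriv_id R setT u) (@has_deriv_cst R setT t u); rewrite addr0.
    have := has_deriv_comp (d := 1) (I := setT) ltr01 (fun _ _ _ => I) Hs (fl.2 (u + t) x j).
    by rewrite mulr1.
  + by move=> u j _; apply: fl.2.
  + by rewrite add0r fl.1.
split; last by exists (L0 + B).
move=> t x; apply: norm_le_coord; first by rewrite mulr_ge0.
move=> j; have := @mean_value_bound R setT 0 t (fun s => Phi s x ord0 j) (fun s => V (Phi s x) ord0 j) B iT.
rewrite fl.1 subr0 !mxE; apply => // u _; exact: fl.2.
Qed.

End TangentLift.

(** * Paracompact Hausdorff spaces are regular; relative homeomorphisms *)

Section Regular.
Variable T : topologicalType.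

Lemma near_finite (J : Type) (A : set J) (P : J -> T -> Prop) (x : T) :
  finite_set A -> (forall j, A j -> \forall z \near x, P j z) ->
  \forall z \near x, forall j, A j -> P j z.
Proof.
move=> /(@finite_seqP {classic J})[s ->] H.
elim: s H => [|j s IH] H; first by apply: filterE => z j; rewrite /= in_nil.
have Hj : \forall z \near x, P j z by apply: H; rewrite /= mem_head.
have {}IH : \forall z \near x, forall j, [set` s] j -> P j z.
  by apply: IH => k ks; apply: H; rewrite /= in_cons ks orbT.
apply: filterS (filterI Hj IH) => z [Pj Ps] k /=.
by rewrite in_cons => /predU1P[->//|]; apply: Ps.
Qed.

(** Refine to a locally finite cover the cover by [A] and by open sets which
    keep away from [x]. The refined sets that keep away from [x] cover the
    complement of [A]; their union [D] is open, and by local finiteness some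
    neighbourhood of [x] misses it. *)
Lemma paracompact_regular : paracompact T -> hausdorff_space T ->
  forall (x : T) (A : set T), open A -> A x ->
  exists B, [/\ open B, B x & forall y, ~ A y -> exists2 N, open_nbhs y N &
    forall z, N z -> ~ B z].
Proof.
move=> pT hT x A oA Ax.
pose good (W : set T) := exists2 N, open_nbhs x N & forall z, W z -> ~ N z.
have [F HF] : {F : T -> set T & forall y, [/\ open (F y), ~ A y -> F y y & good (F y)]}.
  apply: (@choice _ _ (fun y W => [/\ open W, ~ A y -> W y & good W])) => y.
  have [Ay|nAy] := pselect (A y).
    by exists set0; split => //; [exact: open0|exists setT => //; split => //; exact: openT].
  have xy : x != y by apply/eqP => xy; apply: nAy; rewrite -xy.
  move: hT; rewrite open_hausdorff => /(_ x y xy) [[U W] /= [xU yW] [oU oW /eqP UW]].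
  exists W; split => //; first by move=> _; rewrite inE in yW.
  exists U; first by split => //; rewrite inE in xU.
  by move=> z Wz Uz; have : (U `&` W) z by []; rewrite UW.
pose G (o : option T) := if o is Some y then F y else A.
have cG : open_cover G.
  split; first by case=> [y|] //=; case: (HF y).
  apply/seteqP; split => // y _; have [Ay|nAy] := pselect (A y); first by exists None.
  by exists (Some y) => //=; case: (HF y) => _ H _; apply: H.
have [J [K [[oK cK] lfK KG]]] := pT _ _ cG.
pose bad j := good (K j).
pose D := \bigcup_(j in [set j | bad j]) K j.
have oD : open D by apply: bigcup_open => j _.
have AD y : ~ A y -> D y.
  move=> nAy; have : cover [set: J] K y by rewrite cK.
  move=> [j _ Kjy]; exists j => //=; have [ix KGo] := KG j.
  case: ix KGo => [z|] KGo /=; last by case: nAy; apply: KGo.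
  have [_ _ [N Nx NF]] := HF z.
  by exists N => // w /KGo; apply: NF.
have [U Ux fU] := lfK x.
have H : \forall z \near x, forall j, [set j | K j `&` U !=set0] j -> bad j -> ~ K j z.
  apply: near_finite fU _ => j _; have [[N Nx NK]|nb] := pselect (bad j).
    by apply: filterS (open_nbhs_nbhs Nx) => z Nz _ Kz; apply: NK Kz Nz.
  exact: filterE.
have : nbhs x (fun z => U z /\ forall j, K j `&` U !=set0 -> bad j -> ~ K j z).
  by apply: filterI => //; exact: open_nbhs_nbhs.
rewrite nbhsE => -[B [oB Bx] BH]; exists B; split => // y /AD Dy.
exists D => // z [j /= bj Kz] /BH[Uz Hz]; apply: (Hz j) => //.
by exists z.
Qed.

End Regular.

Section Homeo.
Variables (T T' : topologicalType) (A : set T) (B : set T') (f : T -> T').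
Hypothesis hf : homeo_on A B f.

Lemma homeo_inj x y : A x -> A y -> f x = f y -> x = y.
Proof. by move=> Ax Ay; case: hf => [[_ H _] _]; apply: H; rewrite inE. Qed.

(** [homeo_cont] and [homeo_open] are the pointwise forms of the two
    directions of [homeo_on], which speaks about relatively open sets. *)
Lemma homeo_cont x (O : set T') : open O -> A x -> O (f x) ->
  exists2 W, open_nbhs x W & forall y, W y -> A y -> O (f y).
Proof.
move=> oO Ax Ofx; case: hf => [[h1 h2 h3] H].
pose V := A `&` f @^-1` O; have VA : V `<=` A by move=> y [].
have [W oW E] : open_in A V.
  apply/(H V VA); exists O => //; apply/seteqP; split => z.
    by move=> [y [Ay Oy] <-]; split => //; apply: h1.
  by move=> [Bz Oz]; have [y Ay fy] := h3 z Bz; exists y => //; split => //; rewrite /preimage /= fy.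
exists W.
  by split => //; have : V x by []; rewrite E => -[].
by move=> y Wy Ay; have [] : V y by rewrite E.
Qed.

Lemma homeo_open x (N : set T) : open N -> A x -> N x ->
  exists2 O, open_nbhs (f x) O & forall y, A y -> O (f y) -> N y.
Proof.
move=> oN Ax Nx; case: hf => [[h1 h2 h3] H].
pose V := A `&` N; have VA : V `<=` A by move=> y [].
have [Q oQ E] : open_in B (f @` V) by apply/(H V VA); exists N.
have fV : forall y, V y -> Q (f y).
  move=> y Vy; have : (f @` V) (f y) by exists y.
  by rewrite E => -[].
exists Q; first by split => //; apply: fV.
move=> y Ay Oy; have : (B `&` Q) (f y) by split => //; apply: h1.
rewrite -E => -[y' [Ay' Ny'] fy]; suff <- : y' = y by [].
by apply: homeo_inj.
Qed.

End Homeo.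

(** * Smooth functions and coordinates on a stratified space *)

Section Pad.
Variable R : realType.

Lemma pad_smooth n N (O : set 'rV[R]_n) : open O -> smooth_map_on O (@pad R n N).
Proof.
move=> oO j; have [Ei|E] := boolP (j < n)%N.
  apply: (@eq_smooth_on _ _ _ (fun v => v ord0 (Ordinal Ei))) => //; last exact: smooth_on_coord.
  by move=> v _; rewrite mxE insubT.
apply: (@eq_smooth_on _ _ _ (fun=> 0)) => //; last exact: smooth_on_cst.
by move=> v _; rewrite mxE insubF// (negbTE E).
Qed.

Definition unpad n N (le : (n <= N)%N) (z : 'rV[R]_N) : 'rV[R]_n :=
  \row_j z ord0 (widen_ord le j).

Lemma padK n N (le : (n <= N)%N) (v : 'rV[R]_n) : unpad le (pad N v) = v.
Proof.
apply/rowP => j; rewrite !mxE (insubT (fun k => k < n)%N (ltn_ord j)) /=.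
by congr (v _ _); apply: val_inj.
Qed.

Lemma unpad_smooth n N (le : (n <= N)%N) (O : set 'rV[R]_N) : open O ->
  smooth_map_on O (unpad le).
Proof.
move=> oO j; apply: (@eq_smooth_on _ _ _ (fun v => v ord0 (widen_ord le j))) => //.
  by move=> v _; rewrite mxE.
exact: smooth_on_coord.
Qed.

(** In the chart [c] the function is [f] composed with [unpad], the
    diffeomorphism between the padded charts and [pad]; this is smooth near
    the image of [x] and [smooth_extend1] makes it smooth everywhere. *)
Lemma compatible_transfer (T : topologicalType) (c d : chart R T) x
    (f : 'rV[R]_(cdim d) -> R) : compatible c d -> cdom c x -> cdom d x ->
  smooth_on setT f ->
  exists g : 'rV[R]_(cdim c) -> R, smooth_on setT g /\
  exists2 W, open_nbhs x W & exists2 r, 0 < r & forall y, W y -> cdom c y -> cdom d y ->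
    `|cmap c y - cmap c x| < r -> f (cmap d y) = g (cmap c y).
Proof.
move=> cd cx dx sf; have [W [N [Q1 [Q2 [H]]]]] := cd x cx dx.
move=> /= [[[oW Wx] leN] [oQ1 oQ2] HO [G [G1 _ sH _]] HE].
have lec : (cdim c <= N)%N by apply: leq_trans leN; rewrite leq_maxl.
have led : (cdim d <= N)%N by apply: leq_trans leN; rewrite leq_maxr.
have sp : smooth_map_on setT (@pad R (cdim c) N) by apply: pad_smooth; exact: openT.
pose O1 := [set v : 'rV[R]_(cdim c) | setT v /\ Q1 (pad N v)].
have oO1 : open O1.
  apply: open_preimage_on => //; first exact: openT.
  by move=> v _; apply: smooth_map_on_cont sp _.
have O1x : O1 (cmap c x) by split => //; have [] := HO x (conj Wx (conj cx dx)).
have sO1 : smooth_on O1 (fun v => f (unpad led (H (pad N v)))).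
  apply: (smooth_on_comp (O' := setT) (h := fun v => unpad led (H (pad N v))) oO1 (@openT _)) => //.
  apply: (smooth_map_on_comp (O' := Q1) (f := fun z => unpad led (H z)) oO1 oQ1) => //.
  - by move=> v [].
  - by move=> j; apply: smooth_onS (sp j).
  - apply: (smooth_map_on_comp (O' := setT) oQ1 (@openT _)) => //.
    by apply: unpad_smooth; exact: openT.
have [g [sg [r r0 Hg]]] := smooth_extend1 oO1 O1x sO1.
exists g; split => //; exists W => //; exists r => // y Wy cy dy yr.
have [_ ->] := Hg _ yr.
by rewrite HE// padK.
Qed.

End Pad.

Lemma near_open (T : topologicalType) (x : T) (P : T -> Prop) :
  (\forall y \near x, P y) -> exists2 W, open_nbhs x W & forall y, W y -> P y.
Proof. by rewrite -nbhs_nearE nbhsE => -[W Wx WP]; exists W. Qed.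

Section Cinf.
Variables (R : realType) (S : strat_space R).
Implicit Types (x y z : S) (c d : chart R S) (A B U W : set S) (f g h : S -> R).

Let At := @smooth_atlas R S.

Lemma at_smooth_chart c : At c -> smooth_chart [set: S] (@stratum R S) (@stratum_atlas R S) c.
Proof. by move=> Ac; have [H _ _ _] := strat_smooth S; apply: H. Qed.

Lemma at_cover x : exists2 c, At c & cdom c x.
Proof. by have [_ H _ _] := strat_smooth S; apply: H. Qed.

Lemma at_compat c d : At c -> At d -> compatible c d.
Proof. by have [_ _ H _] := strat_smooth S; apply: H. Qed.

Lemma cdom_open c : At c -> open (cdom c).
Proof.
by move=> /at_smooth_chart[[W oW E] _ _]; rewrite E setTI.
Qed.

Lemma at_homeo c : At c -> homeo_on (cdom c) (cmap c @` cdom c) (cmap c).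
Proof. by move=> /at_smooth_chart[]. Qed.

Lemma cmap_near c x (P : 'rV[R]_(cdim c) -> Prop) : At c -> cdom c x ->
  (\forall v \near cmap c x, P v) -> \forall y \near x, cdom c y /\ P (cmap c y).
Proof.
move=> Ac cx => /near_open[Q [oQ Qx] QP].
have [W [oW Wx] HW] := homeo_cont (at_homeo Ac) oQ cx Qx.
apply: (filterS _ (filterI (open_nbhs_nbhs (conj (cdom_open Ac) cx)) (open_nbhs_nbhs (conj oW Wx)))).
by move=> y [cy Wy]; split => //; apply: QP; apply: HW.
Qed.

Lemma cmap_basis c x N : At c -> cdom c x -> nbhs x N ->
  exists2 r, 0 < r & forall y, cdom c y -> `|cmap c y - cmap c x| < r -> N y.
Proof.
move=> Ac cx => /near_open[N' [oN N'x] N'N].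
have [Q Qx HQ] := homeo_open (at_homeo Ac) oN cx N'x.
have /nbhsEP[r r0 Hr] := open_nbhs_nbhs Qx.
by exists r => // y cy yr; apply/N'N/HQ => //; apply: Hr.
Qed.

Lemma chart_trans c d x (f : 'rV[R]_(cdim d) -> R) : At c -> At d ->
  cdom c x -> cdom d x -> smooth_on setT f ->
  exists g : 'rV[R]_(cdim c) -> R, smooth_on setT g /\
    \forall y \near x, f (cmap d y) = g (cmap c y).
Proof.
move=> Ac Ad cx dx sf.
have [g [sg [W Wx [r r0 Hg]]]] := compatible_transfer (at_compat Ac Ad) cx dx sf.
exists g; split => //.
have N1 : \forall y \near x, cdom c y /\ `|cmap c y - cmap c x| < r.
  by apply: (cmap_near (P := fun v => `|v - cmap c x| < r) Ac cx); apply/nbhsEP; exists r.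
have N2 := open_nbhs_nbhs (conj (cdom_open Ad) dx).
apply: filterS (filterI (filterI N1 N2) (open_nbhs_nbhs Wx)) => y [[[cy yr] dy] Wy].
exact: Hg.
Qed.

Lemma Cinf_continuous f : Cinf f -> continuous f.
Proof. by case=> H _; apply: (iffRL (continuous_subspace_setT f)). Qed.

Lemma Cinf_chart f x c : Cinf f -> At c -> cdom c x ->
  exists g : 'rV[R]_(cdim c) -> R, smooth_on setT g /\
    \forall y \near x, cdom c y /\ f y = g (cmap c y).
Proof.
move=> [_ H] Ac cx; have [W Wx [g sg Hg]] := H x c I Ac cx.
exists g; split => //.
apply: filterS (filterI (open_nbhs_nbhs (conj (cdom_open Ac) cx)) (open_nbhs_nbhs Wx)).
by move=> y [cy Wy]; split => //; apply: Hg.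
Qed.

(** One chart at every point is enough, because any other one is compatible
    with it. *)
Lemma Cinf_crit f : (forall x, exists c, [/\ At c, cdom c x &
   exists g : 'rV[R]_(cdim c) -> R, smooth_on setT g /\
    \forall y \near x, f y = g (cmap c y)]) -> Cinf f.
Proof.
move=> H; split.
  suff Hc x : {for x, continuous f} by exact: (iffLR (continuous_subspace_setT f) Hc).
  have [c [Ac cx [g [sg Hg]]]] := H x.
  have Ex : f x = g (cmap c x) := nbhs_singleton Hg.
  apply: continuous_eps => e e0.
  have /cvgrPdist_lt/(_ e e0) Hn : {for cmap c x, continuous g} by apply: smooth_on_cont sg _.
  apply: filterS (filterI Hg (cmap_near Ac cx Hn)) => y [Ey [_]].
  by rewrite Ex Ey.
move=> x d _ Ad dx; have [c [Ac cx [g [sg Hg]]]] := H x.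
have [g' [sg' Hg']] := chart_trans Ad Ac dx cx sg.
have [W Wx WH] := near_open (filterI Hg Hg'); exists W => //.
by exists g' => // y /WH [-> ->].
Qed.

Lemma Cinf_near f : (forall x, exists2 h, Cinf h & \forall y \near x, f y = h y) -> Cinf f.
Proof.
move=> H; apply: Cinf_crit => x; have [c Ac cx] := at_cover x; exists c; split => //.
have [h Ch Eh] := H x; have [g [sg Hg]] := Cinf_chart Ch Ac cx.
by exists g; split => //; apply: filterS (filterI Eh Hg) => y [-> []].
Qed.

Lemma Cinf_comp m (q : S -> 'rV[R]_m) (g : 'rV[R]_m -> R) :
  (forall j, Cinf (fun y => q y ord0 j)) -> smooth_on setT g -> Cinf (fun y => g (q y)).
Proof.
move=> Hq sg; apply: Cinf_crit => x; have [c Ac cx] := at_cover x; exists c; split => //.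
have [p Hp] := choice (fun j => Cinf_chart (Hq j) Ac cx).
exists (fun v => g (\row_j p j v)); split.
  apply: (smooth_on_comp (O' := setT) (h := fun v => \row_j p j v) (@openT _) (@openT _)) => //.
  move=> j; apply: (@eq_smooth_on _ _ _ (p j)); first exact: openT.
    by move=> v _; rewrite mxE.
  by case: (Hp j).
have : \forall y \near x, forall j, cdom c y /\ q y ord0 j = p j (cmap c y).
  by apply: filter_forall_ord => j; case: (Hp j).
apply: filterS => y Hy; congr g; apply/rowP => j; rewrite mxE.
by case: (Hy j).
Qed.

Lemma Cinf_cst (a : R) : Cinf (fun _ : S => a).
Proof.
apply: (@Cinf_comp 0 (fun=> 0) (fun=> a)); first by case.
exact: smooth_on_cst.
Qed.

Lemma Cinf_lin (a : R) f g : Cinf f -> Cinf g -> Cinf (fun y => a * f y + g y).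
Proof.
move=> Cf Cg; pose q y : 'rV[R]_2 := \row_j (if j == ord0 then f y else g y).
have E : (fun y => a * f y + g y) =
   (fun y => a * q y ord0 ord0 + q y ord0 ord_max).
  by apply/funext => y; rewrite !mxE.
rewrite E; apply: (Cinf_comp (q := q) (g := fun v => a * v ord0 ord0 + v ord0 ord_max)).
  move=> j; have -> : (fun y => q y ord0 j) = (if j == ord0 then f else g).
    by apply/funext => y; rewrite mxE; case: ifP.
  by case: ifP.
have oT := @openT ('rV[R]_2).
apply: smooth_onD => //; last exact: smooth_on_coord.
by apply: smooth_onM => //; [exact: smooth_on_cst|exact: smooth_on_coord].
Qed.

Lemma CinfM f g : Cinf f -> Cinf g -> Cinf (fun y => f y * g y).
Proof.
move=> Cf Cg; pose q y : 'rV[R]_2 := \row_j (if j == ord0 then f y else g y).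
have E : (fun y => f y * g y) = (fun y => q y ord0 ord0 * q y ord0 ord_max).
  by apply/funext => y; rewrite !mxE.
rewrite E; apply: (Cinf_comp (q := q) (g := fun v => v ord0 ord0 * v ord0 ord_max)).
  move=> j; have -> : (fun y => q y ord0 j) = (if j == ord0 then f else g).
    by apply/funext => y; rewrite mxE; case: ifP.
  by case: ifP.
by apply: smooth_onM; [exact: openT|exact: smooth_on_coord|exact: smooth_on_coord].
Qed.

Lemma S_regular x A : open A -> A x -> exists B, [/\ open B, B x &
  forall y, ~ A y -> exists2 N, open_nbhs y N & forall z, N z -> ~ B z].
Proof.
exact: (paracompact_regular (@strat_paracompact R S) (@strat_hausdorff R S)).
Qed.

(** A bump function in a chart extends by 0 to a continuous function only if
    its support is closed in [S] and not just in the domain of the chart.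
    Regularity of [S] gives a smaller neighbourhood [B] whose closure is
    inside. *)
Lemma bump_exists x A : nbhs x A -> exists chi : S -> R,
  [/\ Cinf chi, forall y, 0 <= chi y <= 1, \forall y \near x, chi y = 1 &
      forall y, ~ A y -> \forall z \near y, chi z = 0].
Proof.
move=> Ax; have [c Ac cx] := at_cover x.
have [A' [oA' A'x] A'A] := near_open (filterI Ax (open_nbhs_nbhs (conj (cdom_open Ac) cx))).
have [B [oB Bx HB]] := S_regular oA' A'x.
have [r r0 Hr] := cmap_basis Ac cx (open_nbhs_nbhs (conj oB Bx)).
have [b [sb b01 [r' r'0 b1] b0]] := bump_rV (cmap c x) r0.
pose chi y := if `[<cdom c y>] then b (cmap c y) else 0.
have chiE y : cdom c y -> chi y = b (cmap c y) by move=> cy; rewrite /chi asboolT.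
have chi0 y : ~ B y -> chi y = 0.
  move=> nB; rewrite /chi; case: ifPn => // /asboolP cy; apply: b0.
  by rewrite leNgt; apply/negP => /(Hr y cy).
have chiA y : ~ A' y -> \forall z \near y, chi z = 0.
  move=> /HB[N Ny HN]; apply: filterS (open_nbhs_nbhs Ny) => z Nz.
  by apply: chi0; apply: HN.
exists chi; split.
- apply: Cinf_crit => y; have [cy|ncy] := pselect (cdom c y).
    exists c; split => //; exists b; split => //.
    by apply: filterS (open_nbhs_nbhs (conj (cdom_open Ac) cy)) => z /chiE.
  have [d Ad dy] := at_cover y; exists d; split => //; exists (fun=> 0); split.
    exact: smooth_on_cst.
  by apply: chiA => /A'A[].
- by move=> y; rewrite /chi; case: ifP => _; [exact: b01|rewrite lexx ler01].
- have : \forall y \near x, cdom c y /\ b (cmap c y) = 1.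
    by apply: (cmap_near (P := fun v => b v = 1) Ac cx); apply/nbhsEP; exists r'.
  by apply: filterS => y [cy <-]; rewrite chiE.
- by move=> y nA; apply: chiA => /A'A[].
Qed.

(** A bump function at [p] detects whether a point has left a given
    neighbourhood of [p]. *)
Lemma continuous_to_S (T : topologicalType) (u : T -> S) (F : set_system T) (FF : Filter F) (p : S) :
  (forall f, Cinf f -> f \o u @ F --> f p) -> u @ F --> p.
Proof.
move=> H A /bump_exists[chi [Cchi _ chi1 chi0]].
have := H chi Cchi; rewrite (nbhs_singleton chi1) => /cvgrPdist_lt/(_ 1 ltr01).
apply: filterS => t /= Ht; apply: contrapT => /chi0/nbhs_singleton E.
by move: Ht; rewrite E subr0 normr1 ltxx.
Qed.

Lemma Cinf_separates x y : (forall f, Cinf f -> f x = f y) -> x = y.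
Proof.
move=> H; apply: contrapT => xy; have xy' : x != y by apply/eqP.
have := @strat_hausdorff R S; rewrite open_hausdorff => /(_ x y xy').
move=> [[U W] /= [xU yW] [oU oW /eqP UW]]; rewrite !inE in xU yW.
have [chi [Cchi _ /nbhs_singleton c1 c0]] := bump_exists (open_nbhs_nbhs (conj oU xU)).
have nU : ~ U y by move=> Uy; have : (U `&` W) y by []; rewrite UW.
have /nbhs_singleton := c0 y nU; rewrite -(H _ Cchi) c1 => /eqP.
by rewrite oner_eq0.
Qed.

Lemma Cinf_on_near U f x : open U -> Cinf_on U f -> U x ->
  exists2 h, Cinf h & \forall y \near x, f y = h y.
Proof.
move=> oU Uf Ux; have [W Wx [h Ch Hh]] := Uf x Ux; exists h => //.
apply: filterS (filterI (open_nbhs_nbhs Wx) (open_nbhs_nbhs (conj oU Ux))) => y [].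
exact: Hh.
Qed.

Lemma near_Cinf_on U f :
  (forall x, U x -> exists2 h, Cinf h & \forall y \near x, U y -> f y = h y) -> Cinf_on U f.
Proof.
move=> H x Ux; have [h Ch /near_open[W Wx WH]] := H x Ux.
by exists W => //; exists h.
Qed.

Lemma Cinf_cutoff A chi f : open A -> Cinf_on A f -> Cinf chi ->
  (forall y, ~ A y -> \forall z \near y, chi z = 0) -> Cinf (fun y => chi y * f y).
Proof.
move=> oA Af Cchi chi0; apply: Cinf_near => x; have [Ax|nA] := pselect (A x).
  have [h Ch Eh] := Cinf_on_near oA Af Ax; exists (fun y => chi y * h y).
    exact: CinfM.
  by apply: filterS Eh => y ->.
exists (fun=> 0); first exact: Cinf_cst.
by apply: filterS (chi0 x nA) => y ->; rewrite mul0r.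
Qed.

Lemma Cinf_cinf_on U f : Cinf f -> Cinf_on U f.
Proof. by move=> Cf; apply: near_Cinf_on => x _; exists f => //; apply: filterE. Qed.

Lemma chart_fun_Cinf_on c (g : 'rV[R]_(cdim c) -> R) : At c -> smooth_on setT g ->
  Cinf_on (cdom c) (fun y => g (cmap c y)).
Proof.
move=> Ac sg; apply: near_Cinf_on => x cx.
have [chi [Cchi _ chi1 chi0]] := bump_exists (open_nbhs_nbhs (conj (cdom_open Ac) cx)).
exists (fun y => chi y * g (cmap c y)); last first.
  by apply: filterS chi1 => y -> _; rewrite mul1r.
apply: Cinf_crit => y; have [cy|ncy] := pselect (cdom c y).
  exists c; split => //; have [b [sb Hb]] := Cinf_chart Cchi Ac cy.
  exists (fun v => b v * g v); split; first by apply: smooth_onM => //; exact: openT.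
  by apply: filterS Hb => z [_ ->].
have [d Ad dy] := at_cover y; exists d; split => //; exists (fun=> 0); split.
  exact: smooth_on_cst.
by apply: filterS (chi0 y ncy) => z ->; rewrite mul0r.
Qed.

(** A replacement for a chart at [z] whose components are smooth functions on
    the whole of [S], to which derivations apply. The set where [q] is at
    distance less than 1 from its value at [z] plays the part of the domain of
    the chart: there [q] is injective and all smooth functions are locally
    smooth functions of [q]. *)
Definition coords z n (q : S -> 'rV[R]_n) := [/\ forall j, Cinf (fun y => q y ord0 j),
  forall y y', `|q y - q z| < 1 -> `|q y' - q z| < 1 -> q y = q y' -> y = y' &
  forall p f, `|q p - q z| < 1 -> Cinf f -> exists g : 'rV[R]_n -> R,
    smooth_on setT g /\ exists2 r, 0 < r & forall y, `|q y - q p| < r -> f y = g (q y)].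

(** The map is [(chi1 * cmap c, chi2)], where [chi1] is 1 on the support of
    [chi2]. The last coordinate is 1 at [z]; at distance less than 1 it is
    nonzero, so that the first group of coordinates is the chart itself. *)
Lemma coords_exist z : exists n (q : S -> 'rV[R]_n), coords z q.
Proof.
have [c Ac cz] := at_cover z.
have [chi1 [C1 _ c11 c10]] := bump_exists (open_nbhs_nbhs (conj (cdom_open Ac) cz)).
have N : nbhs z (fun y => chi1 y = 1 /\ cdom c y).
  exact: (filterI c11 (open_nbhs_nbhs (conj (cdom_open Ac) cz))).
have [chi2 [C2 _ /nbhs_singleton c2z c20]] := bump_exists N.
pose q y : 'rV[R]_(cdim c + 1) := row_mx (chi1 y *: cmap c y) (const_mx (chi2 y)).
have q2 y : q y ord0 (rshift _ ord0) = chi2 y by rewrite row_mxEr mxE.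
have chi2N y : chi2 y != 0 -> chi1 y = 1 /\ cdom c y.
  by move=> H; apply: contrapT => /c20/nbhs_singleton E; rewrite E eqxx in H.
have qE y : chi2 y != 0 -> q y = row_mx (cmap c y) (const_mx (chi2 y)).
  by move=> /chi2N[c1 _]; rewrite /q c1 scale1r.
have diff2 y y' : `|chi2 y - chi2 y'| <= `|q y - q y'|.
  have := coord_le_norm (q y - q y') (rshift _ ord0).
  by rewrite coordB !q2.
have near1 y : `|q y - q z| < 1 -> chi2 y != 0.
  move=> H; apply/eqP => E; have := le_lt_trans (diff2 y z) H.
  by rewrite E c2z sub0r normrN normr1 ltxx.
exists (cdim c + 1)%N, q; split.
- move=> j; case: (split_ordP j) => k ->.
    have -> : (fun y => q y ord0 (lshift 1 k)) = (fun y => chi1 y * cmap c y ord0 k).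
      by apply/funext => y; rewrite row_mxEl mxE.
    apply: Cinf_cutoff (cdom_open Ac) _ C1 c10.
    by apply: (chart_fun_Cinf_on Ac (g := fun v => v ord0 k)); exact: smooth_on_coord.
  have -> : (fun y => q y ord0 (rshift (cdim c) k)) = chi2 => //.
  by apply/funext => y; rewrite row_mxEr mxE.
- move=> y y' /near1 H /near1 H'; rewrite !qE// => /eq_row_mx[E _].
  exact: (homeo_inj (at_homeo Ac) (chi2N y H).2 (chi2N y' H').2 E).
move=> p f /near1 H Cf; have [_ cp] := chi2N _ H.
have [g [sg Hg]] := Cinf_chart Cf Ac cp.
have [r r0 Hr] := cmap_basis Ac cp Hg.
exists (fun v => g (lsubmx v)); split.
  apply: (smooth_on_comp (O' := setT) (h := fun v : 'rV_(cdim c + 1) => lsubmx v) (@openT _) (@openT _)) => //.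
  move=> j; apply: (@eq_smooth_on _ _ _ (fun v => v ord0 (lshift _ j))); first exact: openT.
    by move=> v _; rewrite mxE.
  exact: smooth_on_coord.
exists (Num.min r `|chi2 p|); first by rewrite lt_min r0 normr_gt0.
move=> y; rewrite lt_min => /andP[yr yc].
have cy : chi2 y != 0.
  apply/eqP => E; have := le_lt_trans (diff2 y p) yc.
  by rewrite E sub0r normrN ltxx.
have [] := Hr y (chi2N _ cy).2; last by move=> _ ->; rewrite qE// row_mxKl.
apply: le_lt_trans yr; rewrite !qE//; apply: norm_le_coord => // j.
have <- : (row_mx (cmap c y) (const_mx (chi2 y)) - row_mx (cmap c p) (const_mx (chi2 p)))
    ord0 (lshift 1 j) = (cmap c y - cmap c p) ord0 j.
  by rewrite [LHS]mxE [X in _ + X = _]mxE !row_mxEl [RHS]mxE [X in _ = _ + X]mxE.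
exact: coord_le_norm.
Qed.

Lemma coords_continuous z n (q : S -> 'rV[R]_n) x : coords z q -> {for x, continuous q}.
Proof. by case=> Cq _ _; apply: rV_continuous => j; apply: Cinf_continuous; exact: Cq. Qed.

Lemma coords_near z n (q : S -> 'rV[R]_n) r x : coords z q -> 0 < r ->
  \forall y \near x, `|q y - q x| < r.
Proof.
move=> cq r0; have /cvgrPdist_lt/(_ r r0) := coords_continuous (x := x) cq.
by apply: filterS => y; rewrite distrC.
Qed.

Lemma coords_basis z n (q : S -> 'rV[R]_n) p A : coords z q -> `|q p - q z| < 1 ->
  nbhs p A -> exists2 r, 0 < r & forall y, `|q y - q p| < r -> A y.
Proof.
move=> [Cq _ Hext] pz /bump_exists[chi [Cchi _ /nbhs_singleton c1 c0]].
have [g [sg [r r0 Hg]]] := Hext p chi pz Cchi.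
have gp : g (q p) = 1 by rewrite -Hg ?c1// subrr normr0.
have cg : {for q p, continuous g} by apply: smooth_on_cont sg _.
have /cvgrPdist_lt/(_ 1 ltr01)/nbhsEP[d d0 Hd] := cg.
exists (Num.min r d); first by rewrite lt_min r0.
move=> y; rewrite lt_min => /andP[yr yd]; apply: contrapT => /c0/nbhs_singleton E.
by have := Hd _ yd; rewrite -(Hg y yr) E gp subr0 normr1 ltxx.
Qed.

End Cinf.

(** * Integral curves *)

Section Curves.
Variables (R : realType) (S : strat_space R).
Local Notation operator := ((S -> R) -> (S -> R)).
Implicit Types (Z X Y : operator) (x y z : S) (I J : set R) (c d : R -> S) (f g : S -> R).
Local Notation deriv Z := (derivation [set: S] (@Cinf R S) Z).

(** Integral curves without the smoothness clause, which the equation implies. *)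
Definition icurve Z x I c := [/\ is_interval I, I 0, c 0 = x &
  forall f, Cinf f -> forall t, I t -> has_deriv I (f \o c) t (Z f (c t))].

Lemma icurve_cvg Z x I c t : icurve Z x I c -> I t -> c @ within I (nbhs t) --> c t.
Proof.
case=> _ _ _ H It; apply: continuous_to_S => f Cf.
exact: has_deriv_cvg (H f Cf t It).
Qed.

Lemma icurve_near Z x I c t (A : S -> Prop) : icurve Z x I c -> I t ->
  (\forall y \near c t, A y) -> exists2 e, 0 < e & forall s, I s -> `|s - t| < e -> A (c s).
Proof.
move=> H It Ax; apply/withinP; exact: (icurve_cvg H It Ax).
Qed.

(** The successive derivatives of [f \o c] are the [iter k Z f \o c]. *)
Lemma integral_curveP Z x I c : deriv Z -> integral_curve Z x I c <-> icurve Z x I c.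
Proof.
move=> [ZC _ _ _]; split.
  case=> iI I0 _ c0 H; split => // f Cf t It.
  by apply/deriv_withinE; apply: H.
move=> Hc; have [iI I0 c0 H] := Hc; split => //; last first.
  by move=> f Cf t It; apply/deriv_withinE; apply: H.
split.
  rewrite continuous_subspace_in => t; rewrite inE => It.
  move=> A nA; have := icurve_cvg Hc It nA.
  change (within I (nbhs t) (c @^-1` A) -> nbhs_subspace (t : subspace I) (c @^-1` A)).
  by rewrite -(nbhs_subspace_in It).
move=> f Cf; exists (fun k => iter k Z f \o c); first by [].
have Ck k : Cinf (iter k Z f) by elim: k => [//|k IH] /=; apply: ZC.
by move=> k t It; apply/deriv_withinE; apply: H.
Qed.

Lemma icurve_sub Z x I J c : icurve Z x I c -> is_interval J -> J 0 -> J `<=` I ->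
  icurve Z x J c.
Proof.
case=> _ _ c0 H iJ J0 JI; split => // f Cf t Jt.
by apply: (has_derivW JI); apply: H => //; apply: JI.
Qed.

(** The components of a derivation in the coordinates are smooth functions,
    hence locally smooth functions of the coordinates. *)
Lemma local_field Z z n (q : S -> 'rV[R]_n) p : deriv Z -> coords z q -> `|q p - q z| < 1 ->
  exists Q : 'rV[R]_n -> 'rV[R]_n, smooth_map_on setT Q /\
  exists2 r, 0 < r & forall y, `|q y - q p| < r ->
    forall j, Z (fun y => q y ord0 j) y = Q (q y) ord0 j.
Proof.
move=> [ZC _ _ _] [Cq _ Hext] pz.
have H j : exists g : 'rV[R]_n -> R, smooth_on setT g /\ exists2 r, 0 < r &
    forall y, `|q y - q p| < r -> Z (fun y => q y ord0 j) y = g (q y).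
  by apply: Hext => //; apply: ZC.
have [g Hg] := choice H; exists (fun v => \row_j g j v); split.
  move=> j; apply: (@eq_smooth_on _ _ _ (g j)); first exact: openT.
    by move=> v _; rewrite mxE.
  by case: (Hg j).
have : \forall v \near q p, forall j y, q y = v -> Z (fun y => q y ord0 j) y = g j v.
  apply: filter_forall_ord => j; have [_ [r r0 Hr]] := Hg j.
  apply/(nbhsEP (fun v => forall y, q y = v -> Z (fun y => q y ord0 j) y = g j v)).
  by exists r => // v vr y E; rewrite -E in vr *; apply: Hr.
move=> /nbhsEP[r r0 Hr]; exists r => // y yr j.
by rewrite mxE; apply: Hr.
Qed.

(** For [interval_ind], coincidence must spread between nearby times. Near a
    time where the curves agree this is uniqueness for the differential
    equation in coordinates; near a time where they differ, smooth functions
    separate them, so that they agree at no nearby time. *)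
Lemma icurve_unique_at Z x y I c d s s' : deriv Z -> icurve Z x I c -> icurve Z y I d ->
  I s -> I s' -> c s = d s -> c s' = d s'.
Proof.
move=> dZ Hc Hd; have [iI _ _ Dc] := Hc; have [_ _ _ Dd] := Hd.
apply: (interval_ind (P := fun t => c t = d t) iI) => t It.
have [E|N] := pselect (c t = d t); last first.
  have [f [Cf fN]] : exists f, Cinf f /\ f (c t) != f (d t).
    apply: contrapT => H; apply: N; apply: Cinf_separates => f Cf.
    by apply: contrapT => fN; apply: H; exists f; split => //; apply/eqP.
  have Hfg := has_derivB (Dc f Cf t It) (Dd f Cf t It).
  have e0 : 0 < `|f (c t) - f (d t)| by rewrite normr_gt0 subr_eq0.
  have /cvgrPdist_lt/(_ _ e0)/withinP[r r0 Hr] := has_deriv_cvg Hfg.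
  exists r => // u u' Iu Iu' ur u'r Pu; exfalso.
  by have := Hr u Iu ur; rewrite /= Pu subrr subr0 ltxx.
have [n [q cq]] := coords_exist (c t).
have zz : `|q (c t) - q (c t)| < 1 by rewrite subrr normr0.
have [Q [sQ [r r0 HQ]]] := local_field dZ cq zz.
have [|L L0 HL] := smooth_map_lipschitz (a := q (c t)) (r := r) (@openT _) sQ; first by [].
have rr : 0 < Num.min r 1 by rewrite lt_min r0 ltr01.
have nc : \forall y \near c t, `|q y - q (c t)| < Num.min r 1 by apply: coords_near cq rr.
have [e1 e10 H1] := icurve_near Hc It nc.
rewrite E in nc; have [e2 e20 H2] := icurve_near Hd It nc; rewrite -E in H2.
pose J := [set u | I u /\ `|u - t| < Num.min e1 e2].
have iJ : is_interval J.
  move=> a b [Ia a1] [Ib b1] u aub; split; first exact: iI aub.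
  by move: a1 b1 aub; rewrite !ltr_norml => /andP[? ?] /andP[? ?] /andP[? ?]; apply/andP; lra.
exists (Num.min e1 e2); first by rewrite lt_min e10.
move=> u u' Iu Iu' ue u'e Pu.
have J1 w : J w -> `|q (c w) - q (c t)| < Num.min r 1.
  by move=> [Iw]; rewrite lt_min => /andP[we _]; apply: H1.
have J2 w : J w -> `|q (d w) - q (c t)| < Num.min r 1.
  by move=> [Iw]; rewrite lt_min => /andP[_ we]; apply: H2.
have JI : J `<=` I by move=> w [].
have [Cq qinj _] := cq.
apply: qinj.
- by have := J1 u' (conj Iu' u'e); rewrite lt_min => /andP[].
- by have := J2 u' (conj Iu' u'e); rewrite lt_min => /andP[].
apply: (@ode_unique R n Q J (q \o c) (q \o d) u u' L) => //.
- move=> w j Jw; have := J1 w Jw; rewrite lt_min => /andP[wr _].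
  rewrite /= -HQ//; apply: (has_derivW JI); apply: (Dc (fun y => q y ord0 j)) => //.
  exact: JI.
- move=> w j Jw; have := J2 w Jw; rewrite lt_min => /andP[wr _].
  rewrite /= -HQ//; apply: (has_derivW JI); apply: (Dd (fun y => q y ord0 j)) => //.
  exact: JI.
- move=> w j Jw; have := J2 w Jw; have := J1 w Jw; rewrite !lt_min => /andP[wr _] /andP[wr' _].
  by apply: HL; apply: ltW.
- by rewrite /= Pu.
Qed.

Lemma icurve_unique Z x I J c d t : deriv Z -> icurve Z x I c -> icurve Z x J d ->
  I t -> J t -> c t = d t.
Proof.
move=> dZ Hc Hd It Jt; have [iI I0 c0 _] := Hc; have [iJ J0 d0 _] := Hd.
have iK : is_interval (I `&` J).
  by move=> a b [? ?] [? ?] u ab; split; [apply: iI ab|apply: iJ ab].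
have Hc' : icurve Z x (I `&` J) c by apply: icurve_sub Hc _ _ _ => // u [].
have Hd' : icurve Z x (I `&` J) d by apply: icurve_sub Hd _ _ _ => // u [].
by apply: (icurve_unique_at (s := 0) dZ Hc' Hd') => //; rewrite c0 d0.
Qed.

(** At a point of [I] which is not in [J], all nearby points of [J] are in
    [I], because both intervals contain 0. *)
Lemma has_deriv_union I J (g : R -> R) t l : is_interval I -> is_interval J -> I 0 -> J 0 ->
  (I t -> has_deriv I g t l) -> (J t -> has_deriv J g t l) -> (I `|` J) t ->
  has_deriv (I `|` J) g t l.
Proof.
move=> iI iJ I0 J0 HI HJ.
have half (A B : set R) : is_interval A -> is_interval B -> A 0 -> B 0 -> A t -> ~ B t ->
    has_deriv A g t l -> has_deriv (A `|` B) g t l.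
  move=> iA iB A0 B0 At nBt HA e e0; have [d d0 Hd] := HA e e0.
  have t0 : t != 0 by apply/eqP => t0; apply: nBt; rewrite t0.
  exists (Num.min d `|t|); first by rewrite lt_min d0 normr_gt0.
  move=> s AB; rewrite lt_min => /andP[sd st]; apply: Hd => //.
  case: AB => // Bs.
  case: (ltrgtP t 0) t0 st => // t1 _ st.
  - have st' : t < s by rewrite ltNge; apply/negP => st'; apply: nBt; apply: (iB s 0) => //; rewrite st' ltW.
    by apply: (iA t 0) => //; move: st; rewrite (ltr0_norm t1) ltr_norml => /andP[? ?]; apply/andP; split; lra.
  - have st' : s < t by rewrite ltNge; apply/negP => st'; apply: nBt; apply: (iB 0 s) => //; rewrite st' ltW.
    by apply: (iA 0 t) => //; move: st; rewrite (gtr0_norm t1) ltr_norml => /andP[? ?]; apply/andP; split; lra.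
have [It|nIt] := pselect (I t); have [Jt|nJt] := pselect (J t).
- move=> _ e e0; have [d1 d10 H1] := HI It e e0; have [d2 d20 H2] := HJ Jt e e0.
  exists (Num.min d1 d2); first by rewrite lt_min d10.
  by move=> s [Is|Js]; rewrite lt_min => /andP[? ?]; [apply: H1|apply: H2].
- by move=> _; apply: half => //; apply: HI.
- by move=> _; rewrite setUC; apply: half => //; apply: HJ.
- by case.
Qed.

Lemma icurve_ext Z x I c d : (forall t, I t -> c t = d t) -> icurve Z x I c -> icurve Z x I d.
Proof.
move=> E [iI I0 c0 H]; split => //; first by rewrite -E.
move=> f Cf t It; rewrite -E//.
by apply: (has_deriv_near ltr01 _ _ (H f Cf t It)) => [s Is _|]; rewrite /= E.
Qed.

Lemma icurve_union Z x I J c d : deriv Z -> icurve Z x I c -> icurve Z x J d ->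
  exists e, icurve Z x (I `|` J) e.
Proof.
move=> dZ Hc Hd; pose e t := if `[<I t>] then c t else d t.
have eI t : I t -> e t = c t by move=> It; rewrite /e asboolT.
have eJ t : J t -> e t = d t.
  by move=> Jt; rewrite /e; case: ifP => // /asboolP It; apply: (icurve_unique dZ Hc Hd).
have [iI I0 e0 HI] : icurve Z x I e by apply: icurve_ext Hc => t /eI.
have [iJ J0 _ HJ] : icurve Z x J e by apply: icurve_ext Hd => t /eJ.
exists e; split => //; last 2 first.
- by left.
- move=> f Cf t IJt; apply: has_deriv_union => //.
    by move=> It; apply: HI.
  by move=> Jt; apply: HJ.
move=> a b [Ia|Ja] [Ib|Jb] u /andP[au ub].
- by left; apply: (iI a b) => //; rewrite au.
- have [u0|u0] := lerP u 0; [left; apply: (iI a 0)|right; apply: (iJ 0 b)] => //.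
    by rewrite au.
  by rewrite ub ltW.
- have [u0|u0] := lerP u 0; [right; apply: (iJ a 0)|left; apply: (iI 0 b)] => //.
    by rewrite au.
  by rewrite ub ltW.
- by right; apply: (iJ a b) => //; rewrite au.
Qed.

Lemma icurve_shift Z x I c s : icurve Z x I c -> I s ->
  icurve Z (c s) [set t | I (t + s)] (fun t => c (t + s)).
Proof.
move=> [iI I0 c0 H] Is; split.
- move=> a b /= Ia Ib u /andP[au ub]; apply: (iI _ _ Ia Ib).
  by rewrite !lerD2r au.
- by rewrite /= add0r.
- by rewrite add0r.
move=> f Cf t It e e0; have [d d0 Hd] := H f Cf _ It e e0.
exists d => // u Iu ud; have := Hd (u + s) Iu.
have -> : u + s - (t + s) = u - t by ring.
exact.
Qed.

Lemma icurve_concat Z x I J c d s : deriv Z -> icurve Z x I c -> I s ->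
  icurve Z (c s) J d -> exists e, icurve Z x [set t | I t \/ J (t - s)] e.
Proof.
move=> dZ Hc Is Hd; have Hs := icurve_shift Hc Is.
have [e He] := icurve_union dZ Hs Hd.
have [iI I0 c0 _] := Hc.
have Hms : ([set t | I (t + s)] `|` J) (- s) by left; rewrite /= addNr.
have := icurve_shift He Hms.
have -> : e (- s) = x.
  rewrite -(icurve_unique dZ Hs He _ Hms) ?addNr//.
  by rewrite /= addNr.
have -> : [set t | ([set t0 | I (t0 + s)] `|` J) (t + - s)] = [set t | I t \/ J (t - s)].
  by apply/seteqP; split => t /=; rewrite /setU /= subrK.
by move=> H; exists (fun t => e (t + - s)).
Qed.

(** Existence of the integral curves for a uniform time near every point. For
    derivations this is equivalent to being a vector field, by
    [vector_field_loc_integrable] and [flow_box]. *)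
Definition loc_integrable Z := forall x, exists2 U, nbhs x U &
  exists2 e : R, 0 < e & forall y, U y -> exists c, icurve Z y [set t | `|t| < e] c.

Lemma itv_ball (e : R) : is_interval [set t : R | `|t| < e].
Proof.
move=> a b /= Ha Hb u; move: Ha Hb; rewrite !ltr_norml.
by move=> /andP[? ?] /andP[? ?] /andP[? ?]; apply/andP; split; lra.
Qed.

Lemma icurve_extend Z x I c t : deriv Z -> loc_integrable Z -> icurve Z x I c -> I t ->
  exists J d, icurve Z x J d /\ exists2 e, 0 < e & forall s, `|s - t| < e -> J s.
Proof.
move=> dZ LI Hc It; have [U Ux [e e0 HU]] := LI (c t).
have [d Hd] := HU (c t) (nbhs_singleton Ux).
have [b Hb] := icurve_concat dZ Hc It Hd.
exists [set s | I s \/ `|s - t| < e], b; split => //.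
by exists e => // s st; right.
Qed.

(** The union of all integral curves from [x]. Each of them can be prolonged
    beyond any of its times, so the equation at any time holds in the union
    because it holds in the interior of some longer curve. *)
Lemma maximal_icurve Z x : deriv Z -> loc_integrable Z ->
  exists I c, icurve Z x I c /\ forall J d, icurve Z x J d -> J `<=` I.
Proof.
move=> dZ LI; pose D := [set t | exists I c, icurve Z x I c /\ I t].
have [c Hc] : {c : R -> S & forall t, D t -> forall I d, icurve Z x I d -> I t -> c t = d t}.
  apply: (@choice _ _ (fun t y => D t -> forall I d, icurve Z x I d -> I t -> y = d t)) => t.
  have [[I [d [Hd It]]]|nD] := pselect (D t); last by exists x => /nD.
  by exists (d t) => _ J b Hb Jt; apply: (icurve_unique dZ Hd Hb).
have D0 : D 0.
  have [U Ux [e e0 HU]] := LI x; have [d Hd] := HU x (nbhs_singleton Ux).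
  by exists [set t | `|t| < e], d; split => //=; rewrite normr0.
exists D, c; split; last by move=> J d Hd t Jt; exists J, d.
split => //.
- move=> a b [I [d [Hd Ia]]] [J [d' [Hd' Jb]]] u aub.
  have [e He] := icurve_union dZ Hd Hd'; exists (I `|` J), e; split => //.
  have [iIJ _ _ _] := He; apply: iIJ aub; [by left|by right].
- by have [I [d [Hd I0]]] := D0; rewrite (Hc 0 D0 I d)//; case: Hd.
move=> f Cf t Dt; have [I [d [Hd It]]] := Dt.
have [J [b [Hb [e e0 He]]]] := icurve_extend dZ LI Hd It.
have [_ _ _ H] := Hb; have Jt : J t by apply: He; rewrite subrr normr0.
have E s : J s -> c s = b s by move=> Js; apply: (Hc s _ J) => //; exists J, b.
rewrite E//; apply: (has_deriv_near e0 _ _ (H f Cf t Jt)).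
  by move=> s _ /He Js; split => //=; rewrite E.
by rewrite /= E.
Qed.

Lemma flowE Z t x y : deriv Z -> loc_integrable Z ->
  flow Z t x y <-> exists I c, [/\ icurve Z x I c, I t & c t = y].
Proof.
move=> dZ LI; split.
  by move=> [I [c [[/(integral_curveP _ _ _ dZ) Hc _] It ct]]]; exists I, c.
move=> [I [c [Hc It ct]]].
have [J [d [Hd Hmax]]] := maximal_icurve x dZ LI.
exists J, d; split.
- split; first exact/integral_curveP.
  move=> K b /(integral_curveP _ _ _ dZ) Hb JK _; apply/seteqP; split => //.
  exact: Hmax Hb.
- exact: Hmax Hc _ It.
- by rewrite -ct; apply: (icurve_unique dZ Hd Hc) => //; apply: Hmax Hc _ It.
Qed.

Section FlowRel.
Variable Z : operator.
Hypotheses (dZ : deriv Z) (LI : loc_integrable Z).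

Lemma flow_fun t x y y' : flow Z t x y -> flow Z t x y' -> y = y'.
Proof.
move=> /(flowE _ _ _ dZ LI)[I [c [Hc It <-]]] /(flowE _ _ _ dZ LI)[J [d [Hd Jt <-]]].
exact: (icurve_unique dZ Hc Hd).
Qed.

Lemma flow_add s t x y z : flow Z s x y -> flow Z t y z -> flow Z (t + s) x z.
Proof.
move=> /(flowE _ _ _ dZ LI)[I [c [Hc Is <-]]] /(flowE _ _ _ dZ LI)[J [d [Hd Jt <-]]].
have [e He] := icurve_concat dZ Hc Is Hd.
apply/(flowE _ _ _ dZ LI); exists [set t | I t \/ J (t - s)], e; split => //.
  by right; rewrite /= addrK.
have Hes := icurve_shift He (or_introl Is).
have Jt' : [set t0 | [set t | I t \/ J (t - s)] (t0 + s)] t by right; rewrite /= addrK.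
have es : e s = c s by apply: (icurve_unique dZ He Hc) => //; left.
rewrite es in Hes; exact: (icurve_unique dZ Hes Hd).
Qed.

Lemma flow_opp t x y : flow Z t x y -> flow Z (- t) y x.
Proof.
move=> /(flowE _ _ _ dZ LI)[I [c [Hc It <-]]]; have [_ I0 c0 _] := Hc.
apply/(flowE _ _ _ dZ LI).
exists [set s | I (s + t)], (fun s => c (s + t)); split.
- exact: (icurve_shift Hc It).
- by rewrite /= addNr.
- by rewrite addNr.
Qed.

End FlowRel.
End Curves.

(** * Local flows are local diffeomorphisms *)

Section Diffeos.
Variables (R : realType) (S : strat_space R).
Implicit Types (x y z : S) (A B U V W : set S) (f g h : S -> R) (phi psi : S -> S).

(** For open sets this is equivalent to [diffeo] ([inverse_diffeosP]).
    Continuity is not mentioned, as smooth functions determine the topology,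
    and only functions smooth on all of [S] are pulled back; in this form
    restrictions and compositions are immediate. *)
Definition inverse_diffeos A B phi psi := [/\ forall x, A x -> B (phi x) /\ psi (phi x) = x,
  forall y, B y -> A (psi y) /\ phi (psi y) = y,
  forall f, Cinf f -> Cinf_on A (f \o phi) & forall f, Cinf f -> Cinf_on B (f \o psi)].

Lemma pullback_cvg A phi x : open A -> A x -> (forall f, Cinf f -> Cinf_on A (f \o phi)) ->
  phi @ x --> phi x.
Proof.
move=> oA Ax H; apply: continuous_to_S => f Cf.
have [h Ch Eh] := Cinf_on_near oA (H f Cf) Ax.
have -> : f (phi x) = h x by exact: (nbhs_singleton Eh).
have Hc : {for x, continuous h} by apply: Cinf_continuous.
by apply: cvg_trans Hc; apply: near_eq_cvg; apply: filterS Eh => y /esym.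
Qed.

Lemma pullback_Cinf_on A B phi f : open A -> open B -> (forall x, A x -> B (phi x)) ->
  (forall f, Cinf f -> Cinf_on A (f \o phi)) -> Cinf_on B f -> Cinf_on A (f \o phi).
Proof.
move=> oA oB AB H Bf; apply: near_Cinf_on => x Ax.
have [h Ch Eh] := Cinf_on_near oB Bf (AB x Ax).
have [h' Ch' Eh'] := Cinf_on_near oA (H h Ch) Ax.
exists h' => //; have := pullback_cvg oA Ax H Eh.
by apply: filterS2 Eh' => y <- /= -> _.
Qed.

Lemma open_pullback A B phi : open A -> open B ->
  (forall f, Cinf f -> Cinf_on A (f \o phi)) -> open [set x | A x /\ B (phi x)].
Proof.
move=> oA oB H; rewrite openE => x [Ax Bx]; apply: filterI; first exact: open_nbhs_nbhs.
exact: (pullback_cvg oA Ax H (open_nbhs_nbhs (conj oB Bx))).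
Qed.

Lemma inverse_diffeosP A B phi psi : open A -> open B ->
  inverse_diffeos A B phi psi <-> diffeo A (Cinf_on A) B (Cinf_on B) phi psi.
Proof.
move=> oA oB; split.
  move=> [H1 H2 C1 C2].
  have AB x : A x -> B (phi x) by case/H1.
  have BA y : B y -> A (psi y) by case/H2.
  split; last 1 first.
  - by move=> f Af; apply: (pullback_Cinf_on oB oA BA C2).
  - split.
      split.
      + by move=> x /AB.
      + move=> x y; rewrite !inE => Ax Ay E.
        by have [_ <-] := H1 x Ax; rewrite E; case: (H1 y Ay).
      + by move=> y By; have [Ay E] := H2 y By; exists (psi y).
    move=> V VA; split.
      move=> [W oW E]; exists [set y | B y /\ W (psi y)].
        exact: open_pullback.
      apply/seteqP; split => y /=.
        move=> [x Vx <-]; have Ax := VA x Vx; have [Bx Ex] := H1 x Ax.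
        by do 2 split => //; rewrite Ex; move: Vx; rewrite E => -[].
      move=> [By [_ Wy]]; have [Ay Ey] := H2 y By; exists (psi y) => //.
      by rewrite E.
    move=> [W oW E]; exists [set x | A x /\ W (phi x)].
      exact: open_pullback.
    apply/seteqP; split => x /=.
      move=> Vx; have Ax := VA x Vx; do 2 split => //.
      by have : (phi @` V) (phi x) by []; rewrite E => -[].
    move=> [Ax [_ Wx]]; have : (B `&` W) (phi x) by split => //; apply: AB.
    rewrite -E => -[x' Vx' Ex']; have Ax' := VA x' Vx'.
    by have [_ <-] := H1 x Ax; rewrite -Ex'; have [_ ->] := H1 x' Ax'.
  - by move=> x /H1[].
  - by move=> f Bf; apply: (pullback_Cinf_on oA oB AB C1).
move=> [[[h1 h2 h3] _] K C1 C2]; split.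
- by move=> x Ax; split; [apply: h1|apply: K].
- by move=> y By; have [x Ax <-] := h3 y By; rewrite K.
- by move=> f Cf; apply: C1; apply: Cinf_cinf_on.
- by move=> f Cf; apply: C2; apply: Cinf_cinf_on.
Qed.

Lemma Cinf_onS A B f : A `<=` B -> Cinf_on B f -> Cinf_on A f.
Proof.
move=> AB Bf x /AB Bx; have [W Wx [h Ch Hh]] := Bf x Bx.
by exists W => //; exists h => // y Wy /AB; apply: Hh.
Qed.

Lemma inverse_diffeos_restr A B A0 B0 phi psi : inverse_diffeos A B phi psi ->
  A0 `<=` A -> B0 `<=` B -> (forall x, A0 x -> B0 (phi x)) -> (forall y, B0 y -> A0 (psi y)) ->
  inverse_diffeos A0 B0 phi psi.
Proof.
move=> [H1 H2 C1 C2] sA sB AB BA; split.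
- by move=> x Ax; split; [apply: AB|case: (H1 x (sA x Ax))].
- by move=> y By; split; [apply: BA|case: (H2 y (sB y By))].
- by move=> f /C1; apply: Cinf_onS.
- by move=> f /C2; apply: Cinf_onS.
Qed.

Lemma inverse_diffeos_comp A B D phi psi phi' psi' : open A -> open B -> open D ->
  inverse_diffeos A B phi psi -> inverse_diffeos B D phi' psi' ->
  inverse_diffeos A D (phi' \o phi) (psi \o psi').
Proof.
move=> oA oB oD [H1 H2 C1 C2] [K1 K2 D1 D2]; split.
- move=> x Ax; have [Bx E] := H1 x Ax; have [Dx E'] := K1 _ Bx.
  by split => //=; rewrite E' E.
- move=> y Dy; have [By E] := K2 y Dy; have [Ay E'] := H2 _ By.
  by split => //=; rewrite E' E.
- move=> f /D1 Hf; apply: (pullback_Cinf_on (f := f \o phi') oA oB) => //.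
  by move=> x /H1[].
- move=> f /C2 Hf; apply: (pullback_Cinf_on (f := f \o psi) oD oB) => //.
  by move=> x /K2[].
Qed.

End Diffeos.

Section VectorFieldFlows.
Variables (R : realType) (S : strat_space R).
Local Notation operator := ((S -> R) -> (S -> R)).
Implicit Types (Z X Y : operator) (x y z : S) (I J : set R) (c d : R -> S) (f g : S -> R).
Local Notation deriv Z := (derivation [set: S] (@Cinf R S) Z).

Lemma flow_icurve Z t x y : deriv Z -> flow Z t x y ->
  exists I c, [/\ icurve Z x I c, I t & c t = y].
Proof. by move=> dZ [I [c [[/(integral_curveP _ _ _ dZ) Hc _] It ct]]]; exists I, c. Qed.

Lemma vector_field_loc_integrable X : vector_field X -> loc_integrable X.
Proof.
move=> [dX H] x; have [U Ux [e e0 HU]] := H x; exists U; first exact: open_nbhs_nbhs.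
have e20 : 0 < e / 2 by rewrite divr_gt0.
exists (e / 2) => // y Uy.
have e2e : e / 2 < e by rewrite ltr_pdivrMr// ltr_pMr// ltr1n.
have [|V1 [phi1 [psi1 [_ _ F1 _]]]] := HU (e / 2); first by rewrite gtr0_norm.
have [|V2 [phi2 [psi2 [_ _ F2 _]]]] := HU (- (e / 2)); first by rewrite normrN gtr0_norm.
have [I [c [Hc It _]]] := flow_icurve dX (F1 y Uy).
have [J [d [Hd Jt _]]] := flow_icurve dX (F2 y Uy).
have [b Hb] := icurve_union dX Hc Hd; exists b.
have [iIJ _ _ _] := Hb.
apply: icurve_sub Hb _ _ _.
- exact: itv_ball.
- by rewrite /= normr0.
- move=> t /=; rewrite ltr_norml => /andP[t1 t2].
  by apply: (iIJ (- (e / 2)) (e / 2)); [right|left|rewrite !ltW].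
Qed.

(** In coordinates [q] around [z] the derivation is a field [Q] of R^n; cut
    off, it has a complete smooth flow [Phi]. As long as the values stay in
    the region where nothing was cut off, [q] maps integral curves of [Z] to
    those of the cut off field, so the time-[t] map of [Z] is [Phi t] read
    through [q] and its inverse is the time-[- t] map. *)
Lemma flow_box Z z (A : set S) : deriv Z -> loc_integrable Z -> nbhs z A ->
  exists2 U, open_nbhs z U & exists2 e : R, 0 < e &
    (forall t : R, `|t| < e -> exists V phi psi, flow_diffeo Z t U V phi psi) /\
    (forall y, U y -> exists c, icurve Z y [set t | `|t| < e] c /\
       forall t, `|t| < e -> A (c t)).
Proof.
move=> dZ LI Az; have [n [q cq]] := coords_exist z.
have zz : `|q z - q z| < 1 by rewrite subrr normr0.
have [Q [sQ [r r0 HQ]]] := local_field dZ cq zz.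
have [U Uz [e e0 HU]] := LI z.
have [r1 r10 Hr1] := coords_basis cq zz (filterI Uz Az).
pose rho := Num.min r (Num.min r1 1).
have rho0 : 0 < rho by rewrite !lt_min r0 r10 ltr01.
have qq : [set v | `|v - q z| < rho] (q z) by rewrite /= subrr normr0.
have [b [sb b01 [r' r'0 Hb] [r2 Hr2] _]] := smooth_cutoff (@open_ball_norm R n (q z) rho) qq.
pose Q' v := b v *: Q v.
have sQ' : smooth_map_on setT Q'.
  move=> j; apply: (@eq_smooth_on _ _ _ (fun v => b v * Q v ord0 j)); first exact: openT.
    by move=> v _; rewrite mxE.
  by apply: smooth_onM => //; exact: openT.
have Q'0 v : r2 <= `|v - q z| -> Q' v = 0 by move=> /Hr2 E; rewrite /Q' E scale0r.
have [Phi [M M0 [fl sPhi grp [HM [L L0 HL]]]]] := compact_field_flow sQ' Q'0.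
pose a := Num.min r' rho; have a0 : 0 < a by rewrite lt_min r'0.
have ar y : `|q y - q z| < a -> [/\ `|q y - q z| < r, U y /\ A y, `|q y - q z| < 1 & Q' (q y) = Q (q y)].
  rewrite /a /rho !lt_min => /andP[yr' /and3P[yr yr1 y1]]; split => //; first exact: Hr1.
  by rewrite /Q'; have [_ ->] := Hb _ yr'; rewrite scale1r.
have M1 : 0 < M + 1 by rewrite ltr_wpDl.
(* in time e' points move by less than a / 4 in the coordinates: those
   starting within a / 2 of z remain within a, where the field was not changed *)
pose e' := Num.min e (a / (4 * (M + 1))).
have e'0 : 0 < e' by rewrite lt_min e0 divr_gt0// mulr_gt0.
have Mt (t : R) : `|t| < e' -> M * `|t| < a / 4.
  rewrite lt_min => /andP[_]; rewrite ltr_pdivlMr ?mulr_gt0// => H.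
  rewrite ltr_pdivlMr//; have := normr_ge0 t; nra.
have [Cq qinj Hext] := cq.
(* the coordinates of integral curves follow Phi, by the same induction on
   intervals as in the uniqueness of integral curves *)
have key y c s : `|q y - q z| < a / 2 -> icurve Z y [set t | `|t| < e] c -> `|s| < e' ->
    q (c s) = Phi s (q y).
  move=> ya Hc se'; have [_ _ c0 Dc] := Hc.
  pose I := [set t : R | `|t| < e'].
  have I0 : I 0 by rewrite /I /= normr0.
  have Ie t : I t -> `|t| < e by rewrite /I /= lt_min => /andP[].
  apply: (interval_ind (P := fun t => q (c t) = Phi t (q y)) (I := I) (@itv_ball _ _) _ I0 se');
    last by rewrite c0 fl.1.
  move=> t It; have [E|N] := pselect (q (c t) = Phi t (q y)); last first.
    have [j Nj] : exists j, q (c t) ord0 j != Phi t (q y) ord0 j.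
      apply: contrapT => H; apply: N; apply/rowP => j.
      by apply: contrapT => /eqP Nj; apply: H; exists j.
    have D1 := has_derivB (Dc _ (Cq j) t (Ie t It)) (has_derivW (@subsetT _ _) (fl.2 t (q y) j)).
    have d0 : 0 < `|q (c t) ord0 j - Phi t (q y) ord0 j| by rewrite normr_gt0 subr_eq0.
    have /cvgrPdist_lt/(_ _ d0)/withinP[d d0' Hd] := has_deriv_cvg D1.
    exists d => // u u' Iu Iu' ud u'd Pu; exfalso.
    by have := Hd u (Ie u Iu) ud; rewrite /= Pu subrr subr0 ltxx.
  have near_a : `|q (c t) - q z| < a.
    rewrite E; have -> : Phi t (q y) - q z = (Phi t (q y) - q y) + (q y - q z) by rewrite subrKA.
    apply: le_lt_trans (ler_normD _ _) _; have := HM t (q y); have := Mt t It; lra.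
  have na : \forall w \near c t, `|q w - q z| < a.
    have d0 : 0 < a - `|q (c t) - q z| by rewrite subr_gt0.
    apply: filterS (coords_near (c t) cq d0) => w wd.
    have -> : q w - q z = (q w - q (c t)) + (q (c t) - q z) by rewrite subrKA.
    by apply: le_lt_trans (ler_normD _ _) _; rewrite -ltrBrDr.
  have [d d0 Hd] := icurve_near Hc (Ie t It) na.
  exists d => // u u' Iu Iu' ud u'd Pu.
  pose J := [set w | I w /\ `|w - t| < d].
  have iJ : is_interval J.
    move=> v w [Iv vd] [Iw wd] x vx; split; first exact: (@itv_ball _ _ v w Iv Iw x vx).
    by move: vd wd vx; rewrite !ltr_norml => /andP[? ?] /andP[? ?] /andP[? ?]; apply/andP; lra.
  have JI w : J w -> `|w| < e by case=> /Ie.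
  apply: (@ode_unique R n Q' J (q \o c) (fun w => Phi w (q y)) u u' L) => //.
  - move=> w j Jw; have [Iw wd] := Jw.
    have [wr _ _ EQ] := ar _ (Hd w (Ie w Iw) wd).
    rewrite /= EQ -HQ//; apply: (has_derivW JI); apply: (Dc _ (Cq j)); exact: Ie.
  - by move=> w j Jw; apply: (has_derivW (@subsetT _ _)); apply: fl.2.
have [cc Hcc] : {cc : S -> R -> S & forall y, `|q y - q z| < a -> icurve Z y [set t | `|t| < e] (cc y)}.
  apply: (@choice _ _ (fun y c => `|q y - q z| < a -> icurve Z y [set t | `|t| < e] c)) => y.
  have [ya|ya] := pselect (`|q y - q z| < a); last by exists (fun=> z).
  by have [_ [Uy _] _ _] := ar y ya; have [c Hc] := HU y Uy; exists c.
have a24 : a / 4 < a / 2 by rewrite ltr_pM2l// ltf_pV2 ?posrE// ltr_nat.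
have a2 : a / 2 < a by rewrite ltr_pdivrMr// ltr_pMr// ltr1n.
have qcc y t : `|q y - q z| < a / 2 -> `|t| < e' -> q (cc y t) = Phi t (q y).
  by move=> ya te; apply: key => //; apply: Hcc; apply: lt_trans a2.
have oball s : open [set y | `|q y - q z| < s].
  rewrite openE => y /= ys; have d0 : 0 < s - `|q y - q z| by rewrite subr_gt0.
  change (\forall w \near y, `|q w - q z| < s).
  apply: filterS (coords_near y cq d0) => w wd /=.
  have -> : q w - q z = (q w - q y) + (q y - q z) by rewrite subrKA.
  by apply: le_lt_trans (ler_normD _ _) _; rewrite -ltrBrDr.
have cPhi t y s : 0 < s -> \forall w \near y, `|Phi t (q w) - Phi t (q y)| < s.
  move=> s0; have c1 : {for y, continuous (fun w => Phi t (q w))}.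
    apply: continuous_comp; first exact: coords_continuous cq.
    exact: smooth_map_on_cont (sPhi t) _.
  by have /cvgrPdist_lt/(_ s s0) := c1; apply: filterS => w; rewrite distrC.
have smooth t y0 f : `|q y0 - q z| < a / 2 -> `|t| < e' -> Cinf f -> `|q (cc y0 t) - q z| < 1 ->
    exists2 h, Cinf h & \forall y \near y0, f (cc y t) = h y.
  move=> ya te Cf p1; have [g [sg [d d0 Hg]]] := Hext (cc y0 t) f p1 Cf.
  exists (fun y => g (Phi t (q y))).
    apply: (Cinf_comp (q := q) (g := fun v => g (Phi t v))) => //.
    exact: (smooth_on_comp (O' := setT) (@openT _) (@openT _) _ (sPhi t) sg).
  apply: filterS (filterI (cPhi t y0 d d0) (open_nbhs_nbhs (conj (oball (a / 2)) ya))).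
  by move=> y [yd y2]; rewrite Hg ?qcc.
exists [set y | `|q y - q z| < a / 4].
  by split => //=; rewrite subrr normr0 divr_gt0.
exists e' => //; split; last first.
  move=> y /= ya; have ya2 := lt_trans ya a24.
  have ca := Hcc y (lt_trans ya2 a2); exists (cc y); split.
    apply: (icurve_sub ca (@itv_ball _ _)); first by rewrite /= normr0.
    by move=> t /=; rewrite lt_min => /andP[].
  move=> t te; have [] // := ar (cc y t); last by move=> _ [].
  rewrite qcc//; have -> : Phi t (q y) - q z = (Phi t (q y) - q y) + (q y - q z) by rewrite subrKA.
  by apply: le_lt_trans (ler_normD _ _) _; have := HM t (q y); have := Mt t te; lra.
move=> t te; have te' : `|- t| < e' by rewrite normrN.
have lt1 y : `|q y - q z| < a / 2 -> `|q y - q z| < 1.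
  by move=> H; have [] := ar y (lt_trans H a2).
pose V := [set y | `|q y - q z| < a / 2 /\ `|Phi (- t) (q y) - q z| < a / 4].
have oV : open V.
  rewrite openE => y [y1 y2]; apply: filterI; first exact: (open_nbhs_nbhs (conj (oball (a / 2)) y1)).
  have d0 : 0 < a / 4 - `|Phi (- t) (q y) - q z| by rewrite subr_gt0.
  apply: filterS (cPhi (- t) y _ d0) => w wd /=.
  have -> : Phi (- t) (q w) - q z = (Phi (- t) (q w) - Phi (- t) (q y)) + (Phi (- t) (q y) - q z) by rewrite subrKA.
  by apply: le_lt_trans (ler_normD _ _) _; rewrite -ltrBrDr.
have grpK s v : Phi (- s) (Phi s v) = v by rewrite -grp addNr fl.1.
have A_V y : `|q y - q z| < a / 4 -> V (cc y t).
  move=> ya; have ya2 := lt_trans ya a24; rewrite /V /= qcc// grpK; split => //.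
  have -> : Phi t (q y) - q z = (Phi t (q y) - q y) + (q y - q z) by rewrite subrKA.
  by apply: le_lt_trans (ler_normD _ _) _; have := HM t (q y); have := Mt t te; lra.
have V_A y : V y -> `|q (cc y (- t)) - q z| < a / 4 by move=> [y1 y2]; rewrite qcc.
exists V, (fun y => cc y t), (fun y => cc y (- t)); split => //.
- move=> y /= ya; apply/flowE => //; exists [set s | `|s| < e], (cc y); split => //.
    by apply: Hcc; apply: lt_trans ya (lt_trans a24 a2).
  by move: te; rewrite /= lt_min => /andP[].
apply/inverse_diffeosP => //; split.
- move=> y ya; split; first exact: A_V.
  have [V1 _] := A_V y ya; have ya2 := lt_trans ya a24.
  apply: qinj; [|exact: lt1|by rewrite qcc// qcc// grpK].
  by apply: lt1; rewrite qcc// qcc// grpK.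
- move=> y Vy; split; first exact: V_A.
  have [y1 _] := Vy; have ya2 := lt_trans (V_A y Vy) a24.
  have E : Phi t (Phi (- t) (q y)) = q y by rewrite -grp addrN fl.1.
  by apply: qinj; [apply: lt1; rewrite qcc// qcc// E|exact: lt1|rewrite qcc// qcc// E].
- move=> f Cf; apply: near_Cinf_on => y /= ya.
  have [h Ch Eh] := smooth t y f (lt_trans ya a24) te Cf (lt1 _ (A_V y ya).1).
  by exists h => //; apply: filterS Eh.
- move=> f Cf; apply: near_Cinf_on => y Vy; have [y1 _] := Vy.
  have [h Ch Eh] := smooth (- t) y f y1 te' Cf (lt1 _ (lt_trans (V_A y Vy) a24)).
  by exists h => //; apply: filterS Eh.
Qed.

Lemma flow_diffeo_restr X t W V W0 V0 phi psi : flow_diffeo X t W V phi psi ->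
  open W0 -> open V0 -> W0 `<=` W -> V0 `<=` V -> (forall x, W0 x -> V0 (phi x)) ->
  (forall y, V0 y -> W0 (psi y)) -> flow_diffeo X t W0 V0 phi psi.
Proof.
move=> [oW oV F /(inverse_diffeosP _ _ oW oV) D] oW0 oV0 sW sV WV VW; split => //.
  by move=> y /sW; apply: F.
by apply/inverse_diffeosP => //; apply: inverse_diffeos_restr D _ _ _ _.
Qed.

Lemma flow_diffeo_comp X s t W V D phi psi phi' psi' : deriv X -> loc_integrable X ->
  flow_diffeo X s W V phi psi ->
  flow_diffeo X t V D phi' psi' -> flow_diffeo X (t + s) W D (phi' \o phi) (psi \o psi').
Proof.
move=> dX LI [oW oV F /(inverse_diffeosP _ _ oW oV) D1] [_ oD F' /(inverse_diffeosP _ _ oV oD) D2].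
split => //.
  move=> y Wy; apply: flow_add (F y Wy) _ => //; apply: F'.
  by case: D1 => H _ _ _; case: (H y Wy).
by apply/inverse_diffeosP => //; apply: inverse_diffeos_comp D1 D2.
Qed.

(** If the statement holds at some time close to [t0], then composing with a
    flow of small time near [c t0] gives it at all times close to [t0],
    earlier or later. *)
Lemma local_flow X x I c t : vector_field X -> icurve X x I c -> I t ->
  exists W V phi psi, flow_diffeo X t W V phi psi /\ W x.
Proof.
move=> vX Hc It; have [dX VF] := vX; have LI := vector_field_loc_integrable vX.
have [iI I0 c0 _] := Hc.
apply: (interval_ind (P := fun t => exists W V phi psi, flow_diffeo X t W V phi psi /\ W x)
  iI _ I0 It); last first.
  have [U [oU Ux] [e e0 HU]] := VF x; have [|V [phi [psi F]]] := HU 0; first by rewrite normr0.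
  by exists U, V, phi, psi.
move=> t0 It0; have [N [oN Nx] [e e0 HN]] := VF (c t0).
have [d d0 Hd] := icurve_near Hc It0 (open_nbhs_nbhs (conj oN Nx)).
exists (Num.min d (e / 2)); first by rewrite lt_min d0 divr_gt0.
move=> s s' Is Is'; rewrite !lt_min => /andP[sd se] /andP[s'd s'e].
move=> [W [V [phi [psi [F Wx]]]]].
have [|V' [phi' [psi' F']]] := HN (s' - s).
  have -> : s' - s = (s' - t0) - (s - t0) by ring.
  apply: le_lt_trans (ler_normB _ _) _; rewrite [e]splitr; exact: ltrD.
have [oW oV Fl /(inverse_diffeosP _ _ oW oV) D] := F.
have [_ oV' Fl' /(inverse_diffeosP _ _ oN oV') D'] := F'.
have [H1 H2 C1 C2] := D; have [K1 K2 D1 D2] := D'.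
have cs : c s = phi x.
  by apply: (flow_fun dX LI) (Fl x Wx); apply/flowE => //; exists I, c.
pose B := [set y | V y /\ N y]; have oB : open B by apply: openI.
pose W0 := [set y | W y /\ B (phi y)].
have oW0 : open W0 by apply: open_pullback.
pose V0 := [set y | V' y /\ B (psi' y)].
have oV0 : open V0 by apply: open_pullback.
have FA : flow_diffeo X s W0 B phi psi.
  apply: (flow_diffeo_restr F) => //.
  - by move=> y [].
  - by move=> y [].
  - by move=> y [].
  - by move=> y By; have [Wy E] := H2 y By.1; split => //; rewrite E.
have FB : flow_diffeo X (s' - s) B V0 phi' psi'.
  apply: (flow_diffeo_restr F') => //.
  - by move=> y [].
  - by move=> y [].
  - by move=> y By; have [Vy E] := K1 y By.2; split => //; rewrite E.
  - by move=> y [].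
have := flow_diffeo_comp dX LI FA FB; rewrite subrK => FC.
exists W0, V0, (phi' \o phi), (psi \o psi'); split => //; split => //.
split; first by case: (H1 x Wx).
by rewrite -cs; apply: Hd.
Qed.

End VectorFieldFlows.

(** * Smooth functions on a stratum *)

Section ManifoldFunctions.
Variables (R : realType) (S : strat_space R).
Implicit Types (x y z : S) (f g h u : S -> R) (i k : stratum_index S).

Lemma at_manifold i a : @stratum_atlas R S i a -> manifold_chart (stratum i) a.
Proof. by have [H _ _ _] := strat_manifold i; apply: H. Qed.

Lemma cdom_stratum i a y : @stratum_atlas R S i a -> cdom a y -> stratum i y.
Proof. by move=> /at_manifold[[W _ ->] _ _] []. Qed.

(** A chart of [S], read in a chart of the stratum, is a smooth map by the
    definition of [smooth_chart]. *)
Lemma manifold_Cinf_crit i u : (forall y, stratum i y ->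
    exists2 h, Cinf h & \forall z \near y, stratum i z -> u z = h z) ->
  manifold_Cinf (@stratum_atlas R S i) u.
Proof.
move=> H a Aa; have [[W oW EW] oimg ha] := at_manifold Aa.
have [g Hg] : {g : 'rV[R]_(cdim a) -> R & forall v y, cdom a y -> cmap a y = v -> u y = g v}.
  apply: (@choice _ _ (fun v r => forall y, cdom a y -> cmap a y = v -> u y = r)) => v.
  have [[y [ay ey]]|N] := pselect (exists y, cdom a y /\ cmap a y = v).
    by exists (u y) => y' ay' ey'; congr u; apply: (homeo_inj ha) => //; rewrite ey'.
  by exists 0 => y ay ey; case: N; exists y.
exists g; last by move=> y ay; apply: Hg.
move=> s v [y ay ev].
have iy := cdom_stratum Aa ay; have [h Ch Eh] := H y iy.
have [c Ac cy] := at_cover y.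
have [G [sG HG]] := Cinf_chart Ch Ac cy.
have [_ _ /(_ i)[_ /(_ a Aa)[hh shh Hhh]]] := at_smooth_chart Ac.
have [N [oN Ny] HN] := near_open (filterI Eh HG).
have [Q [oQ Qy] HQ] := homeo_open ha oN ay Ny.
pose O := (cmap a @` cdom a) `&` Q.
have oO : open O by apply: openI.
have Ov : O v by rewrite -ev; split => //; exists y.
have main w : O w -> exists z, [/\ cdom a z, cmap a z = w, stratum i z & N z].
  by move=> [[z az <-] Qz]; exists z; split => //; [exact: cdom_stratum Aa az|apply: HQ].
have sO : smooth_map_on O hh.
  move=> j; apply: smooth_onS (shh j) => w /main[z [az <- iz /HN[_ [cz _]]]].
  by exists z.
have : smooth_on O g.
  apply: (@eq_smooth_on _ _ _ (fun w => G (hh w)) _ oO).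
    move=> w /main[z [az <- iz /HN[Ez [cz Ez']]]].
    rewrite -(Hg (cmap a z) z az erefl) (Ez iz) Ez'; congr G.
    by rewrite (Hhh z az).
  exact: (smooth_on_comp (O' := setT) oO (@openT _) _ sO sG).
exact.
Qed.

Lemma Cinf_manifold i f : Cinf f -> manifold_Cinf (@stratum_atlas R S i) f.
Proof. by move=> Cf; apply: manifold_Cinf_crit => y _; exists f => //; apply: filterE. Qed.

Lemma homeo_restr (T T' : topologicalType) (A A0 : set T) (B : set T') (f : T -> T') : homeo_on A B f ->
  A0 `<=` A -> homeo_on A0 (f @` A0) f.
Proof.
move=> [[h1 h2 h3] H] sA; split.
  split; first by move=> y Ay; exists y.
    by move=> y z; rewrite !inE => /sA Ay /sA Az; apply: h2; rewrite inE.
  by move=> z [y Ay <-]; exists y.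
move=> V VA; split.
  move=> [W oW E]; have [Q oQ EQ] : open_in B (f @` (A `&` W)).
    by apply/H; [move=> y []|exists W].
  exists Q => //; apply/seteqP; split => z.
    move=> [y Vy <-]; split; first by exists y => //; apply: VA.
    have : (f @` (A `&` W)) (f y).
      by exists y => //; split; [apply/sA/VA|move: Vy; rewrite E => -[]].
    by rewrite EQ => -[].
  move=> [[y Ay <-] Qy]; exists y => //; rewrite E; split => //.
  have : (B `&` Q) (f y) by split => //; apply/h1/sA.
  rewrite -EQ => -[y' [Ay' Wy'] Ey]; suff <- : y' = y by [].
  by apply: h2; rewrite ?inE//; apply: sA.
move=> [Q oQ EQ]; have [W oW EW] : open_in A (A `&` f @^-1` Q).
  apply/H; first by move=> y [].
  exists Q => //; apply/seteqP; split => z.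
    by move=> [y [Ay Qy] <-]; split => //; apply: h1.
  by move=> [Bz Qz]; have [y Ay Ey] := h3 z Bz; exists y => //; split => //; rewrite /preimage /= Ey.
exists W => //; apply/seteqP; split => y.
  move=> Vy; split; first exact: VA.
  have : (f @` V) (f y) by exists y.
  rewrite EQ => -[_ Qy]; have : (A `&` f @^-1` Q) y by split => //; apply/sA/VA.
  by rewrite EW => -[].
move=> [Ay Wy]; have : (A `&` W) y by split => //; apply: sA.
rewrite -EW => -[_ Qy]; have : (f @` A0 `&` Q) (f y) by split => //; exists y.
rewrite -EQ => -[y' Vy' Ey]; suff <- : y' = y by [].
by apply: h2; rewrite ?inE//; apply: sA => //; apply: VA.
Qed.

(** By maximality of the atlas of the stratum. *)
Lemma chart_restr i a (U : set S) : @stratum_atlas R S i a -> open U ->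
  @stratum_atlas R S i (@Chart R S (cdim a) (cdom a `&` U) (cmap a)).
Proof.
move=> Aa oU; have [mc _ comp mx] := strat_manifold i; have [[W oW EW] oimg ha] := mc a Aa.
apply: mx.
  split => /=.
  - by exists (W `&` U); [exact: openI|rewrite EW setIA].
  - rewrite openE => v [y [ay Uy] <-].
    have [Q Qy HQ] := homeo_open ha oU ay Uy.
    have ny : (cmap a @` cdom a) (cmap a y) by exists y.
    apply: (filterS _ (filterI (open_nbhs_nbhs (conj oimg ny)) (open_nbhs_nbhs Qy))).
    by move=> w [[z az <-] Qz]; exists z => //; split => //; apply: HQ.
  - by apply: homeo_restr ha _; move=> y [].
move=> b Ab; have [[h1 s1 H1] [h2 s2 H2]] := comp a b Aa Ab; split.
  exists h1; last by move=> y [ay _]; apply: H1.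
  by move=> j; apply: smooth_onS (s1 j) => v [y [[ay _] by_] <-]; exists y.
exists h2; last by move=> y by_ [ay _]; apply: H2.
by move=> j; apply: smooth_onS (s2 j) => v [y [by_ [ay _]] <-]; exists y.
Qed.

Lemma manifold_Cinf_cvg i g y : manifold_Cinf (@stratum_atlas R S i) g -> stratum i y ->
  forall e, 0 < e -> \forall z \near y, stratum i z -> `|g y - g z| < e.
Proof.
move=> Cg iy e e0; have [_ cov _ _] := strat_manifold i; have [a Aa ay] := cov y iy.
have [[W oW EW] oimg ha] := at_manifold Aa; have [ga sga Hga] := Cg a Aa.
have cga : {for cmap a y, continuous ga} by apply: smooth_on_cont sga _; exists y.
have /cvgrPdist_lt/(_ e e0)/near_open[Q [oQ Qy] HQ] := cga.
have [N Ny HN] := homeo_cont ha oQ ay Qy.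
have Wy : W y by move: ay; rewrite EW => -[].
apply: filterS (filterI (open_nbhs_nbhs Ny) (open_nbhs_nbhs (conj oW Wy))) => z [Nz Wz] iz.
have az : cdom a z by rewrite EW.
by rewrite !Hga//; apply: HQ; apply: HN.
Qed.

(** On the product [(M `&` U) * F] the function [g p.1] is smooth. Its
    pullback to [U] extends [g] because the trivialization sends [y] in [M] to
    [(y, pt)]. *)
Lemma stratum_extension i g x : locally_trivial S ->
  manifold_Cinf (@stratum_atlas R S i) g -> stratum i x ->
  exists2 h, Cinf h & \forall y \near x, stratum i y -> g y = h y.
Proof.
move=> lt Cg ix; have [U [F [pt [k0 [phi [psi [[Ux _] D _ _ Hphi]]]]]]] := lt x i ix.
have [_ _ CD _] := D; have [oU Ux'] := Ux.
pose G (p : S * F) := g p.1.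
have CG : atlas_Cinf (@prod_set R S F i U) (@prod_atlas R S F i U) G.
  split.
    rewrite continuous_subspace_in => p; rewrite inE => Hp; have [[ip _] _] := Hp.
    suff H : G @ within (@prod_set R S F i U) (nbhs p) --> G p.
      move=> A nA; have := H A nA.
      change (within (@prod_set R S F i U) (nbhs p) (G @^-1` A) -> nbhs_subspace (p : subspace (@prod_set R S F i U)) (G @^-1` A)).
      by rewrite -(nbhs_subspace_in Hp).
    apply/cvgrPdist_lt => e e0; rewrite near_withinE.
    have Hn := manifold_Cinf_cvg Cg ip e0.
    have c1 : {for p, continuous (fst : S * F -> S)} by apply: cvg_fst.
    have : \forall q \near p, stratum i q.1 -> `|g p.1 - g q.1| < e by exact: (c1 _ Hn).
    by apply: filterS => q Hq [[iq _] _]; apply: Hq.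
  move=> p c [[ip Up] _] [[[Wc oWc Ec] hc _] compc] cp.
  have [_ cov _ _] := strat_manifold i; have [a0 Aa0 a0p] := cov p.1 ip.
  pose a := @Chart R S (cdim a0) (cdom a0 `&` U) (cmap a0).
  have Aa : open_submanifold (@stratum_atlas R S i) U a.
    by split; [exact: chart_restr|move=> y []].
  have ap : cdom a p.1 by [].
  have [b Ab bp] := at_cover p.2.
  have cab := compc a b Aa Ab.
  have [[W oW EW] oimg ha] := at_manifold Aa.1.
  have [ga sga Hga] := Cg a Aa.1.
  have imgp : (cmap a @` cdom a) (cmap a p.1) by exists p.1.
  have [ga' [sga' [r' r'0 Hr']]] := smooth_extend1 oimg imgp sga.
  have sf : smooth_on setT (fun v : 'rV[R]_(cdim a + cdim b) => ga' (lsubmx v)).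
    apply: (smooth_on_comp (O' := setT) (h := fun v : 'rV_(cdim a + cdim b) => lsubmx v) (@openT _) (@openT _)) => //.
    move=> j; apply: (@eq_smooth_on _ _ _ (fun v => v ord0 (lshift _ j))); first exact: openT.
      by move=> v _; rewrite mxE.
    exact: smooth_on_coord.
  (* in a product chart G only depends on the first group of coordinates; an
     arbitrary chart of the product is compatible with it *)
  have [g' [sg' [W1 W1p [r r0 Hr]]]] := compatible_transfer (d := prod_chart a b) cab cp (conj ap bp) sf.
  have rp : [set v | `|v - cmap c p| < r] (cmap c p) by rewrite /= subrr normr0.
  have [W2 W2p HW2] := homeo_cont hc (@open_ball_norm R _ (cmap c p) r) cp rp.
  have rp' : [set v | `|v - cmap a p.1| < r'] (cmap a p.1) by rewrite /= subrr normr0.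
  have [W3 [oW3 W3p] HW3] := homeo_cont ha (@open_ball_norm R _ (cmap a p.1) r') ap rp'.
  have Wp : W p.1 by move: ap; rewrite EW => -[].
  have n1 : \forall q \near p, W q.1 /\ W3 q.1.
    have c1 : {for p, continuous (fst : S * F -> S)} by apply: cvg_fst.
    apply: (c1 (fun z => W z /\ W3 z)).
    exact: (filterI (open_nbhs_nbhs (conj oW Wp)) (open_nbhs_nbhs (conj oW3 W3p))).
  have n2 : \forall q \near p, cdom b q.2.
    have c1 : {for p, continuous (snd : S * F -> F)} by apply: cvg_snd.
    exact: (c1 _ (open_nbhs_nbhs (conj (cdom_open Ab) bp))).
  have [N Np HN] := near_open (filterI (filterI n1 n2) (filterI (open_nbhs_nbhs W1p) (open_nbhs_nbhs W2p))).
  exists N => //; exists g' => // q /HN[[[Wq W3q] bq] [W1q W2q]] cq.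
  have iq : stratum i q.1 by move: cq; rewrite Ec => -[[[]]].
  have aq : cdom a q.1 by rewrite EW.
  rewrite /G Hga//.
  have <- := Hr q W1q cq (conj aq bq) (HW2 q W2q cq).
  rewrite /= row_mxKl; have [_ ->] := Hr' (cmap a q.1) (HW3 q.1 W3q aq).
  by [].
have [h Ch Eh] := Cinf_on_near oU (CD G CG) Ux'.
exists h => //; apply: filterS (filterI Eh (open_nbhs_nbhs Ux)) => y [Ey Uy] iy.
by rewrite -Ey /= Hphi.
Qed.

End ManifoldFunctions.

(** * Flows preserve the strata *)

Section StrataInvariance.
Variables (R : realType) (S : strat_space R).
Local Notation operator := ((S -> R) -> (S -> R)).
Implicit Types (X Y Z : operator) (x y z : S) (f g h u : S -> R) (i k : stratum_index S).
Local Notation deriv Z := (derivation [set: S] (@Cinf R S) Z).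

Lemma derivation0 (T : Type) (A : set T) (C : set (T -> R)) (D : (T -> R) -> T -> R) (x : T) :
  derivation A C D -> C (fun=> 0) -> A x -> D (fun=> 0) x = 0.
Proof.
move=> [_ _ lin _] C0 Ax; have := lin (-1) _ _ C0 C0 x Ax.
have -> : (fun _ : T => -1 * 0 + 0 : R) = (fun=> 0) by apply/funext => y; rewrite mulr0 addr0.
by rewrite mulN1r addNr.
Qed.

Lemma stratum_uniq i k y : stratum i y -> stratum k y -> i = k.
Proof.
have [[_ tr _] _ _ _] := strat_stratification S => iy ky.
by apply: (tr i k I I); exists y.
Qed.

Lemma stratum_cover y : exists i : stratum_index S, stratum i y.
Proof.
have [[cov _ _] _ _ _] := strat_stratification S.
have : cover [set: stratum_index S] (@stratum R S) y by rewrite cov.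
by move=> [i _ iy]; exists i.
Qed.

(** A bump function makes [f] vanish on the whole stratum, and [X f] on the
    stratum is computed by a derivation of the functions of the stratum. *)
Lemma tangent_zero X i f y : strongly_stratified X -> Cinf f -> stratum i y ->
  (\forall z \near y, stratum i z -> f z = 0) -> X f y = 0.
Proof.
move=> [[dX _] HX] Cf iy near0; have [XM dXM EXM] := HX i.
have [chi [Cchi _ /nbhs_singleton c1 c0]] := bump_exists near0.
have [_ ext _ leib] := dXM; have [_ _ _ leibX] := dX.
have C0 : Cinf (fun _ : S => 0 : R) by exact: Cinf_cst.
have Cfc : Cinf (fun z => f z * chi z) by exact: CinfM.
have E : X (fun z => f z * chi z) y = 0.
  rewrite EXM// (ext _ (fun=> 0)) //.
  - by rewrite -EXM//; exact: (derivation0 dX).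
  - exact: Cinf_manifold.
  - exact: Cinf_manifold.
  - move=> z iz; have [fz|/c0/nbhs_singleton ->] := pselect (stratum i z -> f z = 0).
      by rewrite fz// mul0r.
    by rewrite mulr0.
move: E; rewrite leibX// c1 mulr1 (nbhs_singleton near0 iy) mul0r addr0.
exact.
Qed.

(** Let the coordinates [w] straighten the stratum [k], so that it is given by
    the vanishing of the transverse ones, those of index at least [m]. The
    transverse components of [X] vanish on the stratum by [tangent_zero],
    hence are bounded by a multiple of the transverse coordinates, and
    Gronwall's inequality along the curve keeps these equal to zero. *)
Lemma icurve_stratum_near X x I c t0 k : strongly_stratified X -> icurve X x I c -> I t0 ->
  stratum k (c t0) -> exists2 d, 0 < d & forall s, I s -> `|s - t0| < d -> stratum k (c s).
Proof.
move=> sX Hc It0; set z := c t0 => kz.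
have [[dX _] _] := sX; have [XC _ _ _] := dX.
have [a Aa az] := at_cover z.
have [_ ha /(_ k)[sub _]] := at_smooth_chart Aa.
have [|m [Q [Q' [H [lem [oQ oQ'] Qz [G [HQ GQ' sH sG]] E]]]]] := sub (cmap a z).
  by exists z.
have [H' [sH' [r r0 Hr]]] := smooth_extend oQ Qz sH.
have [chi [Cchi _ c1 c0]] := bump_exists (open_nbhs_nbhs (conj (cdom_open Aa) az)).
pose w y : 'rV[R]_(cdim a) := chi y *: H' (cmap a y).
have Cw j : Cinf (fun y => w y ord0 j).
  have -> : (fun y => w y ord0 j) = (fun y => chi y * H' (cmap a y) ord0 j).
    by apply/funext => y; rewrite mxE.
  apply: Cinf_cutoff (cdom_open Aa) _ Cchi c0.
  exact: (chart_fun_Cinf_on (g := fun v => H' v ord0 j) Aa (sH' j)).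
have [g Hg] := choice (fun j => Cinf_chart (XC _ (Cw j)) Aa az).
pose P y := [/\ cdom a y, w y = H (cmap a y), Q (cmap a y) &
   forall j, X (fun y => w y ord0 j) y = g j (cmap a y)].
have nP : \forall y \near z, P y.
  have n1 : \forall y \near z, cdom a y /\ `|cmap a y - cmap a z| < r.
    by apply: (cmap_near (P := fun v => `|v - cmap a z| < r) Aa az); apply/nbhsEP; exists r.
  have n2 : \forall y \near z, forall j, cdom a y /\ X (fun y => w y ord0 j) y = g j (cmap a y).
    by apply: filter_forall_ord => j; case: (Hg j).
  apply: filterS (filterI (filterI n1 c1) n2) => y [[[ay yr] cy] Hy].
  have [Qy Ey] := Hr _ yr; split => //; first by rewrite /w cy scale1r Ey.
  by move=> j; case: (Hy j).
have stratum_eq y : cdom a y -> Q (cmap a y) -> stratum k y <->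
    (forall i : 'I_(cdim a), (m <= i)%N -> H (cmap a y) ord0 i = 0).
  move=> ay Qy; split.
    move=> ky; have : (H @` (Q `&` cmap a @` (cdom a `&` stratum k))) (H (cmap a y)).
      by exists (cmap a y) => //; split => //; exists y.
    by rewrite E => -[].
  move=> Hy; have : (Q' `&` [set z | forall i : 'I_(cdim a), (m <= i)%N -> z ord0 i = 0]) (H (cmap a y)).
    by split => //; case: (HQ _ Qy).
  rewrite -E => -[v [Qv [y' [ay' ky'] Ev]] EH].
  have : cmap a y' = cmap a y.
    by rewrite Ev; have [_ <-] := HQ _ Qv; rewrite EH; case: (HQ _ Qy).
  by move=> /(homeo_inj ha ay' ay) <-.
have [Q'z GHz] := HQ _ Qz.
have Hz0 (i : 'I_(cdim a)) : (m <= i)%N -> H (cmap a z) ord0 i = 0.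
  by move: i; apply/(stratum_eq z az Qz).
have [N [oN Nz] NP] := near_open nP.
have [r1 r10 Hr1] := cmap_basis Aa az (open_nbhs_nbhs (conj oN Nz)).
have cG : {for H (cmap a z), continuous G} by apply: smooth_map_on_cont sG Q'z.
have : \forall v \near H (cmap a z), Q' v /\ `|G v - cmap a z| < r1.
  apply: filterI; first exact: open_nbhs_nbhs.
  have /cvgrPdist_lt/(_ _ r10) := cG.
  by rewrite GHz; apply: filterS => v; rewrite distrC.
move=> /nbhsEP[r2 r20 Hr2].
(* the component of X along the j-th straightened coordinate, as a function of
   the straightened coordinates *)
pose ph j v := g j (G v).
have ph0 (j : 'I_(cdim a)) v : (m <= j)%N -> `|v - H (cmap a z)| < r2 ->
    (forall i : 'I_(cdim a), (m <= i)%N -> v ord0 i = 0) -> ph j v = 0.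
  move=> mj vr v0; have [Q'v Gv] := Hr2 v vr.
  have [QGv HGv] := GQ' v Q'v.
  have : (Q' `&` [set z | forall i : 'I_(cdim a), (m <= i)%N -> z ord0 i = 0]) v by [].
  rewrite -E => -[p [Qp [y [ay ky] Ey]] Ep].
  have Gvy : G v = cmap a y by rewrite -Ep; have [_ ->] := HQ p Qp.
  have Ny : N y by apply: Hr1 => //; rewrite -Gvy.
  have [_ _ _ PX] := NP y Ny.
  rewrite /ph Gvy -PX; apply: (tangent_zero sX (Cw j) ky).
  apply: filterS (open_nbhs_nbhs (conj oN Ny)) => y' /NP[ay' -> Qy' _] ky'.
  by move/(stratum_eq y' ay' Qy') : ky'; apply.
have r22 : 0 < r2 / 2 by rewrite divr_gt0.
have r2r : r2 / 2 < r2 by rewrite ltr_pdivrMr// ltr_pMr// ltr1n.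
have [||L L0 HL] := smooth_map_lipschitz (V := fun v => \row_j ph j v) (a := H (cmap a z)) (r := r2 / 2) oQ'.
- move=> j; apply: (@eq_smooth_on _ _ _ (fun v => g j (G v))) => //.
    by move=> v _; rewrite mxE.
  by apply: (smooth_on_comp (O' := setT) oQ' (@openT _) _ sG); case: (Hg j).
- by move=> v vr; have [] := Hr2 v (le_lt_trans vr r2r).
(* the transverse part of v; v - tr v is on the straightened stratum *)
pose tr (v : 'rV[R]_(cdim a)) : 'rV[R]_(cdim a) := \row_j (if (m <= j)%N then v ord0 j else 0).
have trB (v : 'rV[R]_(cdim a)) (j : 'I_(cdim a)) : (v - tr v) ord0 j = if (m <= j)%N then 0 else v ord0 j.
  by rewrite [LHS]mxE [X in _ + X]mxE mxE; case: ifP => _; rewrite ?subrr ?subr0.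
have phL (j : 'I_(cdim a)) v : (m <= j)%N -> `|v - H (cmap a z)| <= r2 / 2 -> `|ph j v| <= L * `|tr v|.
  move=> mj vr; have vr' : `|v - tr v - H (cmap a z)| <= r2 / 2.
    apply: norm_le_coord; first exact: ltW.
    move=> i; rewrite [_ ord0 i]mxE trB [X in _ + X]mxE; case: ifP => mi.
      by rewrite Hz0// subr0 normr0 ltW.
    have := coord_le_norm (v - H (cmap a z)) i.
    by rewrite coordB => Hi; apply: le_trans Hi vr.
  have := HL (v - tr v) v j vr' vr; rewrite !mxE.
  have -> : ph j (v - tr v) = 0.
    apply: ph0 => //; first exact: le_lt_trans vr' r2r.
    by move=> i mi; rewrite trB mi.
  have -> : v - (v - tr v) = tr v by rewrite subKr.
  by rewrite subr0.
have nw : \forall y \near z, `|w y - H (cmap a z)| < r2 / 2.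
  have cw : {for z, continuous w}.
    by apply: rV_continuous => j; apply: Cinf_continuous; exact: Cw.
  have wz : w z = H (cmap a z) by have [_ -> _ _] := NP z Nz.
  have /cvgrPdist_lt/(_ _ r22) := cw.
  by rewrite wz; apply: filterS => y; rewrite distrC.
have [d d0 Hd] := icurve_near Hc It0 (filterI nP nw).
exists d => // s Is sd; have [iI _ _ Dc] := Hc.
pose J := [set t | I t /\ `|t - t0| < d].
have iJ : is_interval J.
  move=> u v [Iu ud] [Iv vd] t ut; split; first exact: (iI u v Iu Iv t ut).
  by move: ud vd ut; rewrite !ltr_norml => /andP[? ?] /andP[? ?] /andP[? ?]; apply/andP; lra.
have Jt0 : J t0 by split => //; rewrite subrr normr0.
have Js : J s by [].
have JI : J `<=` I by move=> t [].
pose dw t : 'rV[R]_(cdim a) := \row_j (if (m <= j)%N then X (fun y => w y ord0 j) (c t) else 0).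
have := @gronwall_zero R (cdim a) J (fun t => tr (w (c t))) dw L t0 s iJ Jt0 Js L0.
have [_ wz Qcz _] := NP z Nz.
move=> GZ; have {GZ} GZ : tr (w (c s)) = 0.
  apply: GZ.
  - move=> t j Jt; rewrite mxE; case: ifP => mj; last first.
      by apply: (has_deriv_near ltr01 _ _ (@has_deriv_cst R J 0 t)) => [u Ju _|]; rewrite /tr mxE mj.
    have := Dc _ (Cw j) t (JI t Jt) => /(has_derivW JI).
    by apply: (has_deriv_near ltr01) => [u Ju _|]; rewrite /= /tr [RHS]mxE mj.
  - move=> t j [It td]; have [[at_ wt Qt Xt] wr] := Hd t It td.
    rewrite mxE; case: ifP => mj; last by rewrite normr0 mulr_ge0.
    have [Q't GHt] := HQ _ Qt.
    rewrite Xt; have -> : g j (cmap a (c t)) = ph j (w (c t)) by rewrite /ph wt GHt.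
    by apply: phL => //; apply: ltW.
  - apply/rowP => j; rewrite -/z wz /tr !mxE; case: ifP => // mj; exact: Hz0.
have [[as_ ws Qs _] _] := Hd s Is sd.
apply/(stratum_eq _ as_ Qs) => i mi.
by move/rowP/(_ i) : GZ; rewrite !mxE mi -ws mxE.
Qed.

(** By [icurve_stratum_near] every time has a neighbourhood during which the
    curve stays in one stratum, and the strata are disjoint. *)
Lemma icurve_stratum X x I c i t : strongly_stratified X -> icurve X x I c -> stratum i x ->
  I t -> stratum i (c t).
Proof.
move=> sX Hc ix It; have [iI I0 c0 _] := Hc.
apply: (interval_ind (P := fun t => stratum i (c t)) iI _ I0 It); last by rewrite c0.
move=> t0 It0; have [k kt0] := stratum_cover (c t0).
have [d d0 Hd] := icurve_stratum_near sX Hc It0 kt0.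
exists d => // s s' Is Is' sd s'd Ps.
by rewrite (stratum_uniq Ps (Hd s Is sd)); apply: Hd.
Qed.

Lemma flow_stratum X i t x y : strongly_stratified X -> flow X t x y ->
  stratum i x -> stratum i y.
Proof.
move=> sX; have [[dX _] _] := sX.
move=> /(flow_icurve dX)[I [c [Hc It <-]]] ix.
exact: icurve_stratum sX Hc ix It.
Qed.

End StrataInvariance.

(** * The pushforward of a vector field, cut off *)

Section Localization.
Variables (R : realType) (S : strat_space R).
Local Notation operator := ((S -> R) -> (S -> R)).
Implicit Types (X Y Z : operator) (x y z : S) (f g h u : S -> R) (i k : stratum_index S).
Local Notation deriv Z := (derivation [set: S] (@Cinf R S) Z).

(** A bump function supported where [h1] and [h2] agree makes them equal
    everywhere without changing the values of the derivation at [x]. *)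
Lemma derivation_local Y h1 h2 x : deriv Y -> Cinf h1 -> Cinf h2 ->
  (\forall y \near x, h1 y = h2 y) -> Y h1 x = Y h2 x.
Proof.
move=> [_ _ _ leib] C1 C2 E.
have [chi [Cchi _ /nbhs_singleton c1 c0]] := bump_exists E.
have : Y (fun y => chi y * h1 y) x = Y (fun y => chi y * h2 y) x.
  congr (Y _ x); apply/funext => y; have [->//|/c0/nbhs_singleton ->] := pselect (h1 y = h2 y).
  by rewrite !mul0r.
rewrite !leib// c1 !mul1r (nbhs_singleton E).
by move/addrI.
Qed.

Lemma restr_derivE Y f h x : deriv Y -> Cinf h -> (\forall y \near x, f y = h y) ->
  restr_deriv Y f x = Y h x.
Proof.
move=> dY Ch E; rewrite /restr_deriv.
have E' : \forall y \near x, h y = f y by apply: filterS E.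
have [h' [Ch' Eh' <-]] := xgetPex 0 (ex_intro (fun v => exists h, [/\ Cinf h, \forall y \near x, h y = f y & Y h x = v])
  (Y h x) (ex_intro _ h (And3 Ch E' erefl))).
by apply: derivation_local => //; apply: filterS (filterI Eh' E') => y [-> ->].
Qed.

End Localization.

(** The field [k] of the line is frozen outside [[- e / 2, e / 2]] to make it
    Lipschitz everywhere. Since it is bounded by 1, the solution starting at 0
    does not leave this interval before the time [e / 2] and so does not
    notice the change. *)
Lemma reparametrization (R : realType) (k dk : R -> R) (e B : R) : 0 < e -> 0 <= B ->
  (forall s, `|s| < e -> has_deriv [set s | `|s| < e] k s (dk s)) ->
  (forall s, `|s| < e -> `|dk s| <= B) -> (forall s, `|s| < e -> `|k s| <= 1) ->
  exists tau : R -> R, tau 0 = 0 /\ forall s, `|s| < e / 2 ->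
    `|tau s| < e / 2 /\ has_deriv setT tau s (k (tau s)).
Proof.
move=> e0 B0 Hk HB H1; pose b := e / 2.
have b0 : 0 < b by rewrite divr_gt0.
have be : b < e by rewrite ltr_pdivrMr// ltr_pMr// ltr1n.
pose cl (s : R) := Num.max (- b) (Num.min b s).
have clb s : `|cl s| <= b.
  by rewrite /cl ler_norml le_max lexx ge_max ge_min lexx /= andbT; lra.
have clid s : `|s| < b -> cl s = s.
  rewrite ltr_norml => /andP[? ?]; rewrite /cl min_r ?max_r// ltW//.
have mono s t : s <= t -> cl s <= cl t <= cl s + (t - s).
  rewrite /cl !maxEle !minEle => st; case: (leP b s) => ?; case: (leP b t) => ?;
  case: (leP (- b) b) => ?; case: (leP (- b) s) => ?; case: (leP (- b) t) => ?; apply/andP; split; lra.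
have clL s t : `|cl s - cl t| <= `|s - t|.
  have [st|/ltW st] := leP s t.
    by have /andP[c1 c2] := mono s t st; rewrite !ler0_norm ?subr_le0//; lra.
  by have /andP[c1 c2] := mono t s st; rewrite !ger0_norm ?subr_ge0//; lra.
pose kk s := k (cl s).
have kb s : `|cl s| < e by apply: le_lt_trans (clb s) be.
pose F (v : 'rV[R]_1) : 'rV[R]_1 := const_mx (kk (v ord0 ord0)).
have BL : 0 < B + 1 by rewrite ltr_wpDl.
have [|Phi [P0 PD]] := @picard_flow R 1 F (B + 1) BL.
  move=> u v; apply: norm_le_coord; first by rewrite mulr_ge0// ltW.
  move=> j; rewrite !mxE; apply: (@le_trans _ _ (B * `|cl (u ord0 ord0) - cl (v ord0 ord0)|)).
    exact: (@mean_value_bound R [set s | `|s| < e] (cl (v ord0 ord0)) (cl (u ord0 ord0)) k dk B (@itv_ball R e) (kb _) (kb _) Hk HB).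
  apply: ler_pM => //; first by rewrite lerDl.
  apply: le_trans (clL _ _) _; have := coord_le_norm (u - v) ord0; by rewrite !mxE.
exists (fun s => Phi s 0 ord0 ord0); split; first by rewrite P0 mxE.
move=> s sb; have D1 u := PD u 0 ord0.
have ts : `|Phi s 0 ord0 ord0| <= `|s|.
  have iT : is_interval [set: R] by [].
  have := @mean_value_bound R setT 0 s (fun u => Phi u 0 ord0 ord0) (fun u => F (Phi u 0) ord0 ord0) 1 iT.
  rewrite P0 mxE !subr0 mul1r; apply => // u _; rewrite mxE; exact: H1.
have tb : `|Phi s 0 ord0 ord0| < b by apply: le_lt_trans ts sb.
split => //; have := D1 s; rewrite mxE /kk clid//.
Qed.

Section Transport.
Variables (R : realType) (S : strat_space R).
Local Notation operator := ((S -> R) -> (S -> R)).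
Implicit Types (x y z : S) (f g h u : S -> R) (i k : stratum_index S).
Local Notation deriv Z := (derivation [set: S] (@Cinf R S) Z).
Variables (Y : operator) (W V : set S) (phi psi : S -> S) (chi : S -> R).
Hypotheses (vY : vector_field Y) (oW : open W) (oV : open V).
Hypothesis D : inverse_diffeos W V phi psi.
Hypotheses (Cchi : Cinf chi) (chi01 : forall y, 0 <= chi y <= 1).
Hypothesis chi0 : forall y, ~ V y -> \forall z \near y, chi z = 0.

(** The pushforward of [Y] by [phi], multiplied by a function supported in the
    domain of [psi] so that it is defined everywhere. *)
Definition transport : operator := fun f y => chi y * restr_deriv Y (f \o phi) (psi y).

Let dY : deriv Y. Proof. by case: vY. Qed.
Let WV x : W x -> V (phi x). Proof. by case: D => H _ _ _ /H[]. Qed.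
Let VW y : V y -> W (psi y). Proof. by case: D => _ H _ _ /H[]. Qed.
Let phiK x : W x -> psi (phi x) = x. Proof. by case: D => H _ _ _ /H[]. Qed.
Let psiK y : V y -> phi (psi y) = y. Proof. by case: D => _ H _ _ /H[]. Qed.
Let Cphi f : Cinf f -> Cinf_on W (f \o phi). Proof. by case: D => _ _ + _; apply. Qed.
Let Cpsi f : Cinf f -> Cinf_on V (f \o psi). Proof. by case: D => _ _ _; apply. Qed.

Lemma psi_cvg y : V y -> psi @ y --> psi y.
Proof. by move=> Vy; exact: (pullback_cvg oV Vy Cpsi). Qed.

Lemma phi_cvg x : W x -> phi @ x --> phi x.
Proof. by move=> Wx; exact: (pullback_cvg oW Wx Cphi). Qed.

Lemma transport_out f y : ~ V y -> transport f y = 0.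
Proof. by move=> /chi0/nbhs_singleton E; rewrite /transport E mul0r. Qed.

(** One function [h] represents [f \o phi] at all points near [psi y]; this
    gives the smoothness of [transport f], as [Y h] is smooth. *)
Lemma transport_in f y : Cinf f -> V y -> exists h, [/\ Cinf h,
  \forall x \near psi y, f (phi x) = h x,
  transport f y = chi y * Y h (psi y) &
  \forall z \near y, restr_deriv Y (f \o phi) (psi z) = Y h (psi z)].
Proof.
move=> Cf Vy; have [h Ch Eh] := Cinf_on_near oW (Cphi Cf) (VW Vy).
exists h; split => //; first by rewrite /transport (restr_derivE dY Ch Eh).
have N : \forall z \near y, \forall x \near psi z, (f \o phi) x = h x.
  exact: (psi_cvg Vy (near_join Eh)).
by apply: filterS N => z Ez; exact: restr_derivE.
Qed.

Lemma transport_rep f y h : Cinf h -> V y -> (\forall x \near psi y, f (phi x) = h x) ->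
  transport f y = chi y * Y h (psi y).
Proof. by move=> Ch Vy Eh; rewrite /transport (restr_derivE dY Ch Eh). Qed.

Lemma transport_derivation : deriv transport.
Proof.
have [YC _ lin leib] := dY; split.
- move=> f Cf; apply: Cinf_cutoff oV _ Cchi chi0 => /=.
  apply: near_Cinf_on => y Vy; have [h [Ch _ _ Eh]] := transport_in Cf Vy.
  have [h' Ch' Eh'] := Cinf_on_near oV (Cpsi (YC h Ch)) Vy.
  by exists h' => //; apply: filterS (filterI Eh Eh') => z [-> <-] _.
- move=> f g _ _ E x _; congr (transport _ x); apply/funext => y; exact: E.
- move=> a f g Cf Cg y _; have [Vy|nV] := pselect (V y); last by rewrite !transport_out// mulr0 addr0.
  have [hf [Cf' Ef -> _]] := transport_in Cf Vy; have [hg [Cg' Eg -> _]] := transport_in Cg Vy.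
  rewrite (transport_rep (h := fun z => a * hf z + hg z))//; last 2 first.
  + exact: Cinf_lin.
  + by apply: filterS (filterI Ef Eg) => z [-> ->].
  by rewrite lin//; ring.
- move=> f g Cf Cg y _; have [Vy|nV] := pselect (V y); last by rewrite !transport_out// mul0r mulr0 addr0.
  have [hf [Cf' Ef -> _]] := transport_in Cf Vy; have [hg [Cg' Eg -> _]] := transport_in Cg Vy.
  rewrite (transport_rep (h := fun z => hf z * hg z))//; last 2 first.
  + exact: CinfM.
  + by apply: filterS (filterI Ef Eg) => z [-> ->].
  rewrite leib// -(nbhs_singleton Ef) -(nbhs_singleton Eg) psiK//; ring.
Qed.

(** At a point outside [V] the operator vanishes in a neighbourhood and the
    integral curves are constant. Inside [V] they are images under [phi] of
    integral curves of [Y], reparametrized because of the factor [chi]. *)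
Lemma transport_loc_integrable : loc_integrable transport.
Proof.
move=> z; have [Vz|nVz] := pselect (V z); last first.
  exists (fun y => chi y = 0); first exact: chi0.
  exists 1 => // y cy; exists (fun=> y); split => //.
  - exact: itv_ball.
  - by rewrite /= normr0.
  - move=> f Cf t _; rewrite /transport cy mul0r; exact: has_deriv_cst.
have Wz := VW Vz; have [YC _ _ _] := dY.
have [h Ch Eh] := Cinf_on_near oW (Cphi Cchi) Wz.
have LY := vector_field_loc_integrable vY.
have nB : \forall y \near psi z, `|Y h y| <= `|Y h (psi z)| + 1.
  have cY : {for psi z, continuous (Y h)} by apply: Cinf_continuous; exact: YC.
  have /cvgrPdist_lt/(_ 1 ltr01) := cY; apply: filterS => y.
  have : `|Y h y| <= `|Y h (psi z) - Y h y| + `|Y h (psi z)|.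
    by rewrite [`|Y h (psi z) - Y h y|]distrC -{1}[Y h y](subrK (Y h (psi z))) ler_normD.
  lra.
have nA : \forall y \near psi z, (chi (phi y) = h y /\ `|Y h y| <= `|Y h (psi z)| + 1) /\ W y.
  exact: (filterI (filterI Eh nB) (open_nbhs_nbhs (conj oW Wz))).
have [U [oU Uz] [e e0 [_ HU]]] := flow_box dY LY nA.
exists (fun y => V y /\ U (psi y)).
  apply: filterI; first exact: open_nbhs_nbhs.
  exact: (psi_cvg Vz (open_nbhs_nbhs (conj oU Uz))).
have e20 : 0 < e / 2 by rewrite divr_gt0.
have e2e : e / 2 < e by rewrite ltr_pdivrMr// ltr_pMr// ltr1n.
exists (e / 2) => // y [Vy Uy]; have [c [Hc Ac]] := HU _ Uy.
have [_ _ c0 Dc] := Hc.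
have kE s : `|s| < e -> h (c s) = chi (phi (c s)) by move=> /Ac[[<- _] _].
have [||||tau [tau0 Htau]] := @reparametrization R (h \o c) (fun s => Y h (c s)) e (`|Y h (psi z)| + 1) e0.
- by rewrite addr_ge0.
- by move=> s se; apply: Dc.
- by move=> s /Ac[[_ H] _].
- move=> s se /=; rewrite kE//; have /andP[c1 c2] := chi01 (phi (c s)).
  by rewrite ger0_norm.
exists (fun s => phi (c (tau s))); split.
- exact: itv_ball.
- by rewrite /= normr0.
- by rewrite tau0 c0 psiK.
move=> f Cf s /= se; have [ts Dts] := Htau s se.
have tse : `|tau s| < e by apply: lt_trans e2e.
have [_ Wc] := Ac _ tse.
have [g Cg Eg] := Cinf_on_near oW (Cphi Cf) Wc.
rewrite (transport_rep (h := g)) ?phiK//; last exact: WV.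
rewrite -kE// [h _ * _]mulrC.
have [d d0 Hd] := icurve_near Hc tse Eg.
have := has_deriv_cvg Dts => /cvgrPdist_lt/(_ d d0)/withinP[d' d'0 Hd'].
have DD : has_deriv [set s | `|s| < e / 2] tau s (h (c (tau s))) by apply: (has_derivW (@subsetT _ _)) Dts.
have DC := @has_deriv_comp R [set s | `|s| < e] [set s | `|s| < e / 2] (g \o c) tau s _ _ 1 ltr01 _ DD (Dc g Cg (tau s) tse).
apply: (has_deriv_near d'0 _ _ (DC _)).
- move=> u ue ud; split => //=; have [tu _] := Htau u ue.
  by apply/esym/Hd => //=; [apply: lt_trans e2e|rewrite distrC; apply: Hd'].
- exact: (esym (nbhs_singleton Eg)).
- by move=> u ue _ /=; have [tu _] := Htau u ue; apply: lt_trans e2e.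
Qed.

Lemma transport_vector_field : vector_field transport.
Proof.
split; first exact: transport_derivation.
move=> z; have [U Uz [e e0 [H _]]] := flow_box transport_derivation transport_loc_integrable (filterT : nbhs z setT).
by exists U => //; exists e.
Qed.

End Transport.

(** * Restriction of derivations to strata, and the theorem *)

Section Restriction.
Variables (R : realType) (S : strat_space R).
Local Notation operator := ((S -> R) -> (S -> R)).
Implicit Types (X Y Z : operator) (x y z : S) (f g h u : S -> R) (i k : stratum_index S).
Local Notation deriv Z := (derivation [set: S] (@Cinf R S) Z).

(** Tangency means that the value of [Z] only depends on the function along
    the stratum. By local triviality every smooth function on the stratum is
    locally a restriction, so [Z] can be evaluated on a local extension. *)
Lemma restrict_to_stratum i Z : locally_trivial S -> deriv Z ->
  (forall f y, Cinf f -> stratum i y -> (\forall z \near y, stratum i z -> f z = 0) ->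
    Z f y = 0) ->
  exists2 ZM : operator,
    derivation (stratum i) (manifold_Cinf (@stratum_atlas R S i)) ZM &
    forall f, Cinf f -> forall y, stratum i y -> Z f y = ZM f y.
Proof.
move=> lt dZ tan; have [ZC _ lin leib] := dZ.
pose ext g y h := Cinf h /\ \forall z \near y, stratum i z -> g z = h z.
pose ZM : operator := fun g y => xget 0 [set v | exists2 h, ext g y h & Z h y = v].
have same g y h1 h2 : stratum i y -> ext g y h1 -> ext g y h2 -> Z h1 y = Z h2 y.
  move=> iy [C1 E1] [C2 E2].
  have : Z (fun z => -1 * h2 z + h1 z) y = 0.
    apply: tan => //; first exact: Cinf_lin.
    by apply: filterS (filterI E1 E2) => z [e1 e2] iz; rewrite -e1// -e2// mulN1r addNr.
  by rewrite lin// mulN1r addrC => /subr0_eq.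
have ZME g y h : stratum i y -> ext g y h -> ZM g y = Z h y.
  move=> iy Eh; have [h' Eh' <-] : exists2 h', ext g y h' & Z h' y = ZM g y.
    by apply: (xgetPex 0 (P := [set v | exists2 h, ext g y h & Z h y = v])); exists (Z h y), h.
  exact: same iy Eh' Eh.
have extE g y : manifold_Cinf (@stratum_atlas R S i) g -> stratum i y -> exists h, ext g y h.
  by move=> Cg iy; have [h Ch Eh] := stratum_extension lt Cg iy; exists h.
exists ZM; last first.
  move=> f Cf y iy; apply/esym/ZME => //; split => //; exact: filterE.
split.
- move=> g Cg; apply: manifold_Cinf_crit => y iy; have [h [Ch Eh]] := extE g y Cg iy.
  exists (Z h); first exact: ZC.
  by have := near_join Eh; apply: filterS => z Ez iz; apply: ZME.
- move=> f g Cf Cg E y iy; have [h Eh] := extE g y Cg iy.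
  rewrite (ZME g y h)// (ZME f y h)//; have [Ch Ehh] := Eh; split => //.
  by apply: filterS Ehh => z Ez iz; rewrite E// Ez.
- move=> a f g Cf Cg y iy.
  have [hf Ef] := extE f y Cf iy; have [hg Eg] := extE g y Cg iy.
  rewrite (ZME f y hf)// (ZME g y hg)//; have [Chf Ef'] := Ef; have [Chg Eg'] := Eg.
  rewrite (ZME _ y (fun z => a * hf z + hg z))//; first by rewrite lin.
  split; first exact: Cinf_lin.
  by apply: filterS (filterI Ef' Eg') => z [e1 e2] iz; rewrite e1// e2.
- move=> f g Cf Cg y iy.
  have [hf Ef] := extE f y Cf iy; have [hg Eg] := extE g y Cg iy.
  rewrite (ZME f y hf)// (ZME g y hg)//; have [Chf Ef'] := Ef; have [Chg Eg'] := Eg.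
  rewrite (ZME _ y (fun z => hf z * hg z))//.
    by rewrite leib// (nbhs_singleton Ef')// (nbhs_singleton Eg').
  split; first exact: CinfM.
  by apply: filterS (filterI Ef' Eg') => z [e1 e2] iz; rewrite e1// e2.
Qed.

(** The flow of [X] preserves the strata in both time directions, so [phi]
    pulls functions vanishing on a stratum back to functions vanishing on it,
    and [Y] is tangent to the stratum. *)
Lemma transport_stratified X Y t W V phi psi chi : locally_trivial S ->
  strongly_stratified X -> strongly_stratified Y -> flow_diffeo X t W V phi psi ->
  Cinf chi -> (forall y, 0 <= chi y <= 1) -> (forall y, ~ V y -> \forall z \near y, chi z = 0) ->
  strongly_stratified (transport Y phi psi chi).
Proof.
move=> lt sX sY [oW oV F /(inverse_diffeosP _ _ oW oV) D] Cchi chi01 chi0.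
have [vX _] := sX; have [vY _] := sY; have [dX _] := vX.
split; first exact: (transport_vector_field vY oW oV D Cchi chi01 chi0).
move=> i; apply: restrict_to_stratum => //.
  exact: (transport_derivation vY oW oV D Cchi chi0).
move=> f y Cf iy f0; have [Vy|nV] := pselect (V y); last exact: (transport_out _ _ _ chi0).
have [H1 H2 _ _] := D; have [Wy py] := H2 y Vy.
have LI := vector_field_loc_integrable vX.
have ip : stratum i (psi y).
  have Fy := F _ Wy; rewrite py in Fy.
  exact: (flow_stratum sX (flow_opp dX LI Fy) iy).
have [h [Ch Eh -> _]] := transport_in chi vY oW oV D Cf Vy.
rewrite (tangent_zero sY Ch ip) ?mulr0//.
have pc := phi_cvg oW D Wy; rewrite py in pc.
apply: filterS (filterI (filterI Eh (pc _ f0)) (open_nbhs_nbhs (conj oW Wy))) => z [[<- f0z] Wz] iz.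
by apply: f0z; exact: flow_stratum sX (F z Wz) iz.
Qed.

End Restriction.

Theorem lemma11 (R : realType) (S : strat_space R) (hS : locally_trivial S) :
  locally_complete (@strongly_stratified_fields R S).
Proof.
move=> X Y sX sY t x [x0 Fx]; have [vX _] := sX; have [vY _] := sY; have [dX _] := vX.
have [dY _] := vY; have LI := vector_field_loc_integrable vX.
have [I [c [Hc It _]]] := flow_icurve dX Fx.
have [W [V [phi [psi [FD Wx0]]]]] := local_flow vX Hc It.
have [oW oV F /(inverse_diffeosP _ _ oW oV) D] := FD; have [H1 H2 Cphi Cpsi] := D.
have [Vx _] := H1 _ Wx0; rewrite -(flow_fun dX LI Fx (F _ Wx0)) in Vx.
have [chi [Cchi chi01 chi1 chi0]] := bump_exists (open_nbhs_nbhs (conj oV Vx)).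
have sZ := transport_stratified hS sX sY FD Cchi chi01 chi0.
have [U [oU Ux] HU] := near_open (filterI chi1 (open_nbhs_nbhs (conj oV Vx))).
exists U, (transport Y phi psi chi); split => //.
(* phi has to be restricted to a diffeomorphism onto an open set where chi is
   1 *)
exists [set u | W u /\ U (phi u)], phi, psi; split.
  apply: (flow_diffeo_restr FD) => //.
  - exact: open_pullback oW oU Cphi.
  - by move=> u [].
  - by move=> y /HU[].
  - by move=> u [].
  - by move=> y Uy; have [_ Vy] := HU y Uy; have [Wy py] := H2 y Vy; rewrite /= py.
move=> f Cf y Uy; have [chiy Vy] := HU y Uy; have [Wy py] := H2 y Vy.
have [h Ch Eh] := Cinf_on_near oU Cf Uy.
have [[dZ _] _] := sZ.
rewrite (restr_derivE dZ Ch Eh).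
have [g [Cg Eg -> _]] := transport_in chi vY oW oV D Ch Vy.
rewrite chiy mul1r /pushforward; apply: restr_derivE => //.
have pc := phi_cvg oW D Wy; rewrite py in pc.
by apply: filterS (filterI Eg (pc _ Eh)) => z [<-].
Qed.
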